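(* Let $a$ and $s$ be two free random variables in a non-commutative probability space, where $s$ is semicircular, i.e. $\kappa_2(s)=1$ and $\kappa_n(s)=0$ for every $n\ne2$, and denote $\lambda_n:=\kappa_n(a)$. Then for odd $m\ge1$ one has $\kappa_m(as+sa)=0$, while for even $m=2n$ with $n\ge1$, $$\kappa_{2n}(as+sa)=\sum_{(\mathcal{G},C)\in OCG_n}2^{g_C+1}\prod_{v\in V_{\mathcal{G}}}\lambda_{d(v)},$$ where $V_{\mathcal{G}}$ is the vertex set of $\mathcal{G}$, $d(v)$ is the degree of $v$ in $\mathcal{G}$, $f_C$ is the number of flexible edges of $\mathcal{G}$ without counting the first edge $e_1$ of $C$, and $g_C:=2f_C+1$ if $e_1$ is flexible, $g_C:=2f_C$ if $e_1$ is rigid.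
   Context: A non-commutative probability space $(\mathcal{A},\varphi)$ is a unital algebra over $\mathbb{C}$ with a linear functional $\varphi$, $\varphi(1)=1$. The free cumulants are the multilinear functionals $\kappa_n:\mathcal{A}^n\to\mathbb{C}$ determined recursively by $\varphi(a_1\cdots a_n)=\sum_{\pi\in\mathcal{NC}(n)}\prod_{V\in\pi}\kappa_{|V|}(a_V)$, where $\mathcal{NC}(n)$ is the set of non-crossing partitions of $\{1,\dots,n\}$ and for $V=\{v_1<\dots<v_k\}$, $\kappa_{|V|}(a_V)=\kappa_k(a_{v_1},\dots,a_{v_k})$; $\kappa_n(a):=\kappa_n(a,\dots,a)$. Freeness is free independence, equivalently vanishing of mixed free cumulants in $a,s$. Cacti. In a graph with loops and multiple edges allowed, a cycle is a finite sequence $(v_1,e_1,\dots,v_j,e_j)$ of vertices and edges such that $e_i$ connects $v_i$ with $v_{i+1}$ for $i=1,\dots,j$ (with $v_{j+1}=v_1$); repetitions are allowed. A simple cycle is a cycle with pairwise distinct vertices and pairwise distinct edges, considered up to cyclic rotation and reversal (a loop gives one with $j=1$, a pair of parallel edges one with $j=2$). A cactus is a connected graph in which every edge belongs to at most one simple cycle; an edge is rigid if it belongs to a simple cycle and flexible otherwise. An outercycle (orientation) of a cactus $\mathcal{G}$ is a cycle $C$ passing exactly once through every rigid edge and exactly twice through every flexible edge. Outercycles $C=(v_1,e_1,\dots,v_j,e_j)$ and $C'=(v_1',e_1',\dots,v_j',e_j')$ of $\mathcal{G}$ are considered the same if some automorphism $g$ of $\mathcal{G}$ (acting on vertices and edges)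 satisfies $g(v_i)=v_i'$, $g(e_i)=e_i'$ for all $i$ (cyclic rotations are not otherwise identified). $OCG_n$ is the set of oriented cacti $(\mathcal{G},C)$ ($\mathcal{G}$ a cactus, $C$ an outercycle) with exactly $n$ edges, taken up to isomorphism (a graph isomorphism carrying one outercycle entrywise to the other). Loops count twice in the degree. *)

(* Defs.v *)
From HB Require Import structures.
From mathcomp Require Import all_boot all_order all_algebra.
From mathcomp Require Import complex zify.
From mathcomp Require Import boolp reals.

Set Implicit Arguments.
Unset Strict Implicit.
Unset Printing Implicit Defensive.

Import GRing.Theory.
Local Open Scope ring_scope.

Section FreeCumulants.

Definition noncrossing n (P : {set {set 'I_n}}) : bool :=
  [forall V in P, forall W in P, forall i in V, forall k in V,
   forall j in W, forall l in W, [&& i < j, j < k & k < l]%N ==> (V == W)].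

Definition NC n : {set {set {set 'I_n}}} :=
  [set P | partition P [set: 'I_n] & noncrossing P].

(* [enum V] lists the block V in increasing order, so this is a_V. *)
Definition subword (T : Type) (w : seq T) (V : {set 'I_(size w)}) : seq T :=
  [seq tnth (in_tuple w) i | i <- enum V].

Lemma size_subword (T : Type) (w : seq T) (V : {set 'I_(size w)}) :
  size (subword V) = #|V|.
Proof. by rewrite size_map -cardE. Qed.

Variables (K : comNzRingType) (A : algType K) (phi : A -> K).

(* The moment-cumulant formula solved for the one-block partition.  The fuel N
   only has to be at least the length of the word: see
   [free_cumulant_momentE]. *)
Fixpoint free_cumulant_rec (N : nat) (w : seq A) : K :=
  if N is N'.+1 then
    phi (\prod_(x <- w) x)
    - \sum_(P in NC (size w) | P != [set [set: 'I_(size w)]])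
        \prod_(V in P) free_cumulant_rec N' (subword V)
  else 0.

Definition free_cumulant (w : seq A) : K := free_cumulant_rec (size w) w.

Definition kappa (n : nat) (x : A) : K := free_cumulant (nseq n x).

Lemma card_block_lt n (P : {set {set 'I_n}}) (V : {set 'I_n}) :
  P \in NC n -> P != [set [set: 'I_n]] -> V \in P -> (#|V| < n)%N.
Proof.
rewrite inE => /andP[partP _] neP VP.
rewrite -[X in (_ < X)%N]card_ord -cardsT; apply: proper_card.
rewrite properT; apply: contra neP => /eqP VT; rewrite VT in VP.
have /and3P[_ /trivIsetP trivP P0] := partP.
rewrite eqEsubset sub1set VP andbT.
apply/subsetP => W WP; rewrite inE; apply: contraT => neW.
have := trivP _ _ WP VP neW; rewrite -setI_eq0 setIT => /eqP W0.
by rewrite -W0 WP in P0.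
Qed.

Lemma card_block_gt0 n (P : {set {set 'I_n}}) (V : {set 'I_n}) :
  P \in NC n -> V \in P -> (0 < #|V|)%N.
Proof.
rewrite inE => /andP[/and3P[_ _ P0] _] VP.
by rewrite card_gt0; apply: contraNneq P0 => <-.
Qed.

Lemma free_cumulant_recE N (w : seq A) :
  (size w <= N)%N -> (0 < size w)%N ->
  free_cumulant_rec N w = free_cumulant w.
Proof.
suff rec_eq M M' (v : seq A) :
    (size v <= M)%N -> (size v <= M')%N -> (0 < size v)%N ->
    free_cumulant_rec M v = free_cumulant_rec M' v.
  by move=> wN w0; apply: rec_eq.
elim: M M' v => [|M IH] [|M'] v vM vM' v0 /=; try lia.
congr (_ - _); apply: eq_bigr => P /andP[PNC neP]; apply: eq_bigr => V VP.
have Vlt := card_block_lt PNC neP VP.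
have V0 := card_block_gt0 PNC VP.
by apply: IH; rewrite size_subword //; lia.
Qed.

Lemma setT_in_NC n : (0 < n)%N -> [set [set: 'I_n]] \in NC n.
Proof.
move=> n0; rewrite inE; apply/andP; split.
  rewrite /partition /cover big_set1 eqxx /=; apply/andP; split.
    by apply/trivIsetP => U W /set1P-> /set1P->; rewrite eqxx.
  by rewrite inE eq_sym -card_gt0 cardsT card_ord.
apply/forall_inP => V /set1P->; apply/forall_inP => W /set1P->.
apply/forall_inP => i _; apply/forall_inP => k _; apply/forall_inP => j _.
by apply/forall_inP => l _; rewrite eqxx implybT.
Qed.

Lemma subwordT (T : Type) (w : seq T) : subword [set: 'I_(size w)] = w.
Proof.
by rewrite /subword enum_setT -enumT -[RHS]/(tval (in_tuple w)) map_tnth_enum.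
Qed.

Lemma free_cumulant_momentE (w : seq A) : (0 < size w)%N ->
  phi (\prod_(x <- w) x) =
    \sum_(P in NC (size w)) \prod_(V in P) free_cumulant (subword V).
Proof.
move=> w0; rewrite (bigD1 _ (setT_in_NC w0)) /= big_set1 subwordT.
rewrite -(free_cumulant_recE (leqnSn (size w)) w0) /= -addrA.
rewrite -[LHS]addr0; congr (_ + _); apply/esym/eqP.
rewrite addrC subr_eq0; apply/eqP.
apply: eq_bigr => P /andP[PNC neP]; apply: eq_bigr => V VP.
have Vlt := card_block_lt PNC neP VP.
have V0 := card_block_gt0 PNC VP.
by rewrite free_cumulant_recE ?size_subword // ltnW.
Qed.

(* Free independence of the unital subalgebras generated by x and y, whose
   elements are the p(x), resp. the p(y), for p : {poly K}: an alternating
   product of centred elements is centred.  A factor (b, p) stands for p(x)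
   when b is true and for p(y) otherwise. *)
Definition free_pair (x y : A) : Prop :=
  forall w : seq (bool * {poly K}),
    let factor (f : bool * {poly K}) : A :=
      horner_alg (if f.1 then x else y) f.2 in
    w != [::] ->
    sorted (fun f g => f.1 != g.1) w ->
    (forall f, f \in w -> phi (factor f) = 0) ->
    phi (\prod_(f <- w) factor f) = 0.

Definition semicircular (x : A) : Prop :=
  kappa 2%N x = 1 /\ forall n : nat, (0 < n)%N -> n != 2%N -> kappa n x = 0.

End FreeCumulants.

(* A multigraph assigns to each edge its set of endpoints, which has one
   element for a loop and two otherwise. *)
Record multigraph (V E : finType) := Multigraph {
  ends :> {ffun E -> {set V}};
  endsP : [forall e, 0 < #|ends e| <= 2]%N }.

HB.instance Definition _ V E := [isSub for @ends V E].
HB.instance Definition _ V E := [Finite of multigraph V E by <:].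

Section Cacti.
Variables (V E : finType) (G : multigraph V E).
Implicit Types (c : seq (V * E)) (e : E) (u v : V).

Definition degree v : nat :=
  (\sum_(e | v \in ends G e) if #|ends G e| == 1 then 2 else 1)%N.

Definition connected : Prop :=
  forall u v, connect (fun x y => [exists e, ends G e == [set x; y]]) u v.

(* (v_1, e_1, ..., v_j, e_j) is encoded as [:: (v_1, e_1); ...; (v_j, e_j)]. *)
Definition is_cycle c : Prop :=
  c != [::] /\ cycle (fun x y => ends G x.2 == [set x.1; y.1]) c.

Definition is_simple_cycle c : Prop :=
  [/\ is_cycle c, uniq (unzip1 c) & uniq (unzip2 c)].

(* Reversal, read from v_j:
   (v_j, e_{j-1}, v_{j-1}, e_{j-2}, ..., v_2, e_1, v_1, e_j). *)
Definition reverse_cycle c : seq (V * E) :=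
  zip (rev (unzip1 c)) (rot 1 (rev (unzip2 c))).

Definition same_cycle c c' : Prop :=
  exists r, c' = rot r c \/ c' = rot r (reverse_cycle c).

Definition is_cactus : Prop :=
  connected /\
  forall e c c', is_simple_cycle c -> is_simple_cycle c' ->
    e \in unzip2 c -> e \in unzip2 c' -> same_cycle c c'.

Definition rigid e : bool :=
  `[< exists2 c, is_simple_cycle c & e \in unzip2 c >].

Definition flexible e : bool := ~~ rigid e.

Definition is_outercycle c : Prop :=
  is_cycle c /\
  forall e, count_mem e (unzip2 c) = if rigid e then 1%N else 2%N.

(* f_C and g_C; the empty sequence, on which [g_stat] is 0, is not a cycle. *)
Definition f_stat c : nat :=
  #|[set e | flexible e & Some e != ohead (unzip2 c)]|.

Definition g_stat c : nat :=
  if c is (_, e1) :: _ then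
    (if flexible e1 then (2 * f_stat c).+1 else 2 * f_stat c)%N
  else 0%N.

End Cacti.

Definition oriented_iso (V E V' E' : finType)
    (G : multigraph V E) (c : seq (V * E))
    (G' : multigraph V' E') (c' : seq (V' * E')) : Prop :=
  exists (g : V -> V') (h : E -> E'),
    [/\ bijective g, bijective h,
        forall e, ends G' (h e) = g @: ends G e &
        c' = [seq (g x.1, h x.2) | x <- c]].

(* Pairs (G, C) with edge set 'I_n and vertex set some 'I_k.  For 0 < n the
   bounds 2n on k and on the length of C lose nothing, as the length of an
   outercycle is at most 2n and it visits all the vertices: see
   [OCG_complete]. *)
Definition oriented_graph (n : nat) : Type :=
  {k : 'I_(2 * n).+1%N &
   (multigraph 'I_k 'I_n * (2 * n)%N.-bseq ('I_k * 'I_n))%type}.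

HB.instance Definition _ n := Finite.on (oriented_graph n).

Section OCG.
Variable n : nat.
Implicit Types x y : oriented_graph n.

Definition og_graph x : multigraph 'I_(tag x) 'I_n := (tagged x).1.
Definition og_cycle x : seq ('I_(tag x) * 'I_n) := (tagged x).2.

Definition oriented_cacti : {set oriented_graph n} :=
  [set x | `[< is_cactus (og_graph x) /\
               is_outercycle (og_graph x) (og_cycle x) >]].

Definition og_iso x y : bool :=
  `[< oriented_iso (og_graph x) (og_cycle x) (og_graph y) (og_cycle y) >].

(* One representative of each isomorphism class. *)
Definition OCG : {set oriented_graph n} :=
  transversal (equivalence_partition og_iso oriented_cacti) oriented_cacti.

End OCG.

Section IsoFacts.

Lemma oriented_iso_refl V E (G : multigraph V E) c : oriented_iso G c G c.
Proof.
exists id, id; split; try by exists id.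
  by move=> e; rewrite imset_id.
by rewrite -[LHS]map_id; apply: eq_map => -[].
Qed.

Lemma oriented_iso_sym V E V' E' (G : multigraph V E) c
    (G' : multigraph V' E') c' :
  oriented_iso G c G' c' -> oriented_iso G' c' G c.
Proof.
move=> [g [h [[g' gK g'K] [h' hK h'K] Gh ->]]]; exists g', h'; split.
- by exists g.
- by exists h.
- move=> e; rewrite -{2}[e]h'K Gh -imset_comp -[LHS]imset_id.
  by apply: eq_imset => v /=; rewrite gK.
- rewrite -map_comp -[LHS]map_id; apply: eq_map => -[v e] /=.
  by rewrite gK hK.
Qed.

Lemma oriented_iso_trans V E V' E' V'' E'' (G : multigraph V E) c
    (G' : multigraph V' E') c' (G'' : multigraph V'' E'') c'' :
  oriented_iso G c G' c' -> oriented_iso G' c' G'' c'' ->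
  oriented_iso G c G'' c''.
Proof.
move=> [g [h [bg bh Gh ->]]] [k [l [bk bl Gl ->]]].
exists (k \o g), (l \o h); split; try exact: bij_comp.
  by move=> e; rewrite /= Gl Gh -imset_comp.
by rewrite -map_comp; apply: eq_map => -[].
Qed.

Section Transport.
Variables (V E V' E' : finType) (G : multigraph V E) (G' : multigraph V' E').
Variables (g : V -> V') (h : E -> E').
Hypotheses (bg : bijective g) (bh : bijective h).
Hypothesis Gh : forall e, ends G' (h e) = g @: ends G e.
Let m (x : V * E) := (g x.1, h x.2).

Lemma unzip1_transport c : unzip1 (map m c) = map g (unzip1 c).
Proof. by rewrite /unzip1 -!map_comp. Qed.

Lemma unzip2_transport c : unzip2 (map m c) = map h (unzip2 c).
Proof. by rewrite /unzip2 -!map_comp. Qed.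

Lemma ends_transport e u v :
  (ends G' (h e) == [set g u; g v]) = (ends G e == [set u; v]).
Proof.
rewrite Gh -imset_set1 -[[set g v]]imset_set1 -imsetU.
by apply/eqP/eqP => [|->//]; exact: (imset_inj (bij_inj bg)).
Qed.

Lemma is_cycle_transport c : is_cycle G' (map m c) <-> is_cycle G c.
Proof.
rewrite /is_cycle -!size_eq0 size_map cycle_map.
rewrite (@eq_cycle _ _ (fun x y => ends G x.2 == [set x.1; y.1])) //.
by move=> x y /=; rewrite ends_transport.
Qed.

Lemma is_simple_cycle_transport c :
  is_simple_cycle G' (map m c) <-> is_simple_cycle G c.
Proof.
rewrite /is_simple_cycle unzip1_transport unzip2_transport.
rewrite (map_inj_uniq (bij_inj bg)) (map_inj_uniq (bij_inj bh)).
by split=> -[/is_cycle_transport].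
Qed.

Lemma transport_surj (c' : seq (V' * E')) : exists c, c' = map m c.
Proof.
have [g' _ g'K] := bg; have [h' _ h'K] := bh.
exists [seq (g' x.1, h' x.2) | x <- c'].
rewrite -map_comp -[LHS]map_id; apply: eq_map => -[v e] /=.
by rewrite /m /= g'K h'K.
Qed.

Lemma rigid_transport e : rigid G' (h e) = rigid G e.
Proof.
have hI := bij_inj bh.
apply/asboolP/asboolP => -[c sc ec].
  have [d cE] := transport_surj c; exists d.
    by apply/is_simple_cycle_transport; rewrite -cE.
  by move: ec; rewrite cE unzip2_transport mem_map.
exists (map m c); first exact/is_simple_cycle_transport.
by rewrite unzip2_transport mem_map.
Qed.

Lemma reverse_cycle_transport c :
  reverse_cycle (map m c) = map m (reverse_cycle c).
Proof.
rewrite /reverse_cycle unzip1_transport unzip2_transport.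
rewrite -!map_rev -map_rot; elim: (rev _) (rot _ _) => [|x s IH] [|y t] //=.
by rewrite IH.
Qed.

Lemma same_cycle_transport c d :
  same_cycle c d -> same_cycle (map m c) (map m d).
Proof.
by case=> r [->|->]; exists r; [left|right];
  rewrite ?reverse_cycle_transport map_rot.
Qed.

Lemma is_cactus_transport : is_cactus G -> is_cactus G'.
Proof.
have hI := bij_inj bh; have [g' gK g'K] := bg.
case=> conG cacG; split=> [u' v'|e' c' d'].
  rewrite -[u']g'K -[v']g'K; move: (g' u') (g' v') => u v.
  have /connectP[p] := conG u v; elim: p u => [|w p IH] u /=.
    by move=> _ ->; apply: connect0.
  case/andP=> /existsP[e uw] pw vl; apply: connect_trans (IH _ pw vl).
  by apply: connect1; apply/existsP; exists (h e); rewrite ends_transport.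
have [h' _ h'K] := bh; rewrite -[e']h'K; move: (h' e') => e.
have [c ->] := transport_surj c'; have [d ->] := transport_surj d'.
rewrite !is_simple_cycle_transport !unzip2_transport !mem_map // => sc sd ec ed.
exact/same_cycle_transport/(cacG e).
Qed.

Lemma is_outercycle_transport c :
  is_outercycle G c -> is_outercycle G' (map m c).
Proof.
have hI := bij_inj bh; have [h' _ h'K] := bh.
case=> cc nc; split; first exact/is_cycle_transport.
move=> e'; rewrite -[e']h'K rigid_transport -nc unzip2_transport count_map.
by apply: eq_count => e /=; rewrite inj_eq.
Qed.

End Transport.

Lemma oriented_iso_cactus V E V' E' (G : multigraph V E) c
    (G' : multigraph V' E') c' :
  oriented_iso G c G' c' -> is_cactus G /\ is_outercycle G c ->
  is_cactus G' /\ is_outercycle G' c'.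
Proof.
move=> [g [h [bg bh Gh ->]]] [cG oc]; split.
  exact: (is_cactus_transport bg bh Gh).
exact: is_outercycle_transport.
Qed.

Lemma outercycle_size V E (G : multigraph V E) c :
  is_outercycle G c -> (size c <= 2 * #|E|)%N.
Proof.
case=> _ nc; rewrite -(size_map snd) -/(unzip2 c).
have <- : (\sum_(e : E) count_mem e (unzip2 c))%N = size (unzip2 c).
  elim: (unzip2 c) => [|e s IH] /=; first by rewrite big1.
  rewrite big_split /= IH (bigD1 e) //= eqxx big1 ?addn0 // => e' /negPf.
  by rewrite eq_sym => ->.
rewrite mulnC -sum_nat_const; apply: leq_sum => e _.
by rewrite nc; case: ifP.
Qed.

Lemma outercycle_card V E (G : multigraph V E) c :
  (0 < #|E|)%N -> is_cactus G -> is_outercycle G c -> (#|V| <= size c)%N.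
Proof.
move=> /card_gt0P[e0 _] [conG _] [[_ cyc] nc].
rewrite -(size_map fst) -/(unzip1 c) cardT.
apply: uniq_leq_size => [|v _]; first exact: enum_uniq.
have [e ve] : exists e, v \in ends G e.
  have /forallP/(_ e0)/andP[/card_gt0P[w we] _] := endsP G.
  have /connectP[[|x p]] := conG v w; first by move=> _ /= <-; exists e0.
  by case/andP=> /existsP[e /eqP vx] _ _; exists e; rewrite vx !inE eqxx.
have : e \in unzip2 c by rewrite -has_pred1 has_count nc; case: ifP.
case/mapP=> x xc ex; have := next_cycle cyc xc.
rewrite -ex => /eqP endsE; move: ve; rewrite endsE !inE => /orP[] /eqP->.
  exact: map_f.
by apply: map_f; rewrite mem_next.
Qed.

End IsoFacts.

Lemma og_iso_equiv n :
  {in oriented_cacti n & &, equivalence_rel (@og_iso n)}.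
Proof.
move=> x y z _ _ _; split; first exact/asboolP/oriented_iso_refl.
move=> /asboolP xy; apply/asboolP/asboolP.
  by apply: oriented_iso_trans; apply: oriented_iso_sym.
exact: oriented_iso_trans.
Qed.

Lemma OCG_complete n (V E : finType) (G : multigraph V E) c :
  (0 < n)%N -> #|E| = n -> is_cactus G -> is_outercycle G c ->
  exists! x, x \in OCG n /\ oriented_iso G c (og_graph x) (og_cycle x).
Proof.
move=> n0 En cG oc; subst n.
have sc := outercycle_size oc.
have Vk : (#|V| < (2 * #|E|).+1)%N.
  by rewrite ltnS (leq_trans (outercycle_card n0 cG oc)).
pose f := [ffun i : 'I_#|E| => enum_rank @: ends G (enum_val i)].
have fP : [forall i, 0 < #|f i| <= 2]%N.
  apply/forallP => i; rewrite ffunE card_imset; last exact: enum_rank_inj.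
  exact: (forallP (endsP G)).
pose d := [seq (enum_rank x.1, enum_rank x.2) | x <- c].
have sd : (size d <= 2 * #|E|)%N by rewrite size_map.
pose x0 : oriented_graph #|E| :=
  @Tagged _ (Ordinal Vk)
    (fun k : 'I_(2 * #|E|).+1%N =>
       (multigraph 'I_k 'I_#|E| * (2 * #|E|)%N.-bseq ('I_k * 'I_#|E|))%type)
    (Multigraph fP, Bseq sd).
have iso0 : oriented_iso G c (og_graph x0) (og_cycle x0).
  exists enum_rank, enum_rank; split=> //; try exact: enum_rank_bij.
  by move=> e; rewrite ffunE enum_rankK.
have Dx0 : x0 \in oriented_cacti #|E|.
  by rewrite inE; apply/asboolP/(oriented_iso_cactus iso0).
set P := equivalence_partition (@og_iso #|E|) (oriented_cacti #|E|).
have partP : partition P _ := equivalence_partitionP (@og_iso_equiv _).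
have trP := transversalP partP.
have /and3P[/eqP covP tiP _] := partP.
have PB : pblock P x0 \in P by rewrite pblock_mem ?covP.
have sub x : x \in OCG #|E| -> x \in oriented_cacti #|E|.
  by move: x; apply/subsetP/(transversal_sub trP).
pose y := transversal_repr x0 (OCG #|E|) (pblock P x0).
have yO : y \in OCG #|E| := repr_mem_transversal trP x0 PB.
have yB : y \in pblock P x0 := repr_mem_pblock trP x0 PB.
have isoP x : x \in OCG #|E| ->
    oriented_iso G c (og_graph x) (og_cycle x) <-> x \in pblock P x0.
  move=> xO; rewrite (pblock_equivalence_partition (@og_iso_equiv _)) //;
    last exact: sub.
  split=> [iso|/asboolP]; last exact: oriented_iso_trans.
  by apply/asboolP; apply: oriented_iso_trans iso; apply: oriented_iso_sym.
exists y; split; first by split=> //; apply/isoP.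
move=> z [zO zi]; have zB := (isoP z zO).1 zi; apply: (pblock_inj trP) => //.
by rewrite (same_pblock tiP yB) (same_pblock tiP zB).
Qed.

(* Main.v *)
(** By freeness, phi of a word in a and s is computed by choosing the block of
    its first letter, all blocks being monochromatic.  This determines the
    generating series of the moments phi(l y^m r), y = as + sa, l and r in
    {1, a, s}, through a system of linear recursions.  Eliminating everything but the moments of y leaves
    m0 = 1 + T(t^2 m0^2), so that T is the series of the even cumulants, where
    T(z) = 4 z F_1^2 + 2 z Q F_2 with Q = 1 + z F_2 Q and
    F_d = lambda_d + 4 z F_1 F_(d+1) + z Q F_(d+2).

    On the other side, the first edge of an outercycle of a cactus is either a
    bridge, giving two closed walks around disjoint cacti, or lies on a simple
    cycle, with one closed walk around each of its vertices.  Oriented cacti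
    are thus plane trees with two kinds of nodes, F_d being the series of the
    closed walks whose base point has d spare half-edges, and Q that of the
    walks along the rest of a cycle. *)

(* Freeness speaks of alternating products of centred polynomials, the recursions of words.
   Identities between functionals on words are therefore extended linearly to products of
   polynomials in a and in s, where it suffices to check them on alternating centred products.

   The system does not close up: each new point of an open block of a's leads from d to d + 1. But
   every such step carries a factor t, so a family indexed by d is determined by its recursion
   modulo every power of t. This is used twice: to find a linear relation between the families, and
   to identify their solution with F and Q. Under this identification, the series of the words y^m
   after d + 1 points of an open block is m0 F_(d+1), and Q is 1 + t^2 (m0 m2 - m1^2), where m1 and
   m2 are the series of phi(a y^m) and phi(a y^m a). Series live in a ring where t is nilpotent: m0
   = 1 + t x is then invertible, and substituting t m0 is a finite sum.

   As for the constants, g_C + 1 = 2 f_C + 2 when e_1 is flexible, so every bridge weighs 4, the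
   first one included; a rigid e_1 leaves a single factor 2. *)
From HB Require Import structures.
Require Import Defs.
From mathcomp Require Import all_boot all_order all_algebra qpoly.
From mathcomp Require Import complex zify ring.
From mathcomp Require Import boolp reals.

Set Implicit Arguments.
Unset Strict Implicit.
Unset Printing Implicit Defensive.

Import GRing.Theory.
Local Open Scope ring_scope.

(** * Non-crossing partitions *)

(* [lia] is slow in the presence of set-theoretic hypotheses. *)
Ltac slia :=
  repeat match goal with H : context [@in_mem] |- _ => clear H end;
  repeat match goal with H : forall _, _ |- _ => clear H end; lia.

Section NoncrossingIntervals.
Variable N : nat.
Implicit Types (P Q : {set {set 'I_N}}) (D V W B : {set 'I_N}).

Definition nc_on D : {set {set {set 'I_N}}} :=
  [set P | partition P D & noncrossing P].

Lemma nc_onP D P : reflect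
  [/\ forall V, V \in P -> (V != set0) && (V \subset D),
      forall V W k, V \in P -> W \in P -> k \in V -> k \in W -> V = W,
      forall k, k \in D -> exists2 V, V \in P & k \in V &
      forall V W (i j k l : 'I_N), V \in P -> W \in P ->
        i \in V -> k \in V -> j \in W -> l \in W ->
        (i < j < k)%N -> (k < l)%N -> V = W]
  (P \in nc_on D).
Proof.
rewrite inE; apply: (iffP andP).
  case=> partP /forall_inP ncP; split.
  - move=> V VP; rewrite (partition_neq0 partP VP) /=.
    by rewrite -(cover_partition partP) bigcup_sup.
  - move=> V W k VP WP kV kW; have [_ /trivIsetP trP _] := and3P partP.
    apply/eqP; apply: contraT => VW; have := trP _ _ VP WP VW.
    by move/pred0P/(_ k); rewrite /= kV kW.
  - move=> k; rewrite -(cover_partition partP) => /bigcupP[V VP kV].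
    by exists V.
  - move=> V W i j k l VP WP iV kV jW lW /andP[ij jk] kl.
    have /forall_inP/(_ W WP)/forall_inP/(_ i iV)/forall_inP/(_ k kV) := ncP V VP.
    move=> /forall_inP/(_ j jW)/forall_inP/(_ l lW).
    by rewrite ij jk kl => /eqP.
case=> H1 H2 H3 H4; split.
  apply/and3P; split.
  - apply/eqP/setP => k; apply/bigcupP/idP => [[V VP kV]|/H3[V VP kV]].
      by have /andP[_ /subsetP] := H1 V VP; apply.
    by exists V.
  - apply/trivIsetP => V W VP WP; apply: contraNT => /pred0Pn[k /andP[/= kV kW]].
    by apply/eqP; apply: H2 kV kW.
  - by apply/negP => /H1; rewrite eqxx.
apply/forall_inP => V VP; apply/forall_inP => W WP.
apply/forall_inP => i iV; apply/forall_inP => k kV; apply/forall_inP => j jW.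
apply/forall_inP => l lW; apply/implyP => /and3P[ij jk kl]; apply/eqP.
by apply: (H4 V W i j k l); rewrite ?ij.
Qed.

Definition itv_set (i j : nat) : {set 'I_N} := [set k : 'I_N | (i <= k < j)%N].

(* [extract_pt x p] and [insert_pt x p] are inverse bijections between
   the non-crossing partitions of [x, j) in which p follows x in its block and
   the pairs of non-crossing partitions of (x, p) and [p, j). *)
Definition follows (x p : 'I_N) P : bool :=
  [&& (x < p)%N, p \in pblock P x &
      [forall k in pblock P x, (x < k)%N ==> (p <= k)%N]].

Definition insert_pt (x p : 'I_N) (q : {set {set 'I_N}} * {set {set 'I_N}}) :=
  q.1 :|: ((x |: pblock q.2 p) |: (q.2 :\ pblock q.2 p)).

Definition extract_pt (x p : 'I_N) P : {set {set 'I_N}} * {set {set 'I_N}} :=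
  ([set V in P | V \subset itv_set x.+1 p],
   (pblock P x :\ x) |: [set V in P | V \subset itv_set p.+1 N]).

Lemma nc_on_pblock D P x : P \in nc_on D -> x \in D ->
  pblock P x \in P /\ x \in pblock P x.
Proof.
rewrite inE => /andP[/and3P[/eqP covP _ _] _] xD.
by rewrite pblock_mem ?covP // mem_pblock covP.
Qed.

Lemma nc_on_def_pblock D P V x : P \in nc_on D -> V \in P -> x \in V ->
  pblock P x = V.
Proof.
by rewrite inE => /andP[/and3P[_ tP _] _] VP xV; apply: def_pblock.
Qed.

Lemma insert_ptP (x p : 'I_N) (j : nat) P1 P2 :
  (x < p < j)%N -> (j <= N)%N ->
  P1 \in nc_on (itv_set x.+1 p) -> P2 \in nc_on (itv_set p j) ->
  [/\ insert_pt x p (P1, P2) \in nc_on (itv_set x j),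
      pblock (insert_pt x p (P1, P2)) x = x |: pblock P2 p,
      follows x p (insert_pt x p (P1, P2)) &
      extract_pt x p (insert_pt x p (P1, P2)) = (P1, P2)].
Proof.
move=> /andP[xp pj] jN nc1 nc2.
have pD : p \in itv_set p j by rewrite inE leqnn.
have [BP pB] := nc_on_pblock nc2 pD; set B := pblock P2 p in BP pB *.
have /nc_onP[a1 a2 a3 a4] := nc1; have /nc_onP[b1 b2 b3 b4] := nc2.
set P := insert_pt x p (P1, P2).
have r1 V k : V \in P1 -> k \in V -> (x < k < p)%N.
  by move=> /a1/andP[_ /subsetP s] /s; rewrite inE.
have r2 V k : V \in P2 -> k \in V -> (p <= k < j)%N.
  by move=> /b1/andP[_ /subsetP s] /s; rewrite inE.
have rB k : k \in x |: B -> k = x \/ (k \in B /\ (p <= k < j)%N).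
  by rewrite !inE => /orP[/eqP->|kB]; [left|right; split=> //; apply: r2 kB].
have memP V : V \in P -> [\/ V \in P1, V = x |: B | V != B /\ V \in P2].
  rewrite !inE /= => /or3P[->|/eqP->|/andP[VB V2]].
  - by constructor 1.
  - by constructor 2.
  - by constructor 3.
have ncP : P \in nc_on (itv_set x j).
  apply/nc_onP; split.
  - move=> V /memP[V1|->|[_ V2]].
    + have /andP[-> _] := a1 V V1; apply/subsetP => k /(r1 _ _ V1).
      by rewrite inE; slia.
    + apply/andP; split; first by apply/set0Pn; exists x; rewrite !inE eqxx.
      by apply/subsetP => k /rB[->|[_]]; rewrite inE; slia.
    + have /andP[-> _] := b1 V V2; apply/subsetP => k /(r2 _ _ V2).
      by rewrite inE; slia.
  - move=> V W k /memP[V1|->|[VB V2]] /memP[W1|->|[WB W2]] // kV kW.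
    + exact: a2 kV kW.
    + by have := r1 _ _ V1 kV; case: (rB _ kW) => [->|[_]]; slia.
    + by have := r1 _ _ V1 kV; have := r2 _ _ W2 kW; slia.
    + by have := r1 _ _ W1 kW; case: (rB _ kV) => [->|[_]]; slia.
    + have := r2 _ _ W2 kW; case: (rB _ kV) => [->|[kB _]]; first slia.
      by rewrite (b2 _ _ _ W2 BP kW kB) eqxx in WB.
    + by have := r1 _ _ W1 kW; have := r2 _ _ V2 kV; slia.
    + have := r2 _ _ V2 kV; case: (rB _ kW) => [->|[kB _]]; first slia.
      by rewrite (b2 _ _ _ V2 BP kV kB) eqxx in VB.
    + exact: b2 kV kW.
  - move=> k; rewrite inE => /andP[xk kj].
    have [kx|kx] := eqVneq k x.
      by exists (x |: B); rewrite !inE ?kx ?eqxx ?orbT.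
    have [kp|pk] := ltnP k p.
      have [|V V1 kV] := a3 k; first by rewrite inE kp; move: kx; rewrite -val_eqE /=; slia.
      by exists V; rewrite // !inE V1.
    have [|V V2 kV] := b3 k; first by rewrite inE pk.
    have [VB|VB] := eqVneq V B.
      by move: kV; rewrite VB => kB; exists (x |: B); rewrite !inE ?kB ?eqxx ?orbT.
    by exists V; rewrite // !inE V2 VB ?orbT.
  - move=> V W i h k l /memP[V1|->|[VB V2]] /memP[W1|->|[WB W2]] // iV kV hW lW ihk kl.
    + by apply: (a4 V W i h k l).
    + have := r1 _ _ V1 iV; have := r1 _ _ V1 kV.
      by case: (rB _ hW) => [?|[_ ?]]; subst; slia.
    + by have := r1 _ _ V1 kV; have := r2 _ _ W2 hW; slia.
    + have := r1 _ _ W1 hW; have := r1 _ _ W1 lW.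
      by case: (rB _ kV) => [?|[_ ?]]; subst; slia.
    + case: (rB _ kV) => [?|[kB kr]].
        by subst; case: (rB _ iV) => [?|[_ ?]]; subst; slia.
      have hr := r2 _ _ W2 hW.
      case: (rB _ iV) => [?|[iB ir]]; last first.
        by rewrite (b4 B W i h k l) ?eqxx in WB.
      (* As p lies in the same block as x, it can replace x in the crossing; h = p would make W the
         block of p. *)
      subst i; have [hp|hp] := eqVneq h p.
        by subst h; rewrite (b2 _ _ _ W2 BP hW pB) eqxx in WB.
      rewrite (b4 B W p h k l) ?eqxx // in WB.
      by move: hp; rewrite -val_eqE /=; slia.
    + by have := r1 _ _ W1 hW; have := r2 _ _ V2 iV; slia.
    + have ir := r2 _ _ V2 iV.
      case: (rB _ hW) => [?|[hB hr]]; first by subst; slia.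
      case: (rB _ lW) => [?|[lB lr]]; first by subst; slia.
      by rewrite (b4 V B i h k l) ?eqxx in VB.
    + by apply: (b4 V W i h k l).
have BxP : x |: B \in P by rewrite !inE eqxx orbT.
have pbx : pblock P x = x |: B.
  by apply: (nc_on_def_pblock ncP BxP); rewrite !inE eqxx.
split=> //.
- rewrite /follows pbx xp !inE pB orbT /=.
  by apply/forall_inP => k /rB[->|[_]]; apply/implyP; slia.
- rewrite /extract_pt pbx; congr pair; last first.
    have -> : (x |: B) :\ x = B.
      rewrite setU1K //; apply/negP => xB; have := r2 _ _ BP xB; slia.
    apply/setP => V; rewrite in_setU1 [_ \in [set _ in _ | _]]inE.
    apply/orP/idP => [[/eqP->//|/andP[/memP[V1|->|[]//]]]|V2].
    + have /andP[/set0Pn[k kV] _] := a1 V V1; move=> /subsetP/(_ k kV).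
      by rewrite inE; have := r1 _ _ V1 kV; slia.
    + by move=> /subsetP/(_ x); rewrite !inE eqxx => /(_ isT); slia.
    + have [VB|VB] := eqVneq V B; [by left|right].
      rewrite !inE V2 VB /= ?orbT /=; apply/subsetP => k kV.
      have := r2 _ _ V2 kV; rewrite inE; have [kp|] := eqVneq k p; last first.
        by rewrite -val_eqE /=; have := ltn_ord k; slia.
      by subst k; rewrite (b2 _ _ _ V2 BP kV pB) eqxx in VB.
  apply/setP => V; rewrite inE; apply/andP/idP => [[/memP[//|->|[_ V2]]]|V1].
  + by move=> /subsetP/(_ x); rewrite !inE eqxx => /(_ isT); slia.
  + have /andP[/set0Pn[k kV] _] := b1 V V2; move=> /subsetP/(_ k kV).
    by rewrite inE; have := r2 _ _ V2 kV; slia.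
  + by split; [rewrite !inE V1|have /andP[] := a1 V V1].
Qed.

Lemma extract_ptP (x p : 'I_N) (j : nat) P :
  (x < j)%N -> (j <= N)%N -> P \in nc_on (itv_set x j) -> follows x p P ->
  [/\ (x < p < j)%N,
      (extract_pt x p P).1 \in nc_on (itv_set x.+1 p),
      (extract_pt x p P).2 \in nc_on (itv_set p j) &
      insert_pt x p (extract_pt x p P) = P].
Proof.
move=> xj jN ncP /and3P[xp pB0 /forall_inP minp].
have xD : x \in itv_set x j by rewrite inE leqnn.
have [BP xB] := nc_on_pblock ncP xD.
move: pB0 minp BP xB; rewrite /extract_pt /=; set B := pblock P x.
move=> pB minp BP xB.
have /nc_onP[a1 a2 a3 a4] := ncP.
set P1 := [set V in P | _]; set P2 := _ |: _.
have r V k : V \in P -> k \in V -> (x <= k < j)%N.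
  by move=> /a1/andP[_ /subsetP s] /s; rewrite inE.
have rB k : k \in B -> k = x \/ (p <= k < j)%N.
  move=> kB; have := r _ _ BP kB; have := implyP (minp k kB).
  have [->|] := eqVneq k x; first by left.
  by rewrite -val_eqE /= => kx h1 h2; right; move: h1; clear -kx h2; lia.
have pj : (p < j)%N by have := r _ _ BP pB; slia.
(* A block other than B with points on both sides of p would cross the pair x, p of B. *)
have side V : V \in P -> V != B ->
    (V \subset itv_set x.+1 p) || (V \subset itv_set p.+1 N).
  move=> VP VB; have /andP[/set0Pn[i iV] _] := a1 V VP.
  have nin k : k \in V -> k \notin B.
    by move=> kV; apply: contra VB => kB; apply/eqP; apply: a2 kV kB.
  have nx k : k \in V -> nat_of_ord k != x.
    by move=> /nin; apply: contra => /eqP/val_inj->.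
  have np k : k \in V -> nat_of_ord k != p.
    by move=> /nin; apply: contra => /eqP/val_inj->.
  have [ip|ip] := ltnP i p; apply/orP; [left|right].
    apply/subsetP => k kV; rewrite inE; have := r _ _ VP kV; have := nx k kV.
    have := np k kV; have := nx i iV; have := r _ _ VP iV.
    have [kp|kp] := ltnP k p; first slia.
    move=> h1 h2 h3 h4 h5; suff VeB : B = V by rewrite VeB eqxx in VB.
    by apply: (a4 B V x i p k) => //; slia.
  apply/subsetP => k kV; rewrite inE; have := r _ _ VP kV; have := nx k kV.
  have := np k kV; have := nx i iV; have := np i iV; have := r _ _ VP iV.
  have [kp|kp] := ltnP k p; last by have := ltn_ord k; slia.
  move=> h1 h2 h3 h4 h5 h6; suff VeB : B = V by rewrite VeB eqxx in VB.
  by apply: (a4 B V x k p i) => //; slia.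
have B'p : p \in B :\ x by rewrite !inE pB andbT -val_eqE /=; slia.
have mem2 V : V \in P2 -> V = B :\ x \/ (V \in P /\ V \subset itv_set p.+1 N).
  by rewrite !inE => /orP[/eqP|/andP[]]; [left|right].
have rB' k : k \in B :\ x -> k \in B /\ (p <= k < j)%N.
  rewrite !inE => /andP[kx kB]; split=> //; case: (rB k kB) => // kE.
  by rewrite kE eqxx in kx.
have r2 V k : V \in P -> V \subset itv_set p.+1 N -> k \in V -> (p < k < j)%N.
  by move=> VP /subsetP s kV; have := s k kV; have := r _ _ VP kV; rewrite inE; slia.
have nc1 : P1 \in nc_on (itv_set x.+1 p).
  apply/nc_onP; split.
  - by move=> V; rewrite inE => /andP[/a1/andP[-> _]].
  - by move=> V W k; rewrite !inE => /andP[VP _] /andP[WP _]; apply: a2.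
  - move=> k; rewrite inE => /andP[xk kp].
    have [|V VP kV] := a3 k; first by rewrite inE; slia.
    exists V => //; rewrite inE VP /=.
    have [VB|VB] := eqVneq V B.
      by move: kV; rewrite VB => /rB[?|?]; subst; slia.
    case/orP: (side V VP VB) => // /subsetP/(_ k kV); rewrite inE; slia.
  - move=> V W i h k l; rewrite !inE => /andP[VP _] /andP[WP _]; exact: a4.
have nc2 : P2 \in nc_on (itv_set p j).
  apply/nc_onP; split.
  - move=> V /mem2[->|[VP Vs]].
      apply/andP; split; first by apply/set0Pn; exists p.
      by apply/subsetP => k /rB'[_]; rewrite inE.
    have /andP[-> _] := a1 V VP; apply/subsetP => k kV; rewrite inE.
    by have := r2 _ _ VP Vs kV; slia.
  - move=> V W k /mem2[->|[VP Vs]] /mem2[->|[WP Ws]] //.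
    + move=> /rB'[kB _] kW; have BW := a2 _ _ _ BP WP kB kW.
      by move: Ws xB => /subsetP/(_ x); rewrite BW => s /s; rewrite inE; slia.
    + move=> kV /rB'[kB _]; have BV := a2 _ _ _ BP VP kB kV.
      by move: Vs xB => /subsetP/(_ x); rewrite BV => s /s; rewrite inE; slia.
    + exact: a2.
  - move=> k; rewrite inE => /andP[pk kj].
    have [|V VP kV] := a3 k; first by rewrite inE; slia.
    have [VB|VB] := eqVneq V B.
      exists (B :\ x); first by rewrite !inE eqxx.
      by rewrite !inE -VB kV -val_eqE /= andbT; slia.
    exists V => //; rewrite !inE VP /=; case/orP: (side V VP VB) => [|->].
      by move=> /subsetP/(_ k kV); rewrite inE; slia.
    by rewrite orbT.
  - move=> V W i h k l /mem2[->|[VP Vs]] /mem2[->|[WP Ws]] //.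
    + move=> /rB'[iB _] /rB'[kB _] hW lW ihk kl.
      have BW := a4 _ _ _ _ _ _ BP WP iB kB hW lW ihk kl.
      by move: Ws xB => /subsetP/(_ x); rewrite BW => s /s; rewrite inE; slia.
    + move=> iV kV /rB'[hB _] /rB'[lB _] ihk kl.
      have BV := a4 _ _ _ _ _ _ VP BP iV kV hB lB ihk kl.
      by move: Vs xB => /subsetP/(_ x); rewrite -BV => s /s; rewrite inE; slia.
    + exact: a4.
split; [slia|exact: nc1|exact: nc2|].
have pbp : pblock P2 p = B :\ x.
  by apply: (nc_on_def_pblock nc2) => //; rewrite !inE eqxx.
rewrite /insert_pt /= pbp setD1K //.
apply/setP => V; rewrite !in_setU !in_set1 in_setD1 in_setU1 !inE.
have [->|VB] := eqVneq V B; first by rewrite BP orbT.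
have [VP|] /= := boolP (V \in P); last first.
  by rewrite orbF andNb.
have VB' : V != B :\ x.
  apply/negP => /eqP VE; have pV : p \in V by rewrite VE.
  by move: VB; rewrite (a2 _ _ _ VP BP pV pB) eqxx.
by rewrite VB' (negPf VB') /=; apply: side.
Qed.

Lemma add_singletonP (x : 'I_N) (j : nat) P :
  (x < j)%N -> P \in nc_on (itv_set x.+1 j) ->
  [/\ [set x] |: P \in nc_on (itv_set x j),
      pblock ([set x] |: P) x = [set x] & ([set x] |: P) :\ [set x] = P].
Proof.
move=> xj ncP; have /nc_onP[a1 a2 a3 a4] := ncP.
have r V k : V \in P -> k \in V -> (x < k < j)%N.
  by move=> /a1/andP[_ /subsetP s] /s; rewrite inE.
have nc1 : [set x] |: P \in nc_on (itv_set x j).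
  apply/nc_onP; split.
  - move=> V /setU1P[->|VP].
      rewrite -card_gt0 cards1 /=; apply/subsetP => k /set1P->.
      by rewrite inE leqnn.
    have /andP[-> _] := a1 V VP; apply/subsetP => k /(r _ _ VP).
    by rewrite inE; slia.
  - move=> V W k /setU1P[->|VP] /setU1P[->|WP] //.
    + by move=> /set1P-> /(r _ _ WP); slia.
    + by move=> kV /set1P kx; have := r _ _ VP kV; subst; slia.
    + exact: a2.
  - move=> k; rewrite inE => kr; have [->|kx] := eqVneq k x.
      by exists [set x]; rewrite ?setU11 ?set11.
    have [|V VP kV] := a3 k; last by exists V; rewrite // setU1r.
    by rewrite inE; move: kx; rewrite -val_eqE /=; slia.
  - move=> V W i h k l /setU1P[->|VP] /setU1P[->|WP] //.
    + by move=> /set1P-> /set1P->; slia.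
    + by move=> iV kV /set1P-> /set1P->; slia.
    + exact: a4.
split=> //; first by apply: (nc_on_def_pblock nc1); rewrite ?setU11 ?set11.
rewrite setU1K //; apply/negP => xP; have := r _ x xP; rewrite set11.
by move/(_ isT); slia.
Qed.

Lemma remove_singletonP (x : 'I_N) (j : nat) P :
  (x < j)%N -> P \in nc_on (itv_set x j) -> pblock P x = [set x] ->
  P :\ [set x] \in nc_on (itv_set x.+1 j) /\ [set x] |: (P :\ [set x]) = P.
Proof.
move=> xj ncP pbx; have xD : x \in itv_set x j by rewrite inE leqnn.
have [BP xB] := nc_on_pblock ncP xD; rewrite pbx in BP xB.
split; last exact: setD1K.
have /nc_onP[a1 a2 a3 a4] := ncP; apply/nc_onP; split.
- move=> V /setD1P[Vx VP]; have /andP[-> /subsetP sV] := a1 V VP.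
  apply/subsetP => k kV; have := sV k kV; rewrite !inE => kr.
  have : k != x by apply: contra Vx => /eqP kx; rewrite (a2 _ _ x VP BP) // -kx.
  by rewrite -val_eqE /=; slia.
- by move=> V W k /setD1P[_ VP] /setD1P[_ WP]; apply: a2.
- move=> k; rewrite inE => kr; have [|V VP kV] := a3 k; first by rewrite inE; slia.
  exists V => //; apply/setD1P; split=> //; apply/negP => /eqP VE.
  by move: kV kr; rewrite VE => /set1P->; slia.
- by move=> V W i h k l /setD1P[_ VP] /setD1P[_ WP]; apply: a4.
Qed.

Variables (K : comNzRingType) (c : nat -> K).

Definition ncsum i j := \sum_(P in nc_on (itv_set i j)) \prod_(V in P) c #|V|.

(** The d extra points stand for those points of the block of x that precede x and have been cut
    off. *)
Definition ncsum1 d (x : 'I_N) j := \sum_(P in nc_on (itv_set x j))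
  c (d + #|pblock P x|)%N * \prod_(V in P | V != pblock P x) c #|V|.

Lemma ncsum_ncsum1 (x : 'I_N) j : (x < j)%N -> ncsum x j = ncsum1 0 x j.
Proof.
move=> xj; apply: eq_bigr => P ncP.
have xD : x \in itv_set x j by rewrite inE leqnn.
have [BP xB] := nc_on_pblock ncP xD.
by rewrite (bigD1 _ BP).
Qed.

Lemma nc_on0 : nc_on set0 = [set set0].
Proof.
apply/setP => P; rewrite !inE partition_set0; apply: andb_idr => /eqP->.
by apply/forall_inP => V; rewrite inE.
Qed.

Lemma ncsum_nil i : ncsum i i = 1.
Proof.
rewrite /ncsum; have -> : itv_set i i = set0.
  by apply/setP => k; rewrite !inE; lia.
by rewrite nc_on0 big_set1 big1 // => V; rewrite inE.
Qed.

Lemma follows_uniq (x p p' : 'I_N) P : follows x p P -> follows x p' P -> p = p'.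
Proof.
move=> /and3P[xp pB /forall_inP mp] /and3P[xp' pB' /forall_inP mp'].
apply/val_inj/eqP; rewrite eqn_leq /=.
by rewrite (implyP (mp p' pB') xp') (implyP (mp' p pB) xp).
Qed.

(** Classify by the point p after x in the block of x. If there is none, the block consists of x and
    the extra points. Otherwise the interval between x and p carries an independent partition, and x
    becomes an extra point of the block of p. *)
Lemma ncsum1_rec d (x : 'I_N) j : (x < j)%N -> (j <= N)%N ->
  ncsum1 d x j = c d.+1 * ncsum x.+1 j +
    \sum_(p : 'I_N | (x < p < j)%N) ncsum x.+1 p * ncsum1 d.+1 p j.
Proof.
move=> xj jN; rewrite /ncsum1 (bigID (fun P => pblock P x == [set x])) /=.
have xD : x \in itv_set x j by rewrite inE leqnn.
congr (_ + _).
  rewrite (reindex_onto (fun P => [set x] |: P) (fun P => P :\ [set x])); last first.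
    by move=> P /andP[ncP /eqP pb]; case: (remove_singletonP xj ncP pb).
  rewrite /ncsum big_distrr /=; apply: eq_big => [P|P /andP[/andP[ncP /eqP pb] /eqP PE]].
    apply/idP/idP => [/andP[/andP[ncP /eqP pb] /eqP <-]|ncP].
      by case: (remove_singletonP xj ncP pb).
    by have [-> -> ->] := add_singletonP xj ncP; rewrite !eqxx.
  rewrite pb cards1 addn1; congr (_ * _); apply: eq_bigl => V.
  by rewrite -[in RHS]PE in_setD1 andbC.
pose nx P := [pick p | follows x p P].
(* Here [nx] is never None: the block of x is not a singleton, and its least point beyond x follows
   x. *)
rewrite (partition_big nx (fun o : option 'I_N => if o is Some p then (x < p < j)%N else false)) /=; last first.
  move=> P /andP[ncP npb]; rewrite /nx.
  have [BP xB] := nc_on_pblock ncP xD.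
  case: pickP => [p fp|nf]; first by case: (extract_ptP xj jN ncP fp).
  have /nc_onP[a1 _ _ _] := ncP; have /andP[_ /subsetP sB] := a1 _ BP.
  have /subsetPn[k kB] : ~~ (pblock P x \subset [set x]).
    by apply: contra npb => sB1; rewrite eqEsubset sB1 sub1set.
  rewrite inE => kx.
  have kC : (k \in pblock P x) && (x < k)%N.
    by rewrite kB /=; move: kx; rewrite -val_eqE /=; have := sB k kB; rewrite inE; slia.
  case: (@arg_minnP _ k (fun k => (k \in pblock P x) && (x < k)%N)
    (@nat_of_ord N) kC) => p /andP[pB xp] mp.
  have := nf p; rewrite /follows xp pB /=; move/negP; case.
  by apply/forall_inP => l lB; apply/implyP => xl; apply: mp; rewrite lB.
rewrite [LHS](bigID (fun o : option 'I_N => isSome o)) /=.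
rewrite [X in _ + X]big1 ?addr0; last by move=> [p|] /andP[].
rewrite (reindex_omap Some id) /=; last by move=> [p|].
apply: eq_big => [p|p]; first by rewrite eqxx !andbT.
rewrite !andbT => /andP[xpj _].
rewrite /ncsum /ncsum1 big_distrlr /= pair_big /=.
rewrite (reindex_onto (insert_pt x p) (extract_pt x p)); last first.
  move=> P /andP[/andP[ncP _]]; rewrite /nx; case: pickP => // q fq /eqP[qp].
  by subst q; case: (extract_ptP xj jN ncP fq).
apply: eq_big => [[P1 P2] /=|[P1 P2] /= /andP[/andP[/andP[ncP npb] nxp] /eqP PE]].
  apply/idP/idP => [/andP[/andP[/andP[ncP npb] nxp] /eqP PE]|/andP[nc1 nc2]].
    move: nxp; rewrite /nx; case: pickP => // q fq /eqP[qp]; subst q.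
    by have [_] := extract_ptP xj jN ncP fq; rewrite PE /= => -> ->.
  have [-> pb fp ->] := insert_ptP xpj jN nc1 nc2; rewrite eqxx /= andbT.
  have pD : p \in itv_set p j by rewrite inE leqnn; case/andP: xpj.
  have [BP pB] := nc_on_pblock nc2 pD.
  apply/andP; split.
    rewrite pb; apply/negP => /eqP/setP/(_ p); rewrite !inE pB orbT -val_eqE /=.
    by case/andP: xpj; slia.
  rewrite /nx; case: pickP => [q fq|/(_ p)]; last by rewrite fp.
  by rewrite (follows_uniq fp fq).
move: nxp; rewrite /nx; case: pickP => // q fq /eqP[qp]; subst q.
have [_] := extract_ptP xj jN ncP fq; rewrite PE /= => nc1 nc2 _.
have [_ pb _ _] := insert_ptP xpj jN nc1 nc2; rewrite pb.
have pD : p \in itv_set p j by rewrite inE leqnn; case/andP: xpj.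
have [BP pB] := nc_on_pblock nc2 pD.
have /nc_onP[a1 _ _ _] := nc1; have /nc_onP[b1 _ _ _] := nc2.
have xB V : V \in P2 -> x \notin V.
  move=> /b1/andP[_ /subsetP sV]; apply/negP => /sV; rewrite inE.
  by case/andP: xpj; slia.
rewrite cardsU1 (xB _ BP) addnA addn1 mulrCA; congr (_ * _).
have notxB V : (V \in P1) || (V \in P2) -> V != x |: pblock P2 p.
  case/orP => [/a1/andP[_ /subsetP sV]|V2]; apply/negP => /eqP VE.
    by have := sV x; rewrite VE setU11 inE ltnn => /(_ isT).
  by have := xB V V2; rewrite VE setU11.
rewrite (eq_bigl (fun V => (V \in P1) || ((V \in P2) && (V != pblock P2 p)))).
  rewrite (bigID (fun V => V \in P1)) /=; congr (_ * _).
    by apply: eq_bigl => V; case: (V \in P1); rewrite ?andbF ?andbT.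
  apply: eq_bigl => V; have [V1|] := boolP (V \in P1); rewrite ?andbT //=.
  apply/esym/negbTE/negP => /andP[V2 _]; have /andP[/set0Pn[k kV] /subsetP s1] := a1 V V1.
  have /andP[_ /subsetP s2] := b1 V V2.
  by have := s1 k kV; have := s2 k kV; rewrite !inE; slia.
move=> V; rewrite /insert_pt !inE /=.
have [->|VxB] := eqVneq V (x |: pblock P2 p); last by rewrite andbT [_ && (V \in _)]andbC.
rewrite andbF; apply/esym/negbTE; rewrite -[X in ~~ X]andbT.
apply/negP => /andP[/orP[V1|/andP[V2 _]] _].
  by have := notxB (x |: pblock P2 p); rewrite V1 eqxx => /(_ isT).
by have := notxB (x |: pblock P2 p); rewrite V2 orbT eqxx => /(_ isT).
Qed.

End NoncrossingIntervals.

(** * Moments of one variable, by the block of the first letter *)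

Section MomentRecursion.
Variables (K : comNzRingType) (c m : nat -> K) (u : nat -> nat -> K).
Hypothesis m_nc : forall n, m n = \sum_(P in NC n) \prod_(V in P) c #|V|.
Hypothesis u_rec : forall d n,
  u d n = c d.+1 * m n + \sum_(i < n) m i * u d.+1 (n - i.+1)%N.

Lemma nc_on_setT N : nc_on [set: 'I_N] = NC N.
Proof. by []. Qed.

Lemma nc_moment0 : m 0%N = 1.
Proof.
have T0 : [set: 'I_0] = set0 by apply/setP => -[].
rewrite m_nc -nc_on_setT T0 nc_on0 big_set1 big1 // => V.
by rewrite inE.
Qed.

(** Translation invariance of the sums over intervals. Instead of transporting partitions between
    ordinal types, both sides are shown to obey one recursion; the assumption on m is the conclusion
    of [nc_moment_rec] at smaller lengths, supplied by its strong induction. *)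
Lemma nc_moment_ncsum N n : (n <= N)%N ->
  (forall k, (k < n)%N -> m k.+1 = u 0 k) ->
  (forall (x : 'I_N) j d, (x < j <= N)%N -> (j - x <= n)%N ->
     ncsum1 c d x j = u d (j - x.+1)%N) /\
  (forall i j, (i <= j <= N)%N -> (j - i <= n)%N -> ncsum N c i j = m (j - i)%N).
Proof.
move=> nN IH; elim: n nN IH => [|n IHn] nN IH.
  split=> [x j d|i j] ij jN; first lia.
  have -> : j = i by lia.
  by rewrite subnn nc_moment0 ncsum_nil.
have [|k kn|IH1 IH2] := IHn; [lia|by apply: IH; lia|].
have step1 (x : 'I_N) j d : (x < j <= N)%N -> (j - x <= n.+1)%N ->
    ncsum1 c d x j = u d (j - x.+1)%N.
  move=> /andP[xj jN] jx; rewrite ncsum1_rec // u_rec IH2; [|lia|lia].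
  congr (_ + _).
  transitivity (\sum_(p : 'I_N | (x < p < j)%N) m (p - x.+1)%N * u d.+1 (j - p.+1)%N).
    apply: eq_bigr => p /andP[xp pj]; rewrite IH2; [|lia|lia].
    by rewrite IH1 //; lia.
  rewrite -(big_mkord xpredT (fun i => m i * u d.+1 (j - x.+1 - i.+1)%N)).
  transitivity (\sum_(x.+1 <= p < j) m (p - x.+1)%N * u d.+1 (j - p.+1)%N).
    rewrite (big_nat_widen _ _ _ _ _ jN) (big_nat_widenl x.+1 0) //.
    rewrite big_mkord; apply: eq_bigl => p /=; lia.
  rewrite -{1}(add0n x.+1) big_addn; apply: eq_big_nat => i ir.
  by rewrite addnK; congr (_ * u _ _); lia.
split=> // i j /andP[ij jN] ji.
have [ijE|/negPf ijn] := eqVneq i j; first by rewrite ijE subnn nc_moment0 ncsum_nil.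
have iN : (i < N)%N by lia.
rewrite (ncsum_ncsum1 c (x := Ordinal iN)) /=; last by lia.
rewrite step1 /=; [|lia|lia].
by rewrite -IH; [congr (m _)|]; lia.
Qed.

Lemma nc_moment_rec n : m n.+1 = u 0%N n.
Proof.
elim/ltn_ind: n => n IH.
have [||IH1 IH2] := @nc_moment_ncsum n.+1 n; [lia|by []|].
have mE : m n.+1 = ncsum n.+1 c 0 n.+1.
  rewrite m_nc -nc_on_setT /ncsum.
  by have -> : itv_set n.+1 0 n.+1 = setT by apply/setP => k; rewrite !inE ltn_ord.
rewrite mE (ncsum_ncsum1 c (x := ord0)) // ncsum1_rec // u_rec.
rewrite IH2 ?subn1 //=; congr (_ + _).
transitivity (\sum_(p < n.+1 | (0 < p)%N) m p.-1 * u 1%N (n - p)%N).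
  apply: eq_big => [p|p /andP[xp pj]]; first by have := ltn_ord p; rewrite /=; lia.
  rewrite IH2 /=; [|lia|lia].
  by rewrite IH1; [congr (m _ * u _ _)|..]; lia.
rewrite big_mkcond big_ord_recl /= add0r; apply: eq_bigr => i _.
by rewrite /= /bump /= add1n.
Qed.
End MomentRecursion.

(** * Freeness and moments of words *)

Section WordFunctionals.
Variable K : comNzRingType.
Implicit Types (p q : {poly K}) (f : seq bool -> K) (g : nat -> K) (w : seq bool).
Implicit Types (bs : seq (bool * {poly K})).

Definition lin p (g : nat -> K) : K := \sum_(i < size p) p`_i * g i.

Lemma linE n p g : (size p <= n)%N -> lin p g = \sum_(i < n) p`_i * g i.
Proof.
move=> pn; rewrite /lin -(big_mkord xpredT (fun i => p`_i * g i)).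
rewrite -[RHS](big_mkord xpredT (fun i => p`_i * g i)).
rewrite [RHS](big_cat_nat _ (n := size p)) //=.
rewrite [X in _ = _ + X]big_nat_cond [X in _ = _ + X]big1 ?addr0 // => i /andP[/andP[pi _] _].
by rewrite nth_default ?mul0r.
Qed.

Lemma linD p q g : lin (p + q) g = lin p g + lin q g.
Proof.
pose n := maxn (size p) (size q).
rewrite !(@linE n) ?leq_maxl ?leq_maxr //; last exact: size_polyD.
by rewrite -big_split; apply: eq_bigr => i _; rewrite coefD mulrDl.
Qed.

Lemma lin_const c g : lin c%:P g = c * g 0%N.
Proof. by rewrite (@linE 1) ?size_polyC_leq1 // big_ord1 coefC. Qed.

Lemma linMX p g : lin (p * 'X) g = lin p (fun i => g i.+1).
Proof.
rewrite (@linE (size p).+1) ?(leq_trans (size_polyMleq _ _)) ?size_polyX ?addn2 //.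
rewrite big_ord_recl coefMX mul0r add0r; apply: eq_bigr => i _.
by rewrite coefMX.
Qed.

Lemma linCM c p g : lin (c%:P * p) g = c * lin p g.
Proof.
rewrite (@linE (size p)); last first.
  by rewrite mul_polyC; apply: size_scale_leq.
by rewrite big_distrr; apply: eq_bigr => i _; rewrite coefCM -mulrA.
Qed.

Lemma eq_lin p g (h : nat -> K) : g =1 h -> lin p g = lin p h.
Proof. by move=> gh; apply: eq_bigr => i _; rewrite gh. Qed.

Lemma linM p q g :
  lin (p * q) g = lin p (fun i => lin q (fun j => g (i + j)%N)).
Proof.
elim/poly_ind: p g => [|p c IH] g.
  by rewrite mul0r /lin size_poly0 !big_ord0.
rewrite mulrDl linD linCM -mulrA -(commr_polyX q) mulrA linMX IH.
by rewrite linD lin_const linMX.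
Qed.

Lemma lin_exchange p q (F : nat -> nat -> K) :
  lin q (fun j => lin p (F^~ j)) = lin p (fun i => lin q (F i)).
Proof.
rewrite /lin; under eq_bigr do rewrite big_distrr /=.
rewrite exchange_big; apply: eq_bigr => i _ /=.
by rewrite big_distrr; apply: eq_bigr => j _; rewrite mulrCA.
Qed.

(* [app f b p] is f(p(x_b) . _) and [ext f bs] is f applied to the product of
   the factors of bs, f being extended linearly from words to polynomials. *)
Definition app f b p w : K := lin p (fun i => f (nseq i b ++ w)).

Fixpoint ext f bs : K :=
  if bs is (b, p) :: bs' then ext (app f b p) bs' else f [::].

Lemma eq_ext f (g : seq bool -> K) bs : f =1 g -> ext f bs = ext g bs.
Proof.
elim: bs f g => [|[b p] bs IH] f g fg /=; first exact: fg.
by apply: IH => w; apply: eq_lin => i; apply: fg.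
Qed.

Lemma ext_cat f bs bs' :
  ext f (bs ++ bs') = ext (fun w => ext (fun v => f (v ++ w)) bs) bs'.
Proof.
elim: bs f => [|[b p] bs IH] f //=; rewrite IH.
apply: eq_ext => w; apply: eq_ext => v; apply: eq_lin => i.
by rewrite catA.
Qed.

Lemma ext_lin f c (g : seq bool -> K) bs :
  ext (fun w => f w + c * g w) bs = ext f bs + c * ext g bs.
Proof.
elim: bs f g => [|[b p] bs IH] f g //=; rewrite -IH; apply: eq_ext => w.
rewrite /app /lin big_distrr -big_split; apply: eq_bigr => i _ /=.
by rewrite mulrDr mulrCA.
Qed.

Lemma ext0 bs : ext (fun=> 0) bs = 0.
Proof.
elim: bs => [|[b p] bs IH] //=; rewrite -[RHS]IH; apply: eq_ext => w.
by rewrite /app /lin big1 // => i _; rewrite mulr0.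
Qed.

Lemma ext_sum (I : Type) (r : seq I) (P : pred I) (c : I -> K) (F : I -> seq bool -> K) bs :
  ext (fun w => \sum_(i <- r | P i) c i * F i w) bs = \sum_(i <- r | P i) c i * ext (F i) bs.
Proof.
elim: r => [|i r IH].
  by rewrite big_nil -[RHS](ext0 bs); apply: eq_ext => w; rewrite big_nil.
rewrite big_cons -IH; case: ifP => Pi; last first.
  by apply: eq_ext => w; rewrite big_cons Pi.
rewrite addrC -ext_lin; apply: eq_ext => w.
by rewrite big_cons Pi addrC.
Qed.

Lemma ext_app f b p bs :
  ext (app f b p) bs = lin p (fun i => ext (fun w => f (nseq i b ++ w)) bs).
Proof. exact: (ext_sum _ _ (fun i : 'I__ => p`_i)). Qed.

Lemma ext_merge f b p q bs :
  ext f ((b, p) :: (b, q) :: bs) = ext f ((b, p * q) :: bs).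
Proof.
rewrite /=; apply: eq_ext => w; rewrite /app linM -lin_exchange.
by apply: eq_lin => j; apply: eq_lin => i; rewrite catA -nseqD.
Qed.

End WordFunctionals.

(** * Freeness in terms of words *)

Section Freeness.
Variables (K : comNzRingType) (A : algType K) (phi : {scalar A}).
Hypothesis phi1 : phi 1 = 1.
Variables (a s : A).
Hypothesis free_as : free_pair phi a s.
Implicit Types (b : bool) (w u : seq bool) (f : seq bool -> K) (p q : {poly K}).
Implicit Types (bs : seq (bool * {poly K})).

Definition letter b : A := if b then a else s.
Definition eval_word w : A := \prod_(b <- w) letter b.
Definition mom w : K := phi (eval_word w).
Definition factor (g : bool * {poly K}) : A := horner_alg (letter g.1) g.2.
Definition eval_factors bs : A := \prod_(g <- bs) factor g.

Definition alternating bs : bool := sorted (fun g h => g.1 != h.1) bs.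
Definition centred bs : Prop := forall g, g \in bs -> phi (factor g) = 0.
Definition centre b p : {poly K} := p - (phi (factor (b, p)))%:P.

Lemma phi_alternating bs : bs != [::] -> alternating bs -> centred bs ->
  phi (eval_factors bs) = 0.
Proof. exact: free_as. Qed.

Lemma factor_centre b p :
  factor (b, centre b p) = factor (b, p) - phi (factor (b, p)) *: 1.
Proof. by rewrite /factor /centre /= rmorphB /= horner_algC. Qed.

Lemma phi_factor_centre b p : phi (factor (b, centre b p)) = 0.
Proof. by rewrite factor_centre linearB linearZ /= phi1 mulr1 subrr. Qed.

Lemma phiB (y z : A) (c : K) : phi (y + c *: z) = phi y + c * phi z.
Proof. by rewrite linearD linearZ. Qed.

Lemma eval_word_cat w u : eval_word (w ++ u) = eval_word w * eval_word u.
Proof. by rewrite /eval_word big_cat. Qed.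

Lemma eval_word_nseq n b : eval_word (nseq n b) = letter b ^+ n.
Proof. by rewrite /eval_word big_nseq -Monoid.iteropE. Qed.

Lemma eval_factors_cat bs bs' :
  eval_factors (bs ++ bs') = eval_factors bs * eval_factors bs'.
Proof. by rewrite /eval_factors big_cat. Qed.

Lemma phi_lin b p (y z : A) :
  lin p (fun i => phi (y * letter b ^+ i * z)) = phi (y * factor (b, p) * z).
Proof.
elim/poly_ind: p z => [|p c IH] z.
  by rewrite /lin size_poly0 big_ord0 /factor rmorph0 mulr0 mul0r linear0.
rewrite linD lin_const linMX expr0 mulr1 /factor rmorphD rmorphM /=.
rewrite horner_algC horner_algX mulrDr mulrDl linearD /=; congr (_ + _).
  have := IH (letter b * z); rewrite /factor /= !mulrA => <-.
  by apply: eq_lin => i; rewrite exprSr !mulrA.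
by rewrite -scalerAr mulr1 -scalerAl linearZ.
Qed.

(** These functionals arise when [mom] is extended one factor at a time: see [app_pre]. *)
Definition pre bs u : K := phi (eval_factors bs * eval_word u).

Lemma pre_nil : pre [::] =1 mom.
Proof. by move=> u; rewrite /pre /eval_factors big_nil mul1r. Qed.

Lemma app_pre bs b p : app (pre bs) b p =1 pre (rcons bs (b, p)).
Proof.
move=> u; rewrite /pre -cats1 eval_factors_cat /eval_factors big_seq1 -phi_lin.
by apply: eq_lin => i; rewrite eval_word_cat eval_word_nseq mulrA.
Qed.

Lemma ext_pre bs bs' : ext (pre bs) bs' = phi (eval_factors (bs ++ bs')).
Proof.
elim: bs' bs => [|[b p] bs' IH] bs /=.
  by rewrite /pre /eval_word big_nil mulr1 cats0.
by rewrite (eq_ext _ (app_pre _ _ _)) IH cat_rcons.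
Qed.

Lemma ext_mom bs : ext mom bs = phi (eval_factors bs).
Proof. by rewrite -(eq_ext _ pre_nil) ext_pre. Qed.

(** In the induction z collects the factors already read, which end up on the right after
    reversal. *)
Lemma ext_mom_rev (z : A) bs :
  ext (fun w => phi (eval_word (rev w) * z)) bs = phi (eval_factors (rev bs) * z).
Proof.
elim: bs z => [|[b p] bs IH] z /=.
  by rewrite /eval_word /eval_factors /rev /= !big_nil.
rewrite rev_cons -cats1 eval_factors_cat /eval_factors big_seq1 -mulrA -IH.
apply: eq_ext => w; rewrite mulrA -phi_lin; apply: eq_lin => i.
by rewrite rev_cat eval_word_cat rev_nseq eval_word_nseq.
Qed.

Lemma ext_centre f bs b p bs' : ext f (bs ++ (b, p) :: bs') =
  ext f (bs ++ (b, centre b p) :: bs') + phi (factor (b, p)) * ext f (bs ++ bs').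
Proof.
rewrite !ext_cat /= -ext_lin; apply: eq_ext => w; rewrite /app.
by rewrite -{1}(subrK (phi (factor (b, p)))%:P p) linD lin_const.
Qed.

Lemma not_alternating bs : ~~ alternating bs ->
  exists l b p q r, bs = l ++ (b, p) :: (b, q) :: r.
Proof.
elim: bs => [//|[b p] bs IH]; case: bs IH => [//|[b' q] bs] IH.
rewrite /alternating /= negb_and negbK => /orP[/eqP<-|nalt].
  by exists [::], b, p, q, bs.
have [l [c [p' [q' [r ->]]]]] := IH nalt.
by exists ((b, p) :: l), c, p', q', r.
Qed.

Lemma alternating_eq bs bs' : map fst bs = map fst bs' ->
  alternating bs = alternating bs'.
Proof.
have E l : alternating l = sorted (fun x y => x != y) (map fst l).
  by rewrite sorted_map.
by rewrite !E => ->.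
Qed.

(** Induction on the number of factors. Two neighbours in the same letter are merged; an alternating
    product is centred from left to right, each step costing a product with one factor less. *)
Lemma ext_eq0 f :
  (forall bs, alternating bs -> centred bs -> ext f bs = 0) ->
  forall bs, ext f bs = 0.
Proof.
move=> f0 bs; have [n] := ubnP (size bs); elim: n bs => // n IH bs; rewrite ltnS => sz.
have [alt|/not_alternating[l [b [p [q [r bsE]]]]]] := boolP (alternating bs); last first.
  rewrite bsE ext_cat ext_merge -ext_cat; apply: IH.
  by move: sz; rewrite bsE !size_cat /= !addnS.
suff aux bs1 bs2 : centred bs1 -> alternating (bs1 ++ bs2) ->
    (size (bs1 ++ bs2) <= n)%N -> ext f (bs1 ++ bs2) = 0.
  exact: (aux [::] bs).
elim: bs2 bs1 => [|[b p] bs2 IH2] bs1 c1 alt1 sz1.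
  by rewrite cats0 in alt1 *; apply: f0.
rewrite ext_centre (IH (bs1 ++ bs2)) ?mulr0 ?addr0; last first.
  by move: sz1; rewrite !size_cat /= addnS.
rewrite -cat_rcons; apply: IH2.
- move=> g; rewrite mem_rcons inE => /orP[/eqP->|]; last exact: c1.
  exact: phi_factor_centre.
- by rewrite cat_rcons -(@alternating_eq (bs1 ++ (b, p) :: bs2)) // !map_cat.
- by move: sz1; rewrite cat_rcons !size_cat.
Qed.

(** A word is a product of factors 'X, one for each letter. *)
Lemma words_eq0 f :
  (forall bs, alternating bs -> centred bs -> ext f bs = 0) ->
  forall w, f w = 0.
Proof.
move=> f0 w; rewrite -(ext_eq0 f0 [seq (b, 'X) | b <- w]).
elim: w f {f0} => [//|b w IH] f /=; rewrite -[RHS]IH /app.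
by rewrite -['X]mul1r linMX lin_const mul1r.
Qed.

(** The reversal of an alternating centred product is again one, so the difference of the two sides
    vanishes on all of them. *)
Lemma mom_rev w : mom (rev w) = mom w.
Proof.
apply/eqP; rewrite -subr_eq0 -mulN1r; apply/eqP; move: w.
apply: words_eq0 => bs alt cen; rewrite ext_lin ext_mom.
have -> : ext (fun w => mom (rev w)) bs = phi (eval_factors (rev bs)).
  rewrite -[eval_factors _]mulr1 -ext_mom_rev; apply: eq_ext => w.
  by rewrite mulr1.
have [->|bs0] := eqVneq bs [::].
  by rewrite /eval_factors /rev /= !big_nil phi1 mulN1r subrr.
rewrite !phi_alternating ?mulr0 ?addr0 //.
- by rewrite -size_eq0 size_rev size_eq0.
- rewrite /alternating rev_sorted; apply: sub_sorted alt => x y /=.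
  by rewrite eq_sym.
- by move=> g; rewrite mem_rev; apply: cen.
Qed.

(* For the letter b with free cumulants k_n, [vfun b f d w] is the sum over
   all factorizations w = w_0 b w_1 b ... b w_n of
   k_(d+n+1) * f w_0 * mom w_1 * ... * mom w_n. *)
Fixpoint vfun b f d w : K :=
  if w is x :: w' then
    vfun b (fun u => f (x :: u)) d w' +
    (if x == b then f [::] * vfun b mom d.+1 w' else 0)
  else kappa phi d.+1 (letter b) * f [::].

Lemma eq_vfun b f f' d w : f =1 f' -> vfun b f d w = vfun b f' d w.
Proof.
elim: w f f' => [|x w IH] f f' ff' /=; first by rewrite ff'.
by rewrite (IH _ (fun u => f' (x :: u))) ?ff' // => u; apply: ff'.
Qed.

Lemma vfun_lin b f c f' d w :
  vfun b (fun u => f u + c * f' u) d w = vfun b f d w + c * vfun b f' d w.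
Proof.
elim: w f f' => [|x w IH] f f' /=; first by rewrite mulrDr mulrCA.
by rewrite IH; case: ifP => _; ring.
Qed.

Lemma vfun0 b d w : vfun b (fun=> 0) d w = 0.
Proof.
by elim: w => [|x w IH] /=; rewrite ?mulr0 // IH mul0r if_same addr0.
Qed.

Lemma vfun_app b f b' p d w :
  vfun b (app f b' p) d w = lin p (fun i => vfun b (fun u => f (nseq i b' ++ u)) d w).
Proof.
rewrite /app /lin; elim: (index_enum _) => [|i r IH].
  by rewrite big_nil -[RHS](vfun0 b d w); apply: eq_vfun => u; rewrite big_nil.
rewrite big_cons addrC -IH -vfun_lin; apply: eq_vfun => u.
by rewrite big_cons addrC.
Qed.

(** The open gap either swallows the whole run of letters b, or is closed after i of them by the
    next one. *)
Lemma vfun_nseq b f d n w :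
  vfun b f d (nseq n b ++ w) = vfun b (fun u => f (nseq n b ++ u)) d w +
    \sum_(i < n) f (nseq i b) * vfun b mom d.+1 (nseq (n - i.+1) b ++ w).
Proof.
elim: n f => [|n IH] f; first by rewrite big_ord0 addr0.
rewrite /= eqxx IH -addrA big_ord_recl subn1 /= [X in _ + X = _]addrC.
by congr (_ + (_ + _)).
Qed.

Lemma vfun_nseq_neq b b' f d n w : b' != b ->
  vfun b f d (nseq n b' ++ w) = vfun b (fun u => f (nseq n b' ++ u)) d w.
Proof.
by move=> /negPf bb; elim: n f => [|n IH] f //=; rewrite bb addr0 IH.
Qed.

Lemma app_vfun_neq b b' f d p w : b' != b ->
  app (vfun b f d) b' p w = vfun b (app f b' p) d w.
Proof.
by move=> bb; rewrite vfun_app; apply: eq_lin => i; apply: vfun_nseq_neq.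
Qed.

(** The last factor may be uncentred: its mean multiplies a nonempty alternating centred product. *)
Lemma phi_alternating_rcons bs b p : bs != [::] -> centred bs ->
  alternating (rcons bs (b, p)) -> phi (eval_factors bs * factor (b, p)) = 0.
Proof.
move=> bs0 cen alt.
have altb : alternating bs.
  by move: alt; rewrite /alternating -cats1 => /cat_sorted2[].
have := @phi_alternating (rcons bs (b, centre b p)).
have -> : eval_factors (rcons bs (b, centre b p)) =
    eval_factors bs * factor (b, centre b p).
  by rewrite -cats1 eval_factors_cat {2}/eval_factors big_seq1.
rewrite factor_centre mulrBr -scalerAr mulr1 -scaleNr phiB phi_alternating // mulr0 addr0.
apply.
- by case: (bs).
- by rewrite -(@alternating_eq (rcons bs (b, p))) // !map_rcons.
- move=> g; rewrite mem_rcons inE => /orP[/eqP->|]; last exact: cen.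
  exact: phi_factor_centre.
Qed.

(** In each term the first gap consists of bs, of whole factors of bs' and of at most one power of b
    at its end, so its moment is 0. *)
Lemma ext_vfun_pre b d bs bs' : bs != [::] -> alternating (bs ++ bs') ->
  centred (bs ++ bs') -> ext (vfun b (pre bs) d) bs' = 0.
Proof.
elim: bs' bs => [|[b' p] bs' IH] bs bs0 alt cen /=.
  rewrite cats0 in alt cen; rewrite /pre /eval_word big_nil mulr1.
  by rewrite phi_alternating ?mulr0.
have cenb : centred bs by move=> g gb; apply: cen; rewrite mem_cat gb.
have IH' : ext (vfun b (pre (rcons bs (b', p))) d) bs' = 0.
  by apply: IH; rewrite ?cat_rcons //; case: (bs).
rewrite -[RHS]IH'; apply: eq_ext => w; have [bE|bb] := eqVneq b' b; last first.
  by rewrite app_vfun_neq //; apply/eq_vfun/app_pre.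
subst b'; rewrite -(eq_vfun _ _ _ (app_pre _ _ _)) vfun_app.
apply: eq_lin => i; rewrite vfun_nseq big1 ?addr0 // => j _.
have -> : pre bs (nseq j b) = 0; last by rewrite mul0r.
rewrite /pre eval_word_nseq -(horner_algX (letter b)) -rmorphXn.
apply: (@phi_alternating_rcons _ b 'X^j) => //.
have : alternating (rcons bs (b, p)).
  by move: alt; rewrite /alternating -cat_rcons => /cat_sorted2[].
by congr (is_true _); apply: alternating_eq; rewrite !map_rcons.
Qed.

Lemma ext_vfun_mom b d bs : bs != [::] -> alternating bs -> centred bs ->
  (head (b, 0) bs).1 != b -> ext (vfun b mom d) bs = 0.
Proof.
case: bs => [//|[b' p] bs] _ alt cen /= bb.
rewrite -[RHS](@ext_vfun_pre b d [:: (b', p)] bs) //; apply: eq_ext => w.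
rewrite app_vfun_neq //; apply: eq_vfun => u; rewrite -(app_pre [::]).
by apply: eq_lin => i; rewrite pre_nil.
Qed.

(** If the first gap swallows the whole run, centring b^n reduces to the two previous cases;
    otherwise a shorter run is left. *)
Lemma ext_vfun_nseq b d n bs : bs != [::] -> alternating bs -> centred bs ->
  (head (b, 0) bs).1 != b ->
  ext (fun w => vfun b mom d (nseq n b ++ w)) bs = 0.
Proof.
move=> bs0 alt cen bb; elim/ltn_ind: n d => n IH d.
pose f w := vfun b (pre [:: (b, centre b 'X^n)]) d w +
  phi (factor (b, 'X^n)) * vfun b mom d w.
rewrite (@eq_ext _ _ (fun w => f w + 1 * \sum_(i < n)
    mom (nseq i b) * vfun b mom d.+1 (nseq (n - i.+1) b ++ w))).
  rewrite ext_lin ext_sum big1 ?mulr0 ?addr0; last first.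
    by move=> i _; rewrite IH ?mulr0 //; have := ltn_ord i; lia.
  rewrite /f ext_lin ext_vfun_mom // mulr0 addr0 ext_vfun_pre //.
    case: bs bs0 alt bb {cen IH f} => // -[b' p] bs _ alt /= bb.
    by rewrite /alternating /= eq_sym bb.
  move=> g; rewrite inE => /orP[/eqP->|]; last exact: cen.
  exact: phi_factor_centre.
move=> w; rewrite vfun_nseq mul1r; congr (_ + _).
rewrite /f -vfun_lin; apply: eq_vfun => u.
rewrite /pre /eval_factors big_seq1 factor_centre mulrBl -scalerAl mul1r.
rewrite linearB linearZ /= subrK /mom eval_word_cat eval_word_nseq.
by rewrite /factor /= rmorphXn /= horner_algX.
Qed.

Lemma subword_nseq n (x : A) (V : {set 'I_(size (nseq n x))}) :
  subword V = nseq #|V| x.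
Proof.
rewrite -(size_subword V); apply/all_pred1P/allP => y.
move=> /mapP[i _ ->]; rewrite (tnth_nth x) /= nth_nseq.
by case: ifP => _; rewrite /= eqxx.
Qed.

Lemma moment_cumulant (x : A) n :
  phi (x ^+ n) = \sum_(P in NC n) \prod_(V in P) kappa phi #|V| x.
Proof.
case: n => [|n].
  rewrite expr0 phi1 -nc_on_setT.
  have -> : [set: 'I_0] = set0 by apply/setP => -[].
  by rewrite nc_on0 big_set1 big1 // => V; rewrite inE.
have := @free_cumulant_momentE _ _ phi (nseq n.+1 x) isT.
rewrite big_nseq -Monoid.iteropE => ->.
under eq_bigr do under eq_bigr do rewrite subword_nseq.
by rewrite size_nseq.
Qed.

Lemma mom_nseq b n : mom (nseq n.+1 b) = vfun b mom 0 (nseq n b).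
Proof.
apply: (@nc_moment_rec K (fun k => kappa phi k (letter b))
  (fun k => mom (nseq k b)) (fun d k => vfun b mom d (nseq k b))).
  by move=> k; rewrite /mom eval_word_nseq moment_cumulant.
move=> d k; rewrite -[nseq k b]cats0 vfun_nseq /= cats0.
by congr (_ + _); apply: eq_bigr => i _; rewrite cats0.
Qed.

(** This is where freeness determines the mixed moments. On alternating centred products both sides
    vanish, except when no factor or a single factor in b is left; the moment-cumulant formula of
    the letter b settles that case. *)
Lemma mom_cons b w : mom (b :: w) = vfun b mom 0 w.
Proof.
apply/eqP; rewrite -subr_eq0 -mulN1r; apply/eqP; move: w.
apply: words_eq0 => bs alt cen; rewrite ext_lin.
have extE : ext (fun w => mom (b :: w)) bs = phi (eval_factors ((b, 'X) :: bs)).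
  rewrite -ext_mom /=; apply: eq_ext => w; rewrite /app.
  by rewrite -['X]mul1r linMX lin_const mul1r.
rewrite extE; case: bs alt cen {extE} => [|[b' p] bs] alt cen.
  rewrite /eval_factors big_seq1 /factor horner_algX /=.
  have := mom_nseq b 0; rewrite /= => <-.
  by rewrite /mom /eval_word big_seq1 mulN1r subrr.
have [bE|bb] := eqVneq b' b; last first.
  rewrite ext_vfun_mom // mulr0 addr0.
  have := phi_alternating (bs := (b, centre b 'X) :: (b', p) :: bs) isT.
  have kap : phi (eval_factors ((b', p) :: bs)) = 0 by apply: phi_alternating.
  have evE g r : eval_factors (g :: r) = factor g * eval_factors r.
    by rewrite /eval_factors big_cons.
  rewrite (evE (b, centre _ _)) factor_centre mulrBl -scalerAl mul1r.
  rewrite -scaleNr phiB kap mulr0 addr0 -evE; apply.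
    by move: alt; rewrite /alternating /= eq_sym bb.
  move=> g; rewrite inE => /orP[/eqP->|]; last exact: cen.
  exact: phi_factor_centre.
subst b'; rewrite -ext_mom ext_merge -commr_polyX /=.
case: bs alt cen => [|g bs] alt cen.
  rewrite /= /app linMX; apply/eqP; rewrite mulN1r subr_eq0; apply/eqP.
  by apply: eq_lin => i; rewrite !cats0 mom_nseq.
have altg : alternating (g :: bs) by case/andP: alt.
have ceng : centred (g :: bs) by move=> h hb; apply: cen; rewrite inE hb orbT.
have bg : g.1 != b by case/andP: alt; rewrite eq_sym.
rewrite [X in _ + _ * X]ext_app [X in _ + _ * X]/lin big1 ?mulr0 ?addr0; last first.
  by move=> i _; rewrite ext_vfun_nseq ?mulr0.
have := @ext_mom ((b, p * 'X) :: g :: bs); rewrite /= => ->.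
have := phi_alternating (bs := (b, centre b (p * 'X)) :: g :: bs) isT.
have kap : phi (eval_factors (g :: bs)) = 0 by apply: phi_alternating.
have evE h r : eval_factors (h :: r) = factor h * eval_factors r.
  by rewrite /eval_factors big_cons.
rewrite (evE (b, centre _ _)) factor_centre mulrBl -scalerAl mul1r.
rewrite -scaleNr phiB kap mulr0 addr0 -evE; apply.
  by move: alt; rewrite /alternating.
move=> h; rewrite inE => /orP[/eqP->|]; last exact: ceng.
exact: phi_factor_centre.
Qed.
End Freeness.

(** * Truncated power series *)

Section TruncatedSeries.
Variables (K B : comNzRingType) (iota : {rmorphism K -> B}) (N : nat).
Implicit Types (t x y : B) (f g h : nat -> K).

Definition ev t f : B := \sum_(i < N) iota (f i) * t ^+ i.

Lemma eq_ev t f g : (forall i, (i < N)%N -> f i = g i) -> ev t f = ev t g.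
Proof. by move=> fg; apply: eq_bigr => i _; rewrite fg. Qed.

Lemma evD t f g : ev t (fun i => f i + g i) = ev t f + ev t g.
Proof.
by rewrite -big_split; apply: eq_bigr => i _; rewrite rmorphD mulrDl.
Qed.

Lemma evZ t c f : ev t (fun i => c * f i) = iota c * ev t f.
Proof.
by rewrite big_distrr; apply: eq_bigr => i _; rewrite rmorphM /= mulrA.
Qed.

Lemma ev_horner t (p : {poly K}) : t ^+ N = 0 ->
  (map_poly iota p).[t] = ev t (fun i => p`_i).
Proof.
move=> tN; pose n := (size p + N)%N.
rewrite (@horner_coef_wide _ n); last first.
  by rewrite (leq_trans (size_poly _ _)) // leq_addr.
rewrite -(big_mkord xpredT (fun i => (map_poly iota p)`_i * t ^+ i)).
rewrite (big_cat_nat _ (n := N)) ?leq_addl //= big_mkord.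
rewrite [X in _ + X]big_nat_cond [X in _ + X]big1 ?addr0; last first.
  move=> i /andP[/andP[Ni _] _].
  by rewrite -(subnKC Ni) exprD tN mul0r mulr0.
by apply: eq_bigr => i _; rewrite coef_map.
Qed.

Lemma ev_conv t f g : t ^+ N = 0 ->
  ev t (fun n => \sum_(i < n.+1) f i * g (n - i)%N) = ev t f * ev t g.
Proof.
move=> tN; pose tr h := \poly_(i < N) h i.
have trE h : ev t h = (map_poly iota (tr h)).[t].
  by rewrite ev_horner //; apply: eq_ev => i iN; rewrite coef_poly iN.
rewrite (trE f) (trE g) -hornerM -rmorphM ev_horner //.
apply: eq_ev => n nN; rewrite coefM; apply: eq_bigr => i _.
rewrite !coef_poly; have -> : (i < N)%N by have := ltn_ord i; lia.
by have -> : (n - i < N)%N by lia.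
Qed.

Lemma ev_shift t f g : t ^+ N = 0 -> (0 < N)%N ->
  (forall n, g n.+1 = f n) -> ev t g = iota (g 0%N) + t * ev t f.
Proof.
move=> tN N0 gf; rewrite /ev; case: N N0 tN => // n _ tn.
rewrite big_ord_recl expr0 mulr1; congr (_ + _).
rewrite big_ord_recr /= mulrDr mulrCA -exprS tn mulr0 addr0 big_distrr /=.
by apply: eq_bigr => i _; rewrite gf /= mulrCA exprS.
Qed.

Lemma ev_conv_shift t f g : t ^+ N = 0 -> (0 < N)%N ->
  ev t (fun n => \sum_(i < n) f i * g (n - i.+1)%N) = t * (ev t f * ev t g).
Proof.
move=> tN N0; rewrite -ev_conv //.
rewrite (@ev_shift t (fun n => \sum_(i < n.+1) f i * g (n - i)%N)) //.
by rewrite big_ord0 rmorph0 add0r.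
Qed.

Definition tdvd t (n : nat) x : Prop := exists y, x = t ^+ n * y.

Lemma tdvd0 t x : tdvd t 0 x.
Proof. by exists x; rewrite mul1r. Qed.

Lemma tdvdN t x : t ^+ N = 0 -> tdvd t N x -> x = 0.
Proof. by move=> tN [y ->]; rewrite tN mul0r. Qed.

Lemma tdvdD t n x y : tdvd t n x -> tdvd t n y -> tdvd t n (x + y).
Proof. by move=> [x' ->] [y' ->]; exists (x' + y'); rewrite mulrDr. Qed.

Lemma tdvdMr t n x y : tdvd t n y -> tdvd t n (x * y).
Proof. by move=> [y' ->]; exists (x * y'); rewrite mulrCA. Qed.

Lemma tdvdS t n x : tdvd t n x -> tdvd t n.+1 (t * x).
Proof. by move=> [y ->]; exists y; rewrite exprS mulrA. Qed.

Lemma nilp_inv t x : t ^+ N = 0 -> exists y, (1 + t * x) * y = 1.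
Proof.
move=> tN; exists (\sum_(i < N) (- (t * x)) ^+ i).
have := subrX1 (- (t * x)) N; rewrite exprNn exprMn tN mul0r mulr0 add0r.
by rewrite -opprD mulNr addrC => /oppr_inj.
Qed.

End TruncatedSeries.

(** * Moments of as + sa *)

Section AnticommutatorMoments.
Variables (K : comNzRingType) (A : algType K) (phi : {scalar A}).
Hypothesis phi1 : phi 1 = 1.
Variables (a s : A).
Hypotheses (free_as : free_pair phi a s) (semi_s : semicircular phi s).
Implicit Types (b : bool) (w u l r e : seq bool) (f : seq bool -> K).

Local Notation mom := (mom phi a s).
Local Notation vfun := (vfun phi a s).

(* The value at y^m e of the linear extension of f, where y = as + sa. *)
Fixpoint ysum f m e : K :=
  if m is m'.+1 then
    ysum (fun w => f [:: true, false & w]) m' e +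
    ysum (fun w => f [:: false, true & w]) m' e
  else f e.

Lemma eq_ysum f f' m e : f =1 f' -> ysum f m e = ysum f' m e.
Proof.
elim: m f f' => [|m IH] f f' ff' //=.
by congr (_ + _); apply: IH => w; apply: ff'.
Qed.

Lemma ysum_lin f c f' m e :
  ysum (fun w => f w + c * f' w) m e = ysum f m e + c * ysum f' m e.
Proof.
elim: m f f' => [|m IH] f f' //=.
by rewrite !IH; ring.
Qed.

Lemma vfunD b f f' d w :
  vfun b (fun u => f u + f' u) d w = vfun b f d w + vfun b f' d w.
Proof.
rewrite -[vfun b f' d w]mul1r -vfun_lin.
by apply: eq_vfun => u; rewrite mul1r.
Qed.

Lemma ysum_eval l r m : ysum (fun w => mom (l ++ w)) m r =
  phi (eval_word a s l * (a * s + s * a) ^+ m * eval_word a s r).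
Proof.
elim: m l => [|m IH] l /=; first by rewrite mulr1 /mom eval_word_cat.
have E (x y : bool) : ysum (fun w => mom (l ++ [:: x, y & w])) m r =
    phi (eval_word a s (l ++ [:: x; y]) * (a * s + s * a) ^+ m * eval_word a s r).
  by rewrite -IH; apply: eq_ysum => w; rewrite -catA.
rewrite !E !eval_word_cat -linearD /= -!mulrDl -mulrDr exprS !mulrA.
by rewrite /eval_word !big_cons !big_nil !mulr1.
Qed.

(** The next point of the open block lies in e or in one of the m factors y. In such a factor the
    other letter stays after the point if b comes first, and goes into the gap before it if b comes
    second. *)
Lemma ysum_vfun b f d m e :
  ysum (vfun b f d) m e = vfun b (ysum f m) d e +
    \sum_(i < m) (ysum f i [::] *
        ysum (fun w => vfun b mom d.+1 (~~ b :: w)) (m - i.+1) e +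
      ysum f i [:: ~~ b] * ysum (vfun b mom d.+1) (m - i.+1) e).
Proof.
elim: m f => [|m IH] f; first by rewrite big_ord0 addr0.
pose f1 w := f [:: b, ~~ b & w]; pose f2 w := f [:: ~~ b, b & w].
have yS g n u : ysum g n.+1 u = ysum (fun w => g [:: b, ~~ b & w]) n u +
    ysum (fun w => g [:: ~~ b, b & w]) n u.
  by case: (b) => //=; rewrite addrC.
rewrite yS big_ord_recl subn1 /=.
have -> : ysum (fun w => vfun b f d [:: b, ~~ b & w]) m e =
    ysum (vfun b f1 d) m e + f [::] * ysum (fun w => vfun b mom d.+1 (~~ b :: w)) m e.
  rewrite -ysum_lin; apply: eq_ysum => w /=.
  by rewrite /f1; case: (b); rewrite /= addr0.
have -> : ysum (fun w => vfun b f d [:: ~~ b, b & w]) m e =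
    ysum (vfun b f2 d) m e + f [:: ~~ b] * ysum (vfun b mom d.+1) m e.
  rewrite -ysum_lin; apply: eq_ysum => w /=.
  by rewrite /f2; case: (b); rewrite /= addr0.
rewrite !IH; have -> : vfun b (fun e0 => ysum f m.+1 e0) d e =
    vfun b (ysum f1 m) d e + vfun b (ysum f2 m) d e.
  by rewrite -vfunD; apply: eq_vfun => u; rewrite yS.
transitivity (vfun b (ysum f1 m) d e + vfun b (ysum f2 m) d e +
  (f [::] * ysum (fun w => vfun b mom d.+1 (~~ b :: w)) m e + f [:: ~~ b] * ysum (vfun b mom d.+1) m e) +
  (\sum_(i < m) (ysum f1 i [::] * ysum (fun w => vfun b mom d.+1 (~~ b :: w)) (m - i.+1) e +
    ysum f1 i [:: ~~ b] * ysum (vfun b mom d.+1) (m - i.+1) e) +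
   \sum_(i < m) (ysum f2 i [::] * ysum (fun w => vfun b mom d.+1 (~~ b :: w)) (m - i.+1) e +
    ysum f2 i [:: ~~ b] * ysum (vfun b mom d.+1) (m - i.+1) e))); first by ring.
rewrite -big_split /= -addrA; congr (_ + (_ + _)).
apply: eq_bigr => i _; rewrite !subSS.
have E u : ysum f i.+1 u = ysum f1 i u + ysum f2 i u by rewrite yS.
by move: (E [::]) (E [:: ~~ b]) => /= -> ->; ring.
Qed.

(* [ymoment l m r] is phi(l y^m r).  In [yblock d e m] and [yblock' d e m], the
   words y^m e and s y^m e follow d + 1 points of an open block of a's. *)
Definition ymoment l m r : K := ysum (fun w => mom (l ++ w)) m r.
Definition yblock d e m : K := ysum (vfun true mom d) m e.
Definition yblock' d e m : K := ysum (fun w => vfun true mom d (false :: w)) m e.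

Lemma ysumSr f m e : ysum f m.+1 e =
  ysum f m [:: true, false & e] + ysum f m [:: false, true & e].
Proof.
elim: m f => [|m IH] f //.
have yS g e' : ysum g m.+1 e' = ysum (fun w => g [:: true, false & w]) m e' +
  ysum (fun w => g [:: false, true & w]) m e' by [].
rewrite [LHS](_ : _ = ysum (fun w => f [:: true, false & w]) m.+1 e +
  ysum (fun w => f [:: false, true & w]) m.+1 e) // !IH !yS; ring.
Qed.

(** Reversal exchanges as and sa, hence fixes y. As phi is not assumed to be a trace, this symmetry
    is what identifies phi(y^m s) with phi(s y^m). *)
Lemma ymoment_rev l m r : ymoment l m r = ymoment (rev r) m (rev l).
Proof.
elim: m l r => [|m IH] l r; first by rewrite /ymoment /= -rev_cat mom_rev.
have E (x y : bool) : ysum (fun w => mom (l ++ [:: x, y & w])) m r =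
    ymoment (rev r) m [:: y, x & rev l].
  have -> : [:: y, x & rev l] = rev (l ++ [:: x; y]) by rewrite rev_cat.
  rewrite -IH; apply: eq_ysum => w.
  by rewrite -catA.
by rewrite /ymoment [LHS]/= !E -/(ymoment _ _ _) /ymoment ysumSr addrC.
Qed.

Lemma ymoment_a m e : ymoment [:: true] m e = yblock 0 e m.
Proof. by apply: eq_ysum => w; rewrite -mom_cons. Qed.

Lemma ymoment_as m e : ymoment [:: true; false] m e = yblock' 0 e m.
Proof. by apply: eq_ysum => w; rewrite -mom_cons. Qed.

Lemma yblock_rec d e m : yblock d e m = vfun true (fun u => ymoment [::] m u) d e +
  \sum_(i < m) (ymoment [::] i [::] * yblock' d.+1 e (m - i.+1) +
                ymoment [::] i [:: false] * yblock d.+1 e (m - i.+1)).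
Proof. exact: ysum_vfun. Qed.

Lemma yblock'_rec d e m : yblock' d e m = vfun true (fun u => ymoment [:: false] m u) d e +
  \sum_(i < m) (ymoment [:: false] i [::] * yblock' d.+1 e (m - i.+1) +
                ymoment [:: false] i [:: false] * yblock d.+1 e (m - i.+1)).
Proof.
rewrite -ysum_vfun; apply: eq_ysum => w /=; rewrite addr0.
by apply: eq_vfun.
Qed.

(** The open block already has at least three points, and these cumulants of s vanish. *)
Lemma vfun_s2 f d w : vfun false f d.+2 w = 0.
Proof.
elim: w f d => [|x w IH] f d /=.
  by have [_ ->] := semi_s; rewrite // mul0r.
by rewrite !IH mulr0 if_same addr0.
Qed.

(** The open block has its two points and must be closed, so f receives all that follows. *)
Lemma vfun_s1 f w : vfun false f 1 w = f w.
Proof.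
elim: w f => [|x w IH] f /=; first by have [-> _] := semi_s; rewrite mul1r.
by rewrite IH vfun_s2 mulr0 if_same addr0.
Qed.

(** Once the partner of the first s is chosen, no block is open, and only moments remain. *)
Lemma ymoment_s m e : ymoment [:: false] m e = vfun false (fun u => ymoment [::] m u) 0 e +
  \sum_(i < m) (ymoment [::] i [::] * ymoment [:: true] (m - i.+1) e +
                ymoment [::] i [:: true] * ymoment [::] (m - i.+1) e).
Proof.
have -> : ymoment [:: false] m e = ysum (vfun false mom 0) m e.
  by apply: eq_ysum => w; rewrite -mom_cons.
rewrite ysum_vfun; congr (_ + _); apply: eq_bigr => i _.
by congr (_ * _ + _ * _); apply: eq_ysum => w; rewrite vfun_s1.
Qed.

Lemma ymoment_sa m e : ymoment [:: false; true] m e =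
  vfun false (fun u => ymoment [:: true] m u) 0 e +
  \sum_(i < m) (ymoment [:: true] i [::] * ymoment [:: true] (m - i.+1) e +
                ymoment [:: true] i [:: true] * ymoment [::] (m - i.+1) e).
Proof.
have -> : ymoment [:: false; true] m e = ysum (vfun false (fun u => mom (true :: u)) 0) m e.
  by apply: eq_ysum => w; rewrite /= mom_cons //= addr0.
rewrite ysum_vfun; congr (_ + _); apply: eq_bigr => i _.
by congr (_ * _ + _ * _); apply: eq_ysum => w; rewrite vfun_s1.
Qed.

End AnticommutatorMoments.

(** * Elimination in the linear system *)

Section ResolventSystem.
Variables (B : comNzRingType) (t : B) (N : nat).
Hypothesis tN : t ^+ N = 0.

(** Each use of the recursions gains a factor t and replaces d by d + 1, so W d is divisible by
    every power of t. *)
Lemma tdvd_fixpoint (W W' : nat -> B) (x y x' y' : B) :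
  (forall d, W d = t * (x * W' d.+1 + y * W d.+1)) ->
  (forall d, W' d = t * (x' * W' d.+1 + y' * W d.+1)) -> forall d, W d = 0.
Proof.
move=> EW EW' d; apply: (@tdvdN _ N t) => //.
suff aux n d' : tdvd t n (W d') /\ tdvd t n (W' d') by case: (aux N d).
elim: n d' => [|n IH] d'; first by split; apply: tdvd0.
have [h1 h2] := IH d'.+1.
by rewrite (EW d') (EW' d'); split; apply: tdvdS; apply: tdvdD; apply: tdvdMr.
Qed.

(** In the application L d is the cumulant of a of order d, and m0, m1, m2, n1, n2, l1, k1 are the
    series of phi(y^m), phi(a y^m), phi(a y^m a), phi(s y^m), phi(s y^m s), phi(a y^m s), phi(a s
    y^m). P and S come from [yblock] and [yblock'] with empty ending, Ps and Ss with ending s, Pa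
    and Sa with ending a. *)
Variables (L : nat -> B) (m0 m1 m2 n1 n2 l1 k1 : B) (P S Ps Ss Pa Sa : nat -> B).
Hypotheses (n1E : n1 = t * (m0 * m1 + m1 * m0))
  (l1E : l1 = t * (m0 * m2 + m1 * m1)) (n2E : n2 = m0 + t * (m0 * l1 + m1 * n1))
  (m0E : m0 = 1 + t * (k1 + t * (m1 * m1 + m2 * m0))).
Hypotheses
  (PE : forall d, P d = L d.+1 * m0 + t * (m0 * S d.+1 + n1 * P d.+1))
  (SE : forall d, S d = L d.+1 * n1 + t * (n1 * S d.+1 + n2 * P d.+1))
  (PsE : forall d, Ps d = L d.+1 * n1 + t * (m0 * Ss d.+1 + n1 * Ps d.+1))
  (SsE : forall d, Ss d = L d.+1 * n2 + t * (n1 * Ss d.+1 + n2 * Ps d.+1))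
  (PaE : forall d, Pa d = L d.+1 * m1 + L d.+2 * m0 + t * (m0 * Sa d.+1 + n1 * Pa d.+1))
  (SaE : forall d, Sa d = L d.+1 * l1 + L d.+2 * n1 + t * (n1 * Sa d.+1 + n2 * Pa d.+1)).
Hypotheses (P0 : P 0%N = m1) (S0 : S 0%N = k1) (Ps0 : Ps 0%N = l1) (Pa0 : Pa 0%N = m2).

(** D is the determinant of the recursion matrix with rows (m0, n1) and (n1, n2), and q will turn
    out to be the series Q of the trees. *)
Let D := m0 * n2 - n1 ^+ 2.
Let delta := m0 * m2 - m1 ^+ 2.
Let q := 1 + t ^+ 2 * delta.

(* The sequences Pa d - P d.+1 (ending in a), P d and Ps d satisfy the same
   linear recursion, with linearly dependent initial data. *)
Lemma resolvent_dependence :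
  D * (m2 - P 1%N) = (m1 * n2 - l1 * n1) * m1 + (l1 * m0 - m1 * n1) * l1.
Proof.
(* Cramer's rule: D (m1, l1) = al (m0, n1) + be (n1, n2). These three vectors are the coefficients
   of L d.+1 in the three recursions. *)
pose al := m1 * n2 - l1 * n1; pose be := l1 * m0 - m1 * n1.
pose W d := D * (Pa d - P d.+1) - al * P d - be * Ps d.
pose W' d := D * (Sa d - S d.+1) - al * S d - be * Ss d.
have EW d : W d = t * (m0 * W' d.+1 + n1 * W d.+1).
  by rewrite [W d]/W (PaE d) (PE d.+1) (PE d) (PsE d) /W /W' /al /be /D; ring.
have EW' d : W' d = t * (n1 * W' d.+1 + n2 * W d.+1).
  by rewrite [W' d]/W' (SaE d) (SE d.+1) (SE d) (SsE d) /W /W' /al /be /D; ring.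
have := tdvd_fixpoint EW EW' 0; rewrite /W P0 Ps0 Pa0 => /eqP.
by rewrite -addrA -opprD subr_eq0 => /eqP.
Qed.

Lemma m0_unit : exists y, m0 * y = 1.
Proof. by rewrite m0E; apply: nilp_inv tN. Qed.

Lemma m0_inj (x y : B) : m0 * x = m0 * y -> x = y.
Proof.
have [u uE] := m0_unit => E.
by rewrite -[x]mul1r -[y]mul1r -uE mulrAC E mulrAC.
Qed.

Lemma DE : D = m0 ^+ 2 * q.
Proof. by rewrite /D /q /delta n2E l1E n1E; ring. Qed.

(** In terms of p = P / m0 this reads q = 1 + t^2 m0^2 p_1 q, the equation of Q. *)
Lemma deltaE : delta = m0 * q * P 1%N.
Proof.
apply: m0_inj; have := resolvent_dependence; rewrite DE => E.
(* With n1, n2 and l1 inserted, the dependence says that m0 times this bracket is 0, and m0 can be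
   cancelled. *)
have : m0 * (m0 * q * m2 - m0 * q * P 1%N - t ^+ 2 * delta ^+ 2 - q * m1 ^+ 2) = 0.
  transitivity (m0 ^+ 2 * q * (m2 - P 1%N) - m0 * (t ^+ 2 * delta ^+ 2 + q * m1 ^+ 2)).
    by ring.
  by rewrite E n2E l1E n1E /q /delta; ring.
rewrite -[X in _ = X](mulr0 m0) => /m0_inj E2.
have -> : m0 * delta = m0 * (m0 * q * P 1%N + (m0 * q * m2 - m0 * q * P 1%N - t ^+ 2 * delta ^+ 2 - q * m1 ^+ 2)).
  by rewrite /q /delta; ring.
by rewrite E2 addr0.
Qed.

(** In the combination m0 S - n1 P of the two recursions, L and the next S cancel. *)
Lemma m0SE d : m0 * S d = n1 * P d + t * D * P d.+1.
Proof. by rewrite (SE d) (PE d) /D; ring. Qed.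

Lemma PE2 d : P d = L d.+1 * m0 + 2%:R * t * n1 * P d.+1 + t ^+ 2 * D * P d.+2.
Proof. by rewrite (PE d) m0SE; ring. Qed.

(** Divided by m0, P obeys the recursion of f shifted by one, as index d stands for d + 1 points;
    and q obeys that of q'. The differences are therefore divisible by every power of t. *)
Lemma resolvent_series (f : nat -> B) (q' : B) :
  let z := t ^+ 2 * m0 ^+ 2 in
  (forall d, f d.+1 = L d.+1 + z * (4%:R * (f 1%N * f d.+2) + q' * f d.+3)) ->
  q' = 1 + z * (f 2%N * q') ->
  m0 = 1 + z * (4%:R * (f 1%N * f 1%N) + 2%:R * (q' * f 2%N)).
Proof.
move=> z fE qE; have [u uE] := m0_unit.
pose p d := u * P d.
have PpE d : P d = m0 * p d by rewrite /p mulrA uE mul1r.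
have pE d : p d = L d.+1 + z * (4%:R * (p 0%N * p d.+1) + q * p d.+2).
  apply: m0_inj; rewrite -PpE PE2 DE n1E -P0 !PpE /z; ring.
have qE' : q = 1 + z * (p 1%N * q).
  by rewrite {1}/q deltaE PpE /z; ring.
have key n : (forall d, tdvd t n (f d.+1 - p d)) /\ tdvd t n (q' - q).
  elim: n => [|n [IH1 IH2]]; first by split=> [d|]; apply: tdvd0.
  have zd x : tdvd t n x -> tdvd t n.+1 (z * x).
    move=> xd; have -> : z * x = t * (t * m0 ^+ 2 * x) by rewrite /z; ring.
    by apply: tdvdS; apply: tdvdMr.
  split=> [d|].
    have -> : f d.+1 - p d = z * (4%:R * f d.+2 * (f 1%N - p 0%N) +
      4%:R * p 0%N * (f d.+2 - p d.+1) + (f d.+3 * (q' - q) + q * (f d.+3 - p d.+2))).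
      by rewrite (fE d) (pE d); ring.
    by apply: zd; do !apply: tdvdD; apply: tdvdMr.
  have -> : q' - q = z * (q' * (f 2%N - p 1%N) + p 1%N * (q' - q)).
    by rewrite {1}qE {1}qE'; ring.
  by apply: zd; apply: tdvdD; apply: tdvdMr.
have [fp qq] := key N.
have fpE d : f d.+1 = p d by apply/eqP; rewrite -subr_eq0; apply/eqP/(tdvdN tN).
have -> : q' = q by apply/eqP; rewrite -subr_eq0; apply/eqP/(tdvdN tN).
rewrite !fpE.
(* The series of phi(s a y^m) is t (2 m1^2 + delta) as well, which gives the factor 2 below. *)
have k1E : k1 = t * (2%:R * m1 ^+ 2 + delta).
  apply: m0_inj; rewrite -S0 m0SE P0 DE n1E deltaE; ring.
rewrite {1}m0E k1E.
have -> : 1 + t * (t * (2%:R * m1 ^+ 2 + delta) + t * (m1 * m1 + m2 * m0)) =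
  1 + 2%:R * t ^+ 2 * (2%:R * m1 ^+ 2 + delta) by rewrite /delta; ring.
by rewrite deltaE -P0 !PpE /z; ring.
Qed.
End ResolventSystem.

(** * Comparison of coefficients *)

Section SeriesExtraction.
Variables (K B : comNzRingType) (iota : {rmorphism K -> B}) (N : nat) (t : B).
Hypotheses (tN : t ^+ N = 0) (N0 : (0 < N)%N).

Lemma ev_even (w : B) (g : nat -> K) : w ^+ N = 0 ->
  ev iota N w (fun k => if odd k then 0 else g k./2) = ev iota N (w ^+ 2) g.
Proof.
move=> wN; pose p := \poly_(i < N) g i.
have -> : ev iota N (w ^+ 2) g = ev iota N (w ^+ 2) (fun i => p`_i).
  by apply: eq_ev => i iN; rewrite coef_poly iN.
rewrite -(@ev_horner _ _ iota N (w ^+ 2) p); last by rewrite -exprM mulnC exprM wN expr0n.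
have -> : w ^+ 2 = ('X^2).[w] by rewrite hornerXn.
rewrite -horner_comp -(map_polyXn iota) -map_comp_poly (@ev_horner _ _ iota N) //.
apply: eq_ev => i iN; rewrite coef_comp_poly_Xn // dvdn2 divn2.
by case: (odd i) => //=; rewrite coef_poly; case: ifP => //; lia.
Qed.

(** Multiplying by t^(N-1-k) kills the terms after the k-th one, those before it vanish by
    induction, and t^(N-1) absorbs every power of m0 = 1 + t x. *)
Lemma ev_inj (m0 x : B) (e : nat -> K) :
  (forall c, iota c * t ^+ N.-1 = 0 -> c = 0) -> m0 = 1 + t * x ->
  ev iota N (t * m0) e = 0 -> forall k, (k < N)%N -> e k = 0.
Proof.
move=> iota0 m0E e0; elim/ltn_ind => k IH kN; apply: iota0.
have tm0 n : t ^+ N.-1 * m0 ^+ n = t ^+ N.-1.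
  elim: n => [|n IHn]; first by rewrite mulr1.
  rewrite exprS mulrA {1}m0E mulrDr mulr1 mulrA -exprSr prednK // tN mul0r.
  by rewrite addr0.
have : ev iota N (t * m0) e * t ^+ (N.-1 - k) = 0 by rewrite e0 mul0r.
rewrite /ev big_distrl /= (bigD1 (Ordinal kN)) //= big1 ?addr0.
  move=> <-; rewrite -(tm0 k) exprMn -mulrA; congr (_ * _).
  have -> : t ^+ N.-1 = t ^+ k * t ^+ (N.-1 - k) by rewrite -exprD; congr (_ ^+ _); lia.
  ring.
move=> i; rewrite -val_eqE /= => ik; have [lt_ik|le_ki] := ltnP i k.
  by rewrite IH ?ltn_ord // rmorph0 !mul0r.
have -> : iota (e i) * (t * m0) ^+ i * t ^+ (N.-1 - k) =
    iota (e i) * m0 ^+ i * t ^+ (i + (N.-1 - k)) by rewrite exprMn exprD; ring.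
have -> : (i + (N.-1 - k) = N + (i - k).-1)%N by lia.
by rewrite exprD tN mul0r mulr0.
Qed.
End SeriesExtraction.

(** Polynomials modulo X^(N+2), with t the class of X: the coefficient of degree N + 1, needed for
    the cumulant of that order, is still visible. *)
Lemma truncated_ring (K : comNzRingType) (N : nat) :
  exists (B : comNzRingType) (iota : {rmorphism K -> B}) (t : B),
    t ^+ N.+2 = 0 /\ forall c, iota c * t ^+ N.+1 = 0 -> c = 0.
Proof.
pose h : {poly K} := 'X^(N.+2).
exists {poly %/ h}, (in_qpoly h \o polyC), (in_qpoly h 'X); split=> [|c].
  rewrite -rmorphXn; apply: val_inj => /=.
  by rewrite mk_monic_Xn Pdiv.RingMonic.rmodpp // monicXn.
rewrite -rmorphXn /= -rmorphM => /(congr1 (@polyn _ _)).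
rewrite in_qpoly_small ?mk_monic_Xn.
  by move=> /(congr1 (fun p : {poly K} => p`_N.+1)); rewrite coefCM coefXn eqxx mulr1 coef0.
rewrite size_polyXn ltnS (leq_trans (size_polyMleq _ _)) //.
by rewrite size_polyXn size_polyC; case: eqP.
Qed.

(** * Cumulants of as + sa as coefficients of the tree series *)

Section AnticommutatorCumulants.
Variables (K : comNzRingType) (A : algType K) (phi : {scalar A}).
Hypothesis phi1 : phi 1 = 1.
Variables (a s : A).
Hypotheses (free_as : free_pair phi a s) (semi_s : semicircular phi s).

Let y := a * s + s * a.

Lemma moment_series (B : comNzRingType) (iota : {rmorphism K -> B}) N (t : B) :
  t ^+ N = 0 -> (0 < N)%N ->
  let m0 := ev iota N t (fun m => phi (y ^+ m)) in
  m0 = 1 + ev iota N (t * m0) (fun k => if k is k'.+1 then kappa phi k'.+1 y else 0).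
Proof.
move=> tN N0 m0.
(* [mom_nseq] rests on the moment-cumulant formula of one variable, so it applies to y itself, taken
   for both letters. *)
pose u d n := vfun phi y y true (mom phi y y) d (nseq n true).
pose us d := ev iota N t (u d).
have m0u : m0 = 1 + t * us 0%N.
  have := @ev_shift _ _ iota _ t (u 0%N) (fun m => phi (y ^+ m)) tN N0.
  rewrite expr0 phi1 rmorph1; apply=> n.
  by rewrite /u -mom_nseq // /mom eval_word_nseq.
have uE d : us d = iota (kappa phi d.+1 y) * m0 + t * (m0 * us d.+1).
  rewrite /us /m0 -ev_conv_shift // -evZ -evD; apply: eq_ev => n _.
  rewrite /u -[nseq n true]cats0 vfun_nseq /=.
  congr (_ * _ + _); first by rewrite !cats0 /mom eval_word_nseq.
  by apply: eq_bigr => i _; rewrite cats0 /mom eval_word_nseq.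
have w0 : (t * m0) ^+ N = 0 by rewrite exprMn tN mul0r.
(* Unrolling the recursion N times leaves a remainder with the factor (t m0)^N = 0. *)
have iter n : t * us 0%N = \sum_(k < n) iota (kappa phi k.+1 y) * (t * m0) ^+ k.+1
    + t * ((t * m0) ^+ n * us n).
  elim: n => [|n ->]; first by rewrite big_ord0 add0r mul1r.
  by rewrite big_ord_recr /= {1}uE -addrA; congr (_ + _); rewrite !exprS; ring.
rewrite {1}m0u; congr (_ + _).
move: (t * m0) w0 iter => w w0 iter.
rewrite (@ev_shift _ _ iota _ w (fun k => kappa phi k.+1 y)) //.
rewrite rmorph0 add0r (iter N) w0 mul0r mulr0 addr0 /ev big_distrr /=.
by apply: eq_bigr => i _; rewrite exprS; ring.
Qed.

(** To be instantiated by the weighted counts of trees: see [wsum0], [wsumT] and [wsumF]. *)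
Variables (F : nat -> nat -> K) (Q : nat -> K).
Hypotheses (F0 : forall d, F d 0 = kappa phi d a)
  (FS : forall d n, F d n.+1 = \sum_(i < n.+1)
     (4%:R * (F 1 i * F d.+1 (n - i)) + Q i * F d.+2 (n - i)))
  (Q0 : Q 0 = 1) (QS : forall n, Q n.+1 = \sum_(i < n.+1) F 2 i * Q (n - i)).

(** The coefficients of T(z) / z; [top_wsum] finds the same sum for the trees with n + 1 edges. *)
Let tot n : K := \sum_(i < n.+1)
   (4%:R * (F 1 i * F 1 (n - i)) + 2%:R * (Q i * F 2 (n - i))).

Lemma anticommutator_series (B : comNzRingType) (iota : {rmorphism K -> B}) N (t : B) :
  t ^+ N = 0 -> (0 < N)%N ->
  let m0 := ev iota N t (fun m => phi (y ^+ m)) in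
  m0 = 1 + (t * m0) ^+ 2 * ev iota N ((t * m0) ^+ 2) tot.
Proof.
move=> tN N0 m0; pose MM l r := ev iota N t (fun m => ymoment phi a s l m r).
have m0M : m0 = MM [::] [::].
  by apply: eq_ev => m _; rewrite /ymoment ysum_eval /eval_word !big_nil mul1r mulr1.
have MMrev l r : MM l r = MM (rev r) (rev l).
  by apply: eq_ev => m _; rewrite ymoment_rev.
pose PP e d := ev iota N t (yblock phi a s d e).
pose SS e d := ev iota N t (yblock' phi a s d e).
pose L d := iota (kappa phi d a).
have momnil : mom phi a s [::] = 1 by rewrite /mom /eval_word big_nil.
have k1s : kappa phi 1 s = 0 by have [_ ->] := semi_s.
have Us e d : PP e d = ev iota N t (fun m => vfun phi a s true (fun u => ymoment phi a s [::] m u) d e)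
    + t * (MM [::] [::] * SS e d.+1 + MM [::] [:: false] * PP e d.+1).
  rewrite mulrDr -!ev_conv_shift // -!evD; apply: eq_ev => m _.
  by rewrite yblock_rec // big_split.
have U's e d : SS e d = ev iota N t (fun m => vfun phi a s true (fun u => ymoment phi a s [:: false] m u) d e)
    + t * (MM [:: false] [::] * SS e d.+1 + MM [:: false] [:: false] * PP e d.+1).
  rewrite mulrDr -!ev_conv_shift // -!evD; apply: eq_ev => m _.
  by rewrite yblock'_rec // big_split.
have Ms e : MM [:: false] e = ev iota N t (fun m => vfun phi a s false (fun u => ymoment phi a s [::] m u) 0 e)
    + t * (MM [::] [::] * MM [:: true] e + MM [::] [:: true] * MM [::] e).
  rewrite mulrDr -!ev_conv_shift // -!evD; apply: eq_ev => m _.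
  by rewrite ymoment_s // big_split.
have Msa : MM [:: false; true] [::] =
    t * (MM [:: true] [::] * MM [:: true] [::] + MM [:: true] [:: true] * MM [::] [::]).
  rewrite mulrDr -!ev_conv_shift // -!evD; apply: eq_ev => m _.
  by rewrite ymoment_sa // big_split /= k1s mul0r add0r.
have ev_0 : ev iota N t (fun=> 0) = 0.
  by rewrite /ev big1 // => i _; rewrite rmorph0 mul0r.
have zN : ((t * m0) ^+ 2) ^+ N = 0.
  by rewrite -exprM mulnC exprM exprMn tN mul0r expr0n.
have n1E : MM [:: false] [::] =
    t * (m0 * MM [:: true] [::] + MM [:: true] [::] * m0).
  rewrite Ms m0M (MMrev [::] [:: true]) -[RHS]add0r -ev_0; congr (_ + _).
  by apply: eq_ev => m _; rewrite /= k1s mul0r.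
have l1E : MM [:: true] [:: false] =
    t * (m0 * MM [:: true] [:: true] + MM [:: true] [::] * MM [:: true] [::]).
  rewrite MMrev Ms m0M (MMrev [::] [:: true]) -[RHS]add0r -ev_0; congr (_ + _).
  by apply: eq_ev => m _; rewrite /= k1s mul0r addr0.
have n2E : MM [:: false] [:: false] =
    m0 + t * (m0 * MM [:: true] [:: false] + MM [:: true] [::] * MM [:: false] [::]).
  rewrite Ms (MMrev [::] [:: true]) (MMrev [::] [:: false]) m0M; congr (_ + _).
  apply: eq_ev => m _; rewrite /= k1s mul0r add0r momnil.
  by have [-> _] := semi_s; rewrite !mulr1.
have m0E : m0 = 1 + t * (MM [:: true; false] [::] +
    t * (MM [:: true] [::] * MM [:: true] [::] + MM [:: true] [:: true] * m0)).
  rewrite {2}m0M -Msa -evD {1}m0M.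
  rewrite {1}/MM (@ev_shift _ _ iota _ t (fun m =>
    ymoment phi a s [:: true; false] m [::] + ymoment phi a s [:: false; true] m [::])) //.
  by rewrite /ymoment /= momnil rmorph1.
have PE d : PP [::] d = L d.+1 * m0 +
    t * (m0 * SS [::] d.+1 + MM [:: false] [::] * PP [::] d.+1).
  by rewrite Us (MMrev [::] [:: false]) m0M /L -evZ.
have SE d : SS [::] d = L d.+1 * MM [:: false] [::] +
    t * (MM [:: false] [::] * SS [::] d.+1 + MM [:: false] [:: false] * PP [::] d.+1).
  by rewrite U's /L -evZ.
have PsE d : PP [:: false] d = L d.+1 * MM [:: false] [::] +
    t * (m0 * SS [:: false] d.+1 + MM [:: false] [::] * PP [:: false] d.+1).
  rewrite Us -(MMrev [::] [:: false]) m0M /L -evZ; congr (_ + _).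
  by apply: eq_ev => m _; rewrite /= addr0.
have SsE d : SS [:: false] d = L d.+1 * MM [:: false] [:: false] +
    t * (MM [:: false] [::] * SS [:: false] d.+1 +
         MM [:: false] [:: false] * PP [:: false] d.+1).
  rewrite U's /L -evZ; congr (_ + _).
  by apply: eq_ev => m _; rewrite /= addr0.
have PaE d : PP [:: true] d = L d.+1 * MM [:: true] [::] + L d.+2 * m0 +
    t * (m0 * SS [:: true] d.+1 + MM [:: false] [::] * PP [:: true] d.+1).
  rewrite Us (MMrev [::] [:: false]) (MMrev [:: true] [::]) m0M /L -!evZ -evD; congr (_ + _).
  by apply: eq_ev => m _; rewrite /= momnil mulr1 [_ * kappa _ _ _]mulrC.
have SaE d : SS [:: true] d = L d.+1 * MM [:: true] [:: false] +
    L d.+2 * MM [:: false] [::] +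
    t * (MM [:: false] [::] * SS [:: true] d.+1 + MM [:: false] [:: false] * PP [:: true] d.+1).
  rewrite U's (MMrev [:: true] [:: false]) /L -!evZ -evD; congr (_ + _).
  by apply: eq_ev => m _; rewrite /= momnil mulr1 [_ * kappa _ _ _]mulrC.
have P0 e : PP e 0 = MM [:: true] e by apply: eq_ev => m _; rewrite ymoment_a.
have S0 e : SS e 0 = MM [:: true; false] e by apply: eq_ev => m _; rewrite ymoment_as.
pose z := (t * m0) ^+ 2; pose f d := ev iota N z (F d); pose q' := ev iota N z Q.
have ev_tot (g g' h h' : nat -> K) c c' : ev iota N z (fun n => \sum_(i < n.+1)
      (c%:R * (g i * g' (n - i)%N) + c'%:R * (h i * h' (n - i)%N))) =
    c%:R * (ev iota N z g * ev iota N z g') + c'%:R * (ev iota N z h * ev iota N z h').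
  rewrite -!ev_conv // -!(rmorph_nat iota) -!evZ -evD.
  by apply: eq_ev => n _; rewrite big_split -!big_distrr.
have fE d : f d.+1 = L d.+1 + z * (4%:R * (f 1%N * f d.+2) + q' * f d.+3).
  rewrite /f (@ev_shift _ _ iota _ z _ (F d.+1) zN N0 (fun n => FS d.+1 n)) F0.
  have := ev_tot (F 1%N) (F d.+2) Q (F d.+3) 4%N 1%N; rewrite mul1r /q' => <-.
  congr (_ + _ * _).
  by apply: eq_ev => n _; apply: eq_bigr => i _; rewrite mul1r.
have qE : q' = 1 + z * (f 2%N * q').
  by rewrite {1}/q' (@ev_shift _ _ iota _ z _ Q zN N0 QS) Q0 rmorph1 ev_conv.
have := resolvent_series tN n1E l1E n2E m0E PE SE PsE SsE PaE SaE (P0 _) (S0 _) (P0 _) (P0 _).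
rewrite -exprMn -/z => /(_ f q' fE qE) main; rewrite {1}main -/z; congr (1 + z * _).
by rewrite /tot ev_tot.
Qed.

(** Two expansions of m0 in powers of t m0 are at hand, one with the cumulants of y as coefficients
    and one with [tot]; [ev_inj] compares them. *)
Lemma anticommutator_cumulant N :
  kappa phi N.+1 y = if odd N.+1 then 0 else tot N./2.
Proof.
have [B [iota [t [tN iota0]]]] := truncated_ring K N.
have E1 := moment_series iota tN isT; have E2 := anticommutator_series iota tN isT.
have wN : (t * ev iota N.+2 t (fun m => phi (y ^+ m))) ^+ N.+2 = 0.
  by rewrite exprMn tN mul0r.
set m0 := ev iota N.+2 t _ in E1 E2 wN.
pose c k := if k is k'.+1 then kappa phi k'.+1 y else 0.
pose h k := if odd k then 0 else tot k./2.
(* The factor (t m0)^2 in front shifts the coefficients by two. *)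
pose g k := if k is k'.+2 then h k' else 0.
have gE : ev iota N.+2 (t * m0) g = (t * m0) ^+ 2 * ev iota N.+2 ((t * m0) ^+ 2) tot.
  rewrite (@ev_shift _ _ iota _ _ (fun k => if k is k'.+1 then h k' else 0)) //.
  rewrite (@ev_shift _ _ iota _ _ h) // !rmorph0 !add0r /h.
  by rewrite ev_even // mulrA.
have E0 : ev iota N.+2 (t * m0) (fun k => c k + (-1) * g k) = 0.
  rewrite evD evZ gE rmorphN1 mulN1r; apply/eqP; rewrite subr_eq0; apply/eqP.
  by apply: (addrI 1); rewrite -E1 -E2.
have m0E : m0 = 1 + t * (m0 * (t * m0) * ev iota N.+2 ((t * m0) ^+ 2) tot).
  by rewrite {1}E2 -/m0; congr (1 + _); ring.
have := ev_inj tN isT iota0 m0E E0 (ltnSn N.+1).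
rewrite mulN1r => /eqP; rewrite subr_eq0 => /eqP cE.
rewrite -[LHS]/(c N.+1) cE.
case: N {tN iota0 E1 E2 wN m0 gE E0 m0E t iota B c cE} => [//|N] /=; rewrite /g /h negbK.
by case oN: (odd N); rewrite //= uphalf_half oN.
Qed.

End AnticommutatorCumulants.

(** * Outercycles of cacti are spelled by trees *)

(* A closed walk from v around a cactus is empty, or goes through a bridge to
   a new vertex u, walks around u, comes back and goes on from v ([Flex]), or
   enters a simple cycle, visits its remaining vertices ([Via]), walking around
   each of them, and goes on from v ([Cyc]).  The letter in [Via u e] is the
   edge leaving u in the cycle; [Leaf] at the end of a chain of [Via] stands
   for the arrival at v. *)
Inductive dtree (V E : Type) : Type :=
| Leaf
| Flex (u : V) (e : E) (l r : dtree V E)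
| Cyc (e : E) (q r : dtree V E)
| Via (u : V) (e : E) (t q : dtree V E).
Arguments Leaf {V E}.

Section DecoratedTrees.
Variables V E : Type.
Implicit Types (d : dtree V E).

(* [wf true d]: d is a closed walk; [wf false d]: d is the rest of a cycle. *)
Fixpoint wf (b : bool) d : bool :=
  match d with
  | Leaf => true
  | Flex _ _ l r => [&& b, wf true l & wf true r]
  | Cyc _ q r => [&& b, wf false q & wf true r]
  | Via _ _ t q => [&& ~~ b, wf true t & wf false q]
  end.

Fixpoint word (v : V) d : seq (V * E) :=
  match d with
  | Leaf => [::]
  | Flex u e l r => (v, e) :: word u l ++ (u, e) :: word v r
  | Cyc e q r => (v, e) :: word v q ++ word v r
  | Via u e t q => word u t ++ (u, e) :: word v q
  end.

Fixpoint verts d : seq V :=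
  match d with
  | Leaf => [::]
  | Flex u _ l r => u :: verts l ++ verts r
  | Cyc _ q r => verts q ++ verts r
  | Via u _ t q => u :: verts t ++ verts q
  end.

Fixpoint edges d : seq E :=
  match d with
  | Leaf => [::]
  | Flex _ e l r => e :: edges l ++ edges r
  | Cyc e q r => e :: edges q ++ edges r
  | Via _ e t q => e :: edges t ++ edges q
  end.

Definition hd (p : seq (V * E)) (y : V) : V := head y (unzip1 p).

Lemma hd_cat p p' y : hd (p ++ p') y = hd p (hd p' y).
Proof. by case: p. Qed.

Lemma hd_word v d : wf true d -> hd (word v d) v = v.
Proof. by case: d. Qed.
End DecoratedTrees.

Section WordMembership.
Variables V E : eqType.
Implicit Types (d : dtree V E).

Lemma unzip1_cat (s t : seq (V * E)) : unzip1 (s ++ t) = unzip1 s ++ unzip1 t.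
Proof. exact: map_cat. Qed.

Lemma unzip2_cat (s t : seq (V * E)) : unzip2 (s ++ t) = unzip2 s ++ unzip2 t.
Proof. exact: map_cat. Qed.

Lemma unzip1_word v d : {subset unzip1 (word v d) <= v :: verts d}.
Proof.
move=> x; rewrite inE.
elim: d v => [|u e l IHl r IHr|e q IHq r IHr|u e t IHt q IHq] v //=.
- rewrite unzip1_cat /= !inE !mem_cat inE.
  by case/or4P=> [->|/IHl/orP[]->|->|/IHr/orP[]->]; rewrite ?orbT.
- rewrite unzip1_cat !inE !mem_cat.
  by case/or3P=> [->|/IHq/orP[]->|/IHr/orP[]->]; rewrite ?orbT.
- rewrite unzip1_cat /= !inE !mem_cat inE.
  by case/or3P=> [/IHt/orP[]->|->|/IHq/orP[]->]; rewrite ?orbT.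
Qed.

Lemma verts_word v d : {subset verts d <= unzip1 (word v d)}.
Proof.
move=> x; elim: d v => [|u e l IHl r IHr|e q IHq r IHr|u e t IHt q IHq] v //=.
- rewrite unzip1_cat /= !inE !mem_cat inE.
  by case/or3P=> [->|/(IHl u)->|/(IHr v)->]; rewrite ?orbT.
- rewrite unzip1_cat !inE !mem_cat.
  by case/orP=> [/(IHq v)->|/(IHr v)->]; rewrite ?orbT.
- rewrite unzip1_cat /= !inE !mem_cat inE.
  by case/or3P=> [->|/(IHt u)->|/(IHq v)->]; rewrite ?orbT.
Qed.

Lemma unzip2_word v d : unzip2 (word v d) =i edges d.
Proof.
move=> x; elim: d v => [|u e l IHl r IHr|e q IHq r IHr|u e t IHt q IHq] v //=.
- rewrite unzip2_cat /= !inE !mem_cat inE IHl IHr.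
  by case: (x == e); rewrite ?orbT.
- by rewrite unzip2_cat !inE !mem_cat IHq IHr.
- rewrite unzip2_cat /= !inE !mem_cat inE IHt IHq.
  by case: (x == e); rewrite ?orbT.
Qed.
End WordMembership.

Section Walks.
Variables (V E : finType) (G : multigraph V E).
Implicit Types (p w : seq (V * E)) (x y v u : V) (e : E).

Lemma set2_injr x y y' : [set x; y] = [set x; y'] -> y = y'.
Proof.
move=> E1; have : y \in [set x; y'] by rewrite -E1 set22.
rewrite !inE => /orP[/eqP yx|/eqP//]; have : y' \in [set x; y] by rewrite E1 set22.
by rewrite yx !inE orbb => /eqP.
Qed.

(* [walk p y]: the walk p ends in y; it starts in [hd p y]. *)
Fixpoint walk p y : bool :=
  if p is (x, e) :: p' then (ends G e == [set x; hd p' y]) && walk p' y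
  else true.

Lemma walk_cat p p' y : walk (p ++ p') y = walk p (hd p' y) && walk p' y.
Proof. by elim: p => [|[x e] p IH] //=; rewrite IH hd_cat andbA. Qed.

Lemma path_walk a p z :
  path (fun b c : V * E => ends G b.2 == [set b.1; c.1]) a (rcons p z) =
  walk (a :: p) z.1.
Proof. by elim: p a => [|b p IH] [x e] //=; rewrite IH; case: b. Qed.

Lemma is_cycleE x e p : is_cycle G ((x, e) :: p) <-> walk ((x, e) :: p) x.
Proof. by rewrite /is_cycle [cycle _ _]path_walk; split=> [[]|]. Qed.

Lemma walk_ends p y e x : walk p y -> e \in unzip2 p -> x \in ends G e ->
  x \in rcons (unzip1 p) y.
Proof.
elim: p => [|[x' e'] p IH] //= /andP[/eqP Ge' wp]; rewrite !inE.
case/orP=> [/eqP->|ep xe]; last by rewrite IH ?orbT.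
rewrite Ge' !inE => /orP[->//|/eqP->]; rewrite /hd mem_rcons inE.
by case: (p) => [|[z f] p'] /=; rewrite ?inE eqxx ?orbT.
Qed.

Lemma walk_prefix p z y : walk p z -> y \in rcons (unzip1 p) z ->
  exists pa, [/\ walk pa y, hd pa y = hd p z & {subset pa <= p}].
Proof.
elim: p => [|[x e] p IH] /=.
  by rewrite inE => _ /eqP->; exists [::].
case/andP=> /eqP Ge wp; rewrite inE => /orP[/eqP->|yp]; first by exists [::].
have [pa [wa ha sa]] := IH wp yp; exists ((x, e) :: pa); split=> //=.
  by rewrite ha Ge eqxx.
by move=> a; rewrite !inE => /orP[->//|/sa->]; rewrite orbT.
Qed.

Lemma walk_suffix p z y : walk p z -> y \in rcons (unzip1 p) z ->
  exists pb, [/\ walk pb z, hd pb z = y & {subset pb <= p}].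
Proof.
elim: p => [|[x e] p IH] /=.
  by rewrite inE => _ /eqP->; exists [::].
case/andP=> Ge wp; rewrite inE => /orP[/eqP->|yp].
  by exists ((x, e) :: p); split=> //=; rewrite Ge.
have [pb [wb hb sb]] := IH wp yp; exists pb; split=> // a /sb.
by rewrite inE => ->; rewrite orbT.
Qed.

Definition simple_path p y : bool := walk p y && uniq (rcons (unzip1 p) y).

Lemma shorten_walk p y : walk p y ->
  exists p', [/\ simple_path p' y, hd p' y = hd p y & {subset p' <= p}].
Proof.
elim: p => [|[x e] p IH]; first by exists [::].
case/andP=> /eqP Ge wp; have [p' [/andP[wp' up'] hp' sp']] := IH wp.
have [xp'|xp'] := boolP (x \in rcons (unzip1 p') y); last first.
  exists ((x, e) :: p'); split=> //.
    by rewrite /simple_path /= hp' Ge eqxx wp' xp' up'.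
  by move=> a; rewrite !inE => /orP[->//|/sp'->]; rewrite orbT.
suff [pb [wb hb sb ub]] : exists pb, [/\ walk pb y, hd pb y = x,
    {subset pb <= p'} & uniq (rcons (unzip1 pb) y)].
  exists pb; split; rewrite /simple_path ?wb //.
  by move=> a /sb/sp'; rewrite inE => ->; rewrite orbT.
elim: p' wp' up' xp' {hp' sp'} => [|[x' e'] p' IH'] /=.
  by move=> _ _; rewrite inE => /eqP->; exists [::].
case/andP=> Ge' wp' /andP[x'p' up']; rewrite inE => /orP[/eqP->|xp'].
  by exists ((x', e') :: p'); split=> //=; rewrite ?Ge' ?x'p'.
have [pb [wb hb sb ub]] := IH' wp' up' xp'; exists pb; split=> // a /sb.
by rewrite inE => ->; rewrite orbT.
Qed.

(** Follow w1 from x to the common vertex y, then w2 from y to v. When w1 and w2 are parts of a walk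
    separated by an edge, this is a detour around that edge. *)
Lemma join_walks w1 w2 x v y : walk w1 x -> hd w1 x = x -> walk w2 v ->
  y \in rcons (unzip1 w1) x -> y \in rcons (unzip1 w2) v ->
  exists p, [/\ simple_path p v, hd p v = x & {subset p <= w1 ++ w2}].
Proof.
move=> W1 h1 W2 y1 y2.
have [pa [wa ha sa]] := walk_prefix W1 y1.
have [pb [wb hb sb]] := walk_suffix W2 y2.
have [|p [sp hp pp]] := @shorten_walk (pa ++ pb) v.
  by rewrite walk_cat hb wa wb.
exists p; split=> //; first by rewrite hp hd_cat hb ha h1.
by move=> a /pp; rewrite !mem_cat => /orP[/sa|/sb] ->; rewrite ?orbT.
Qed.

(** An edge used again would make its first vertex reappear. *)
Lemma simple_path_uniq_edges p y : simple_path p y -> uniq (unzip2 p).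
Proof.
case/andP; elim: p => [|[x e] p IH] //= /andP[/eqP Ge wp] /andP[xp up].
rewrite IH // andbT; apply: contra xp => /(walk_ends wp); apply.
by rewrite Ge set21.
Qed.

Lemma simple_path_cycle p v e : simple_path p v -> ends G e = [set v; hd p v] ->
  e \notin unzip2 p -> is_simple_cycle G ((v, e) :: p).
Proof.
move=> sp Ge ep; have := simple_path_uniq_edges sp.
case/andP: sp => wp; rewrite rcons_uniq => /andP[vp up] u2; split=> /=.
- by apply/is_cycleE; rewrite /= Ge eqxx.
- by rewrite vp.
- by rewrite ep.
Qed.

Lemma same_cycle_edges (c c' : seq (V * E)) : same_cycle c c' -> unzip2 c =i unzip2 c'.
Proof.
have rv l : unzip2 (rev l) = rev (unzip2 l) :> seq E by apply: map_rev.
have rt r l : unzip2 (rot r l) = rot r (unzip2 l) :> seq E by apply: map_rot.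
case=> r [->|->] e; rewrite rt mem_rot // /reverse_cycle unzip2_zip.
  by rewrite mem_rot mem_rev.
by rewrite size_rot !size_rev !size_map.
Qed.

Lemma split_last x w : x \in unzip1 w ->
  exists w1 z w2, w = w1 ++ (x, z) :: w2 /\ x \notin unzip1 w2.
Proof.
elim: w => [//|[x' e] w IH]; have [/IH[w1 [z [w2 [-> x2]]]] _|xw] := boolP (x \in unzip1 w).
  by exists ((x', e) :: w1), z, w2.
by rewrite /= inE (negPf xw) orbF => /eqP <-; exists [::], e, w.
Qed.

Hypothesis cactusG : is_cactus G.

(** The multiplicity condition of outercycles, asked only of the edges of w so that it can pass to
    parts of the walk. *)
Definition full w : Prop := forall e, e \in unzip2 w ->
  count_mem e (unzip2 w) = if rigid G e then 1%N else 2%N.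

(* This holds for the rest w of a closed walk in which a cycle edge leads from
   v to x: completed by this edge, both paths are simple cycles through it. *)
Definition chain_unique x v w : Prop :=
  forall p p', simple_path p v -> simple_path p' v ->
    hd p v = x -> hd p' v = x -> {subset p <= w} -> {subset p' <= w} ->
  unzip2 p =i unzip2 p' /\ {in unzip2 p, forall e, rigid G e}.

Lemma subset_unzip1 w w' : {subset w <= w'} -> {subset unzip1 w <= unzip1 w'}.
Proof. by move=> s x /mapP[a /s aw ->]; apply: map_f. Qed.

Lemma subset_unzip2 w w' : {subset w <= w'} -> {subset unzip2 w <= unzip2 w'}.
Proof. by move=> s x /mapP[a /s aw ->]; apply: map_f. Qed.

Lemma disjoint_edges w1 w2 x v e : walk w1 x -> walk w2 v ->
  (forall y, y \in rcons (unzip1 w1) x -> y \in rcons (unzip1 w2) v -> False) ->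
  e \in unzip2 w1 -> e \in unzip2 w2 -> False.
Proof.
move=> W1 W2 dis e1 e2; have /forallP/(_ e)/andP[/card_gt0P[y ye] _] := endsP G.
exact: dis (walk_ends W1 e1 ye) (walk_ends W2 e2 ye).
Qed.

Lemma closed_walk_verts w v d : w = word v d ->
  {subset v :: verts d <= rcons (unzip1 w) v}.
Proof.
move=> -> y; rewrite inE mem_rcons inE => /orP[->//|/verts_word->].
by rewrite orbT.
Qed.

Lemma count_full w1 w2 (mid : seq E) w : unzip2 w = unzip2 w1 ++ mid ++ unzip2 w2 ->
  full w -> (forall e, e \in unzip2 w1 -> e \notin mid /\ e \notin unzip2 w2) ->
  full w1.
Proof.
move=> wE fw dis e e1; have [e2 e3] := dis e e1.
have := fw e; rewrite wE !mem_cat e1 => /(_ isT) <-.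
by rewrite !count_cat (count_memPn e2) (count_memPn e3) !addn0.
Qed.

Definition closed_spec w v := exists d, [/\ wf true d, w = word v d,
  uniq (v :: verts d) & uniq (edges d)].

Definition chain_spec w v := exists q r, [/\ wf false q, wf true r,
  w = word v q ++ word v r, uniq (v :: verts q ++ verts r) &
  uniq (edges q ++ edges r)].

(** Cut w at its last visit of x: a closed walk around x, a cycle edge z, and a rest that avoids x.
    If the two parts shared a vertex, they would contain a simple path from x to v without z,
    against uniqueness. *)
Lemma chain_step w x v n :
  (forall w' x', (size w' < n)%N -> walk w' x' -> hd w' x' = x' -> full w' -> closed_spec w' x') ->
  (forall w' x', (size w' < n)%N -> walk w' v -> hd w' v = x' -> full w' ->
     chain_unique x' v w' -> chain_spec w' v) ->
  (size w <= n)%N -> x != v -> walk w v -> hd w v = x -> full w ->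
  chain_unique x v w -> chain_spec w v.
Proof.
move=> IH0 IH1 sw xv Ww hw fw uw.
have xw : x \in unzip1 w.
  by move: hw xv; rewrite /hd; case: (unzip1 w) => [|z s] /= ->; rewrite ?eqxx ?mem_head.
have [w1 [z [w2 [wE x2]]]] := split_last xw.
move: Ww; rewrite wE walk_cat /= => /and3P[W1 /eqP Gz W2].
have h1 : hd w1 x = x by move: hw; rewrite wE hd_cat.
have sub1 : {subset w1 <= w} by move=> a; rewrite wE mem_cat => ->.
have sub2 : {subset w2 <= w} by move=> a a2; rewrite wE mem_cat inE a2 !orbT.
(* As w2 does not visit x, a simple path in w2 stays simple with x in front; so w2 inherits
   uniqueness from w. *)
have ext p : simple_path p v -> hd p v = hd w2 v -> {subset p <= w2} ->
    [/\ simple_path ((x, z) :: p) v, hd ((x, z) :: p) v = x &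
        {subset (x, z) :: p <= w}].
  case/andP=> Wp up hp pw2; split=> //.
    rewrite /simple_path /= hp Gz eqxx Wp up mem_rcons inE negb_or xv !andbT /=.
    by apply: contra x2; apply: (subset_unzip1 pw2).
  move=> a; rewrite inE => /orP[/eqP->|/pw2/sub2//].
  by rewrite wE mem_cat mem_head orbT.
have [p2 [sp2 hp2 pw2]] := shorten_walk W2.
have [spz hpz pwz] := ext p2 sp2 hp2 pw2.
have zr : rigid G z.
  have [_] := uw _ _ spz spz hpz hpz pwz pwz; apply; exact: mem_head.
have zw : z \in unzip2 w by rewrite wE unzip2_cat mem_cat mem_head orbT.
have := fw z zw; rewrite zr wE unzip2_cat /= count_cat /= eqxx add1n addnS.
move=> /eqP; rewrite eqSS addn_eq0 => /andP[/eqP/count_memPn z1 /eqP/count_memPn z2].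
have dis y : y \in rcons (unzip1 w1) x -> y \in rcons (unzip1 w2) v -> False.
  move=> y1 y2; have [p [sp hp pw]] := join_walks W1 h1 W2 y1 y2.
  have pww : {subset p <= w} by move=> a /pw; rewrite mem_cat => /orP[/sub1|/sub2].
  have [/(_ z) Ez _] := uw _ _ sp spz hp hpz pww pwz.
  have := @subset_unzip2 _ _ pw z; rewrite Ez mem_head => /(_ isT).
  by rewrite unzip2_cat mem_cat (negPf z1) (negPf z2).
have dise e : e \in unzip2 w1 -> e \in unzip2 w2 -> False.
  exact: disjoint_edges W1 W2 dis.
have wE2 : unzip2 w = unzip2 w1 ++ [:: z] ++ unzip2 w2 by rewrite wE unzip2_cat.
have f1 : full w1.
  apply: (count_full wE2 fw) => e e1; split; last by apply/negP; apply: dise.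
  by rewrite inE; apply: contraNneq z1 => <-.
have f2 : full w2.
  move=> e e2; have := fw e; rewrite wE2 !mem_cat e2 !orbT => /(_ isT) <-.
  rewrite !count_cat (count_memPn (_ : e \notin unzip2 w1)).
    rewrite /= addn0; case: eqP => [ze|_]; last by rewrite add0n.
    by rewrite ze e2 in z2.
  by apply/negP => e1; apply: dise e1 e2.
have u2 : chain_unique (hd w2 v) v w2.
  move=> p p' sp sp' hp hp' pw pw'.
  have [s1 h1' q1] := ext p sp hp pw; have [s2 h2' q2] := ext p' sp' hp' pw'.
  have [EE rr] := uw _ _ s1 s2 h1' h2' q1 q2.
  have zp : z \notin unzip2 p by apply: contra z2; apply: subset_unzip2.
  have zp' : z \notin unzip2 p' by apply: contra z2; apply: subset_unzip2.
  split=> [e|e ep]; last by apply: rr; rewrite inE ep orbT.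
  have := EE e; rewrite /= !inE; case: eqP => [->|//].
  by rewrite (negPf zp) (negPf zp').
have sz : (size w1 + size w2 < n)%N by move: sw; rewrite wE size_cat /= addnS.
have sz1 : (size w1 < n)%N by apply: leq_ltn_trans sz; apply: leq_addr.
have sz2 : (size w2 < n)%N by apply: leq_ltn_trans sz; apply: leq_addl.
have [d1 [wf1 w1E ud1 ue1]] := IH0 w1 x sz1 W1 h1 f1.
have [q [r [wfq wfr w2E uv ue]]] := IH1 w2 (hd w2 v) sz2 W2 erefl f2 u2.
have v1 y : y \in x :: verts d1 -> y \in rcons (unzip1 w1) x.
  by apply: closed_walk_verts.
have v2 y : y \in v :: verts q ++ verts r -> y \in rcons (unzip1 w2) v.
  rewrite w2E unzip1_cat mem_rcons !inE !mem_cat.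
  by case/or3P=> [->//|/(@verts_word _ _ v)->|/(@verts_word _ _ v)->]; rewrite ?orbT.
have vdis : ~~ has (mem (x :: verts d1)) (v :: verts q ++ verts r).
  by apply/hasPn => y /v2 y2; apply/negP => /v1 y1; apply: dis y1 y2.
exists (Via x z d1 q), r; split=> //=.
- by rewrite wf1.
- by rewrite w1E w2E -catA.
- have p : perm_eq ([:: v] ++ (x :: verts d1) ++ (verts q ++ verts r))
      ((x :: verts d1) ++ [:: v] ++ (verts q ++ verts r)) by rewrite perm_catCA.
  have : uniq ((x :: verts d1) ++ (v :: verts q ++ verts r)).
    by rewrite cat_uniq ud1 vdis uv.
  by rewrite -(perm_uniq p) /= -catA.
have edis : ~~ has (mem (edges d1)) (edges q ++ edges r).
  apply/hasPn => e; rewrite mem_cat -!(unzip2_word v) -mem_cat -unzip2_cat -w2E => e2.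
  by apply/negP => /=; rewrite -(unzip2_word x) -w1E => e1; apply: dise e1 e2.
rewrite -catA cat_uniq ue1 edis ue /= andbT !mem_cat -(unzip2_word x) -w1E (negPf z1) /=.
by rewrite -!(unzip2_word v) -mem_cat -unzip2_cat -w2E.
Qed.

Lemma flexible_no_path e v p : ~~ rigid G e -> e \notin unzip2 p ->
  simple_path p v -> ends G e = [set v; hd p v] -> False.
Proof.
move=> fe ep sp Ge; move/negP: fe; apply; apply/asboolP.
by exists ((v, e) :: p); [apply: simple_path_cycle|apply: mem_head].
Qed.

Lemma rigid_chain_unique e v u w : rigid G e -> e \notin unzip2 w ->
  ends G e = [set v; u] -> chain_unique u v w.
Proof.
move=> re ew Ge.
have cyc p : simple_path p v -> hd p v = u -> {subset p <= w} ->
    is_simple_cycle G ((v, e) :: p) /\ e \notin unzip2 p.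
  move=> sp hp pw; have ep : e \notin unzip2 p by apply: contra ew; apply: subset_unzip2.
  by split=> //; apply: simple_path_cycle; rewrite ?hp.
move=> p p' sp sp' hp hp' pw pw'.
have [c1 e1] := cyc p sp hp pw; have [c2 e2] := cyc p' sp' hp' pw'.
split=> f; last first.
  by move=> fp; apply/asboolP; exists ((v, e) :: p); rewrite // inE fp orbT.
have [_ uniqG] := cactusG.
have := same_cycle_edges (uniqG e _ _ c1 c2 (mem_head _ _) (mem_head _ _)) f.
by rewrite /= !inE; case: eqP => [->|//]; rewrite (negPf e1) (negPf e2).
Qed.

(** A rigid first edge never returns, and what follows is the rest of its cycle. A flexible one
    returns exactly once and cuts the walk into two closed walks. *)
Lemma closed_step w v n :
  (forall w' x', (size w' < n)%N -> walk w' x' -> hd w' x' = x' -> full w' -> closed_spec w' x') ->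
  (forall w' x', (size w' < n)%N -> walk w' v -> hd w' v = x' -> full w' ->
     chain_unique x' v w' -> chain_spec w' v) ->
  (size w <= n)%N -> walk w v -> hd w v = v -> full w -> closed_spec w v.
Proof.
move=> IH0 IH1; case: w => [|[v' e] w] sw; first by exists Leaf.
move=> /= /andP[/eqP Ge W] hv fw; rewrite /hd /= in hv; subst v'.
set u := hd w v in Ge.
have := fw e (mem_head _ _); rewrite /= eqxx add1n; case: ifP => re [ce].
  have ew : e \notin unzip2 w by apply/count_memPn.
  have f1 : full w.
    move=> f fW; have := fw f; rewrite /= inE fW orbT => /(_ isT) <-.
    by case: eqP => [eE|//]; rewrite eE fW in ew.
  have [q [r [wfq wfr wE uv ue]]] :=
    IH1 w u sw W erefl f1 (rigid_chain_unique re ew Ge).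
  exists (Cyc e q r); split=> //=; first by rewrite wfq.
    by rewrite wE.
  by rewrite ue andbT mem_cat -!(unzip2_word v) -mem_cat -unzip2_cat -wE.
have ew : e \in unzip2 w by rewrite -has_pred1 has_count ce.
have nov p : simple_path p v -> e \notin unzip2 p -> hd p v = u -> False.
  by move=> sp ep hp; apply: (flexible_no_path _ ep sp); rewrite ?re ?hp.
case/mapP: ew => [[x e'] xw /= eE]; subst e'.
case/splitPr: xw ce sw W @u Ge nov fw => w1 w2.
rewrite unzip2_cat count_cat /= eqxx addnCA add1n => -[/eqP].
rewrite addn_eq0 => /andP[/eqP/count_memPn e1 /eqP/count_memPn e2] sw.
rewrite walk_cat /= => /and3P[W1 /eqP Gx W2]; rewrite hd_cat.
have hx : hd ((x, e) :: w2) v = x by []; rewrite {}hx in W1 *.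
move uE: (hd w1 x) => u Ge nov fw.
(* A loop would be a simple cycle, and e is flexible. *)
have uv : u != v.
  by apply/negP => /eqP uv; apply: (nov [::]).
(* The edge is passed backwards the second time: otherwise the walk in between would lead from u to
   v without e, and e would close it to a simple cycle. *)
have xE : x = u.
  have : x \in [set v; u] by rewrite -Ge Gx set21.
  rewrite !inE => /orP[/eqP xv|/eqP//]; subst x.
  have [p [sp hp pw]] := shorten_walk W1.
  by case: (nov p sp); rewrite ?hp //; apply: contra e1; apply: subset_unzip2.
have h2 : hd w2 v = v.
  have := Gx; rewrite Ge xE [in LHS]setUC => /set2_injr <-.
  by [].
subst x; move: (uE) => h1.
have dis y : y \in rcons (unzip1 w1) u -> y \in rcons (unzip1 w2) v -> False.
  move=> y1 y2; have [p [sp hp pw]] := join_walks W1 h1 W2 y1 y2.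
  apply: (nov p sp) => //; apply/negP => /(subset_unzip2 pw).
  by rewrite unzip2_cat mem_cat (negPf e1) (negPf e2).
have dise f : f \in unzip2 w1 -> f \in unzip2 w2 -> False.
  exact: disjoint_edges W1 W2 dis.
have wE2 : unzip2 ((v, e) :: w1 ++ (u, e) :: w2) =
    [:: e] ++ unzip2 w1 ++ [:: e] ++ unzip2 w2 by rewrite /= unzip2_cat.
have f1 : full w1.
  move=> f f1; have := fw f; rewrite wE2 !mem_cat f1 !orbT => /(_ isT) <-.
  rewrite !count_cat /=; case: eqP => [ef|_]; first by rewrite ef f1 in e1.
  rewrite (count_memPn (_ : f \notin unzip2 w2)) ?addn0 ?add0n //.
  by apply/negP; apply: dise.
have f2 : full w2.
  move=> f f2; have := fw f; rewrite wE2 !mem_cat f2 !orbT => /(_ isT) <-.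
  rewrite !count_cat /=; case: eqP => [ef|_]; first by rewrite ef f2 in e2.
  rewrite (count_memPn (_ : f \notin unzip2 w1)) ?addn0 ?add0n //.
  by apply/negP => f1'; apply: dise f1' f2.
have sz : ((size w1 + size w2).+1 < n)%N by move: sw; rewrite /= size_cat /= addnS.
have sz1 : (size w1 < n)%N by apply: leq_ltn_trans sz; apply/leqW/leq_addr.
have sz2 : (size w2 < n)%N by apply: leq_ltn_trans sz; apply/leqW/leq_addl.
have [d1 [wf1 w1E ud1 ue1]] := IH0 w1 u sz1 W1 h1 f1.
have [d2 [wf2 w2E ud2 ue2]] := IH0 w2 v sz2 W2 h2 f2.
have v1 y : y \in u :: verts d1 -> y \in rcons (unzip1 w1) u.
  by apply: closed_walk_verts.
have v2 y : y \in v :: verts d2 -> y \in rcons (unzip1 w2) v.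
  by apply: closed_walk_verts.
have vdis : ~~ has (mem (u :: verts d1)) (v :: verts d2).
  by apply/hasPn => y /v2 y2; apply/negP => /v1 y1; apply: dis y1 y2.
have edis : ~~ has (mem (edges d1)) (edges d2).
  apply/hasPn => f; rewrite -(unzip2_word v) -w2E => f2'.
  by apply/negP => /=; rewrite -(unzip2_word u) -w1E => f1'; apply: dise f1' f2'.
exists (Flex u e d1 d2); split.
- by rewrite /= wf1.
- by rewrite /= w1E w2E.
- have p : perm_eq ([:: v] ++ (u :: verts d1) ++ verts d2)
      ((u :: verts d1) ++ [:: v] ++ verts d2) by rewrite perm_catCA.
  have : uniq ((u :: verts d1) ++ (v :: verts d2)) by rewrite cat_uniq ud1 vdis.
  by rewrite -(perm_uniq p).
- rewrite /= cat_uniq ue1 edis ue2 !andbT mem_cat.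
  by rewrite -(unzip2_word u) -(unzip2_word v) -w1E -w2E negb_or e1.
Qed.

Lemma cactus_word (c : seq (V * E)) : is_outercycle G c ->
  exists v d, [/\ wf true d, c = word v d, uniq (v :: verts d) & uniq (edges d)].
Proof.
move=> [cc nc]; case: c cc nc => [[]//|[v e] c] /is_cycleE W nc.
exists v; pose P0 n := forall w' x', (size w' < n)%N -> walk w' x' -> hd w' x' = x' ->
  full w' -> closed_spec w' x'.
pose P1 n := forall w' x' v', (size w' < n)%N -> walk w' v' -> hd w' v' = x' ->
  full w' -> chain_unique x' v' w' -> chain_spec w' v'.
have PP n : P0 n /\ P1 n.
  elim: n => [|n [IH0 IH1]]; first by split.
  have IH0' : P0 n.+1.
    move=> w x; rewrite ltnS => sw W' hw fw.
    by apply: (@closed_step w x n) => // w' x'; apply: IH1.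
  (* If x = v', the cycle is complete and [Leaf] ends its chain. *)
  split=> // w x v' sw W' hw fw uw; have [xv|xv] := eqVneq x v'.
    subst v'; have [d [wd -> ud ue]] := IH0' w x sw W' hw fw.
    by exists Leaf, d.
  by apply: (@chain_step w x v' n) => // w' x'; apply: IH1.
have [H0 _] := PP (size c).+2; exact: H0.
Qed.
End Walks.

(** * Trees spell outercycles of cacti *)

Section SimpleCycles.
Variables (V E : finType) (G : multigraph V E).
Implicit Types (p c Z : seq (V * E)) (x y v u : V) (e f : E).

(** The first edge of q also occurs in p. It must come first there, since at any later place it
    would bring p back to its starting vertex. *)
Lemma subset_path_eq p q x : walk G p x -> walk G q x -> hd p x = hd q x ->
  uniq (rcons (unzip1 p) x) -> uniq (rcons (unzip1 q) x) -> uniq (unzip2 q) ->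
  {subset unzip2 q <= unzip2 p} -> p = q.
Proof.
elim: q p => [|[y f] q IH] p.
  case: p => [//|[y g] p] _ _; rewrite /hd /= => ->.
  by rewrite mem_rcons mem_head.
move=> Wp /= /andP[/eqP Gf Wq] hpq up /andP[yq uq] /andP[fq u2] sub.
have yx : y != x by move: yq; rewrite mem_rcons inE negb_or => /andP[].
case: p Wp hpq up sub => [_ hx|[y' g] p /= /andP[/eqP Gg Wp] hpq /andP[yp up] sub].
  by rewrite /hd /= in hx; rewrite hx eqxx in yx.
rewrite /hd /= in hpq; subst y'.
have fg : f = g.
  have := sub f (mem_head _ _); rewrite inE => /orP[/eqP//|fp].
  by case/negP: yp; apply: (walk_ends Wp fp); rewrite Gf set21.
subst g; rewrite (IH p) //.
  by move: Gf; rewrite Gg => /set2_injr.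
move=> h hq; have := sub h; rewrite !inE hq orbT => /(_ isT) /orP[/eqP hf|//].
by rewrite -hf hq in fq.
Qed.

Fixpoint rev_walk p y : seq (V * E) :=
  if p is (x, e) :: p' then rcons (rev_walk p' y) (hd p' y, e) else [::].

Lemma unzip2_rev_walk p y : unzip2 (rev_walk p y) = rev (unzip2 p).
Proof. by elim: p => [|[x e] p IH] //=; rewrite {1}/unzip2 map_rcons -/(unzip2 _) IH rev_cons. Qed.

Lemma unzip1_rev_walk p y x e :
  unzip1 (rev_walk ((x, e) :: p) y) = rev (rcons (unzip1 p) y).
Proof.
elim: p x e => [|[z f] p IH] x e //=.
by rewrite [LHS]map_rcons -/(unzip1 _) [X in rcons X _](IH z f) rev_cons.
Qed.

Lemma hd_rev_walk p x y : hd (rev_walk p y) x = if p is [::] then x else y.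
Proof.
case: p => [//|[z e] p].
by rewrite /hd unzip1_rev_walk rev_rcons.
Qed.

Lemma walk_rev p y x : walk G p y -> hd p y = x -> walk G (rev_walk p y) x.
Proof.
elim: p x => [|[z e] p IH] x //= /andP[/eqP Ge Wp]; rewrite /hd /= => zx.
rewrite -cats1 walk_cat /= andbT; apply/andP; split; last first.
  by rewrite Ge setUC zx.
exact: IH.
Qed.

Lemma reverse_cycleE c x e :
  reverse_cycle ((x, e) :: c) = rot 1 (rev_walk ((x, e) :: c) x).
Proof.
rewrite -[RHS]zip_unzip /reverse_cycle; congr zip.
  rewrite -[RHS]/(map _ _) map_rot -/(unzip1 _) unzip1_rev_walk rev_rcons.
  by rewrite rot1_cons /= rev_cons.
by rewrite -[RHS]/(map _ _) map_rot -/(unzip2 _) unzip2_rev_walk.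
Qed.

Lemma is_simple_cycle_rot n c : is_simple_cycle G c -> is_simple_cycle G (rot n c).
Proof.
case=> -[c0 cc] u1 u2; rewrite /is_simple_cycle /is_cycle /unzip1 /unzip2.
by rewrite rot_cycle !map_rot !rot_uniq -size_eq0 size_rot size_eq0.
Qed.

Lemma closed_walk_cycle p x : p != [::] -> walk G p x -> hd p x = x -> is_cycle G p.
Proof.
case: p => [//|[y f] p] _ W; rewrite /hd /= => yx; subst y.
exact/is_cycleE.
Qed.

Lemma is_simple_cycle_reverse c :
  is_simple_cycle G c -> is_simple_cycle G (reverse_cycle c).
Proof.
case: c => [[[]]//|[x e] c] [/is_cycleE W u1 u2].
rewrite reverse_cycleE; apply: is_simple_cycle_rot.
have h : hd (rev_walk ((x, e) :: c) x) x = x by rewrite hd_rev_walk.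
split.
- apply: (closed_walk_cycle _ _ h); last exact: (walk_rev W).
  by rewrite -size_eq0 /= size_rcons.
- by rewrite unzip1_rev_walk rev_uniq rcons_uniq.
- by rewrite unzip2_rev_walk rev_uniq.
Qed.

Lemma mem_reverse c a b e : is_simple_cycle G c -> (a, e) \in c ->
  ends G e = [set a; b] -> (b, e) \in reverse_cycle c.
Proof.
case: c => [[[]]//|[x f] c] [/is_cycleE W u1 u2] ae Ge.
rewrite reverse_cycleE mem_rot; clear u1 u2.
move: x ((x, f) :: c) W ae => y p; elim: p => [//|[x' f'] p IH] /=.
case/andP=> /eqP Gf Wp; rewrite inE mem_rcons inE => /orP[/eqP[ax ef]|/(IH Wp)->].
  by subst x' f'; move: Gf; rewrite Ge => /set2_injr ->; rewrite eqxx.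
by rewrite orbT.
Qed.

(** Rotate c, reversed if necessary, so that it starts with the same vertex and edge as Z. Two
    simple paths with common ends remain, to which [subset_path_eq] applies. *)
Lemma same_cycle_subset c Z : is_simple_cycle G c -> is_simple_cycle G Z ->
  {subset unzip2 Z <= unzip2 c} -> same_cycle c Z.
Proof.
move=> sc sZ sub.
have aux c' : is_simple_cycle G c' -> {subset unzip2 Z <= unzip2 c'} ->
    (exists2 a, a \in c' & a \in Z /\ a = head a Z) -> exists r, Z = rot r c'.
  move=> sc' sub' [[x e] ac [aZ ahd]]; have [r p rE] := rot_to ac.
  exists r; have := is_simple_cycle_rot r sc'.
  have : {subset unzip2 Z <= unzip2 (rot r c')}.
    by move=> f /sub'; rewrite /unzip2 map_rot mem_rot.
  rewrite rE {rE ac}; case: Z sZ aZ ahd {sub sub'} => [[[]]//|[x' e'] q].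
  move=> sZ _ /= [xx ee]; subst x' e' => sub [/is_cycleE W1 u1 u2].
  case: sZ => /is_cycleE W2 v1 v2.
  move: W1 W2 => /= /andP[/eqP Ge W1] /andP[/eqP Ge' W2].
  move: u1 u2 v1 v2 => /= u1 /andP[ep u2] v1 /andP[eq v2].
  congr cons; symmetry; apply: (subset_path_eq W1 W2); rewrite ?rcons_uniq //.
    by move: Ge; rewrite Ge' => /set2_injr.
  move=> f fq; have := sub f; rewrite !inE fq orbT => /(_ isT) /orP[/eqP fe|//].
  by rewrite -fe fq in eq.
case: Z sZ sub aux => [[[]]//|[x e] q] sZ sub aux.
have : e \in unzip2 c by apply: sub; apply: mem_head.
case/mapP=> -[a e'] ac /= ee; subst e'.
have [/is_cycleE /= /andP[/eqP GeZ _] _ _] := sZ.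
have [ax|ax] := eqVneq a x.
  subst a; have [|r ->] := aux c sc sub; last by exists r; left.
  by exists (x, e) => //; split=> //; apply: mem_head.
have Ge : exists b, ends G e = [set a; b].
  have [[c0 cyc] _ _] := sc; have := next_cycle cyc ac => /eqP ->.
  by eexists.
case: Ge => b Ge; have bx : b = x.
  have : x \in [set a; b] by rewrite -Ge GeZ set21.
  by rewrite !inE eq_sym (negPf ax) /= => /eqP.
subst b; have xr := mem_reverse sc ac Ge.
have [|||r ->] := aux (reverse_cycle c); last by exists r; right.
- exact: is_simple_cycle_reverse.
- move=> f /sub; rewrite /reverse_cycle unzip2_zip ?size_rot ?size_rev ?size_map //.
  by rewrite mem_rot mem_rev.
- by exists (x, e) => //; split=> //; apply: mem_head.
Qed.
End SimpleCycles.

Section TreeFlexible.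
Variables (V E : Type).

Fixpoint fedges (d : dtree V E) : seq E :=
  match d with
  | Leaf => [::]
  | Flex _ e l r => e :: fedges l ++ fedges r
  | Cyc _ q r => fedges q ++ fedges r
  | Via _ _ t q => fedges t ++ fedges q
  end.

(** The cycle itself, without the walks around its vertices. *)
Fixpoint spine (d : dtree V E) : seq (V * E) :=
  if d is Via u e _ q then (u, e) :: spine q else [::].
End TreeFlexible.

Section TreeGraph.
Variables (V E : finType) (G : multigraph V E).
Implicit Types (d t q r : dtree V E) (x y v u : V) (e f : E) (c : seq (V * E)).

Lemma fedges_edges d : {subset fedges d <= edges d}.
Proof.
move=> x; elim: d => [|u e l IHl r IHr|e q IHq r IHr|u e t IHt q IHq] //=.
- rewrite !inE !mem_cat.
  by case/or3P=> [->|/IHl->|/IHr->]; rewrite ?orbT.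
- rewrite !inE !mem_cat.
  by case/orP=> [/IHq->|/IHr->]; rewrite ?orbT.
- rewrite !inE !mem_cat.
  by case/orP=> [/IHt->|/IHq->]; rewrite ?orbT.
Qed.

Lemma spine_edges q : {subset unzip2 (spine q) <= edges q}.
Proof.
move=> e; elim: q => [|||u f t _ q IH] //=.
by rewrite !inE mem_cat => /orP[->//|/IH->]; rewrite !orbT.
Qed.

Lemma fedges_subseq d : subseq (fedges d) (edges d).
Proof.
elim: d => [|u e l IHl r IHr|e q IHq r IHr|u e t IHt q IHq] //.
- by rewrite /= eqxx cat_subseq.
- exact: subseq_trans (cat_subseq IHq IHr) (subseq_cons _ _).
- exact: subseq_trans (cat_subseq IHt IHq) (subseq_cons _ _).
Qed.

Lemma count_word v d e :
  count_mem e (unzip2 (word v d)) = (count_mem e (edges d) + count_mem e (fedges d))%N.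
Proof.
elim: d v => [|u f l IHl r IHr|f q IHq r IHr|u f t IHt q IHq] v //=;
  rewrite unzip2_cat /= !count_cat /= ?IHl ?IHr ?IHt ?IHq;
  move: (nat_of_bool _) => b; do !move: (count _ _) => ?; lia.
Qed.

Lemma walk_Flex v u e l r : wf true (Flex u e l r) -> walk G (word v (Flex u e l r)) v ->
  [/\ ends G e = [set v; u], walk G (word u l) u & walk G (word v r) v].
Proof.
move=> /= /andP[wl wr] /andP[/eqP Ge]; rewrite walk_cat /= => /and3P[W1 _ W2].
split=> //; rewrite Ge hd_cat [hd (_ :: _) _]/hd /=.
by rewrite hd_word.
Qed.

Lemma walk_Cyc v e q r : wf true (Cyc e q r) -> walk G (word v (Cyc e q r)) v ->
  [/\ ends G e = [set v; hd (word v q) v], walk G (word v q) v & walk G (word v r) v].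
Proof.
move=> /= /andP[wq wr] /andP[/eqP Ge]; rewrite walk_cat hd_word // => /andP[W1 W2].
by split=> //; rewrite Ge hd_cat hd_word.
Qed.

Lemma walk_Via v u e t q : wf false (Via u e t q) -> walk G (word v (Via u e t q)) v ->
  [/\ ends G e = [set u; hd (word v q) v], walk G (word u t) u & walk G (word v q) v].
Proof.
move=> /= /andP[wt wq]; rewrite walk_cat /= => /and3P[W1 /eqP Ge W2].
by split.
Qed.

Lemma hd_word_Via v u e t q : wf true t -> hd (word v (Via u e t q)) v = u.
Proof. by move=> wt; rewrite /= hd_cat [hd (_ :: _) _]/hd /= hd_word. Qed.

Lemma spineP v q : wf false q -> walk G (word v q) v -> uniq (v :: verts q) ->
  [/\ simple_path G (spine q) v, hd (spine q) v = hd (word v q) v,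
      {subset unzip1 (spine q) <= verts q} & {subset unzip2 (spine q) <= edges q}].
Proof.
elim: q => [|||u e t IHt q IHq]; rewrite /simple_path //= => wfq W uv.
have [Ge W1 W2] := walk_Via wfq W; have /andP[wt wq] := wfq.
have uvq : uniq (v :: verts q).
  move: uv; rewrite /= !inE !mem_cat !negb_or cat_uniq.
  by case/andP=> /and3P[_ _ ->] /andP[_ /and3P[_ _ ->]].
have [sp hs s1 s2] := IHq wq W2 uvq.
have [Wsp usp] := andP sp; split.
- rewrite hs Ge eqxx Wsp usp !andbT /= mem_rcons inE negb_or.
  move: uv; rewrite /= !inE !negb_or mem_cat => /and3P[/andP[vu _] uu _].
  rewrite eq_sym vu /=; apply: contra uu => /s1.
  by rewrite mem_cat orbC => ->.
- by rewrite hd_word_Via.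
- by move=> x; rewrite !inE mem_cat => /orP[->|/s1->]; rewrite ?orbT.
- by move=> x; rewrite !inE mem_cat => /orP[->|/s2->]; rewrite ?orbT.
Qed.

Definition crosses (S : pred V) e : bool :=
  [exists x in ends G e, S x] && [exists x in ends G e, ~~ S x].

Lemma crossesE (S : pred V) e x y : ends G e = [set x; y] ->
  crosses S e = (S x != S y).
Proof.
move=> Ge; rewrite /crosses; apply/andP/idP => [[]|].
  case/exists_inP=> z; rewrite Ge !inE => /orP[] /eqP-> Sz;
  case/exists_inP=> z'; rewrite ?Ge !inE => /orP[] /eqP-> Sz';
  by move: Sz'; rewrite ?Sz // => /negPf->.
case Sx : (S x); case Sy : (S y) => // _; split; apply/exists_inP.
- by exists x; rewrite // Ge set21.
- by exists y; rewrite ?Sy // Ge set22.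
- by exists y; rewrite // Ge set22.
- by exists x; rewrite ?Sx // Ge set21.
Qed.

Lemma walk_parity (S : pred V) p y : walk G p y ->
  odd (count (crosses S) (unzip2 p)) = (S (hd p y) != S y).
Proof.
elim: p => [|[x e] p IH] /=; first by rewrite eqxx.
case/andP=> /eqP Ge Wp; rewrite oddD (crossesE S Ge) IH //.
by rewrite [hd (_ :: _) y]/hd /= oddb; case: (S x); case: (S _); case: (S y).
Qed.

Lemma cycle_parity (S : pred V) c : is_simple_cycle G c ->
  ~~ odd (count (crosses S) (unzip2 c)).
Proof.
case: c => [[[]]//|[x e] c] [/is_cycleE W _ _].
by rewrite (walk_parity S W) /hd /= eqxx.
Qed.

Lemma bridge_cut (S : pred V) e c : crosses S =1 pred1 e -> is_simple_cycle G c ->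
  e \notin unzip2 c.
Proof.
move=> Se sc; have := cycle_parity S sc; case: sc => _ _ u2.
by rewrite (eq_count Se) count_uniq_mem //; case: (e \in _).
Qed.

Lemma two_edge_cut (S : pred V) e f c : e != f -> crosses S =1 pred2 e f ->
  is_simple_cycle G c -> (e \in unzip2 c) = (f \in unzip2 c).
Proof.
move=> ef Se sc; have := cycle_parity S sc; case: sc => _ _ u2.
rewrite (eq_count Se) (@eq_count _ _ (predU (pred1 e) (pred1 f))) //.
have := count_predUI (pred1 e) (pred1 f) (unzip2 c).
rewrite (@eq_count _ (predI _ _) pred0) ?count_pred0; last first.
  by move=> g /=; case: eqP => [->|//]; apply/negbTE.
rewrite addn0 => ->; rewrite !count_uniq_mem //.
by case: (e \in _); case: (f \in _).
Qed.

(* [verts d] does not contain the base point: the edges outside d may touch d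
   there, but nowhere else. *)
Definition separated d : Prop :=
  forall f, f \notin edges d -> forall x, x \in ends G f -> x \notin verts d.

(** By [same_cycle_subset], a simple cycle Z contained in all simple cycles through e agrees with
    each of them. This form of uniqueness can be proved by cuts. *)
Definition edge_spec d e : Prop :=
  if e \in fedges d then forall c, is_simple_cycle G c -> e \notin unzip2 c
  else exists Z, [/\ is_simple_cycle G Z, e \in unzip2 Z &
    forall c, is_simple_cycle G c -> e \in unzip2 c -> {subset unzip2 Z <= unzip2 c}].

Lemma crosses_in (S : pred V) e : (forall x, x \in ends G e -> S x) -> crosses S e = false.
Proof.
move=> inS; apply/negbTE/negP => /andP[_ /exists_inP[x xe]].
by rewrite inS.
Qed.

Lemma crosses_out (S : pred V) e :
  (forall x, x \in ends G e -> ~~ S x) -> crosses S e = false.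
Proof.
move=> outS; apply/negbTE/negP => /andP[/exists_inP[x xe Sx] _].
by have := outS x xe; rewrite Sx.
Qed.

Lemma ends_in_word v d e x : walk G (word v d) v -> e \in edges d ->
  x \in ends G e -> x \in v :: verts d.
Proof.
move=> W ed xe; have e2 : e \in unzip2 (word v d) by rewrite unzip2_word.
have := walk_ends W e2 xe; rewrite mem_rcons inE => /orP[/eqP->|].
  exact: mem_head.
exact: unzip1_word.
Qed.

Lemma edge_spec_eq d d' e : (e \in fedges d) = (e \in fedges d') ->
  edge_spec d e -> edge_spec d' e.
Proof. by rewrite /edge_spec => ->. Qed.

(* For the rest q of a cycle entered through ein, whose other end is x0. *)
Definition chain_ok q := forall v ein x0,
  wf false q -> walk G (word v q) v -> uniq (v :: verts q) -> uniq (edges q) ->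
  ein \notin edges q -> ends G ein = [set x0; hd (word v q) v] -> x0 \notin verts q ->
  (forall f, f \notin edges q -> f != ein -> forall x, x \in ends G f -> x \notin verts q) ->
  (forall c, is_simple_cycle G c -> {in unzip2 (spine q), forall z, (z \in unzip2 c) = (ein \in unzip2 c)}) /\
  (forall e, e \in edges q -> e \notin unzip2 (spine q) -> edge_spec q e).

(* The vertices of the subtree l in [Flex u e l r], with u, are only connected
   to the others by e, and those of t in [Via u e t q] by the two cycle edges
   at u.  As simple cycles cross a cut evenly, they avoid e in the first case
   and contain both cycle edges or none in the second. *)
Definition closed_ok d := forall v,
  wf true d -> walk G (word v d) v -> uniq (v :: verts d) -> uniq (edges d) ->
  separated d -> forall e, e \in edges d -> edge_spec d e.

Lemma fedges_sideF d1 d2 e : uniq (edges d1 ++ edges d2) -> e \in edges d1 ->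
  (e \in fedges d2) = false.
Proof.
rewrite cat_uniq => /and3P[_ /hasPn dis _] e1.
by apply/negbTE/negP => /fedges_edges/dis; rewrite /= e1.
Qed.

Lemma fedges_sideF' d1 d2 e : uniq (edges d1 ++ edges d2) -> e \in edges d2 ->
  (e \in fedges d1) = false.
Proof.
rewrite cat_uniq => /and3P[_ /hasPn dis _] e2.
by apply/negbTE/negP => /fedges_edges e1; have := dis e e2; rewrite /= e1.
Qed.

Lemma fedges_spine q e : wf false q -> uniq (edges q) -> e \in unzip2 (spine q) ->
  e \notin fedges q.
Proof.
elim: q => [|||u f t IHt q IHq] //= /andP[wt wq] /andP[fn uq].
rewrite inE mem_cat negb_or => /orP[/eqP->|es].
  by move: fn; rewrite mem_cat negb_or => /andP[fl fr];
    rewrite (contra (@fedges_edges t f)) // (contra (@fedges_edges q f)).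
have uq2 : uniq (edges q) by move: uq; rewrite cat_uniq => /and3P[].
rewrite (IHq wq uq2 es) andbT (fedges_sideF' uq) //.
exact: spine_edges.
Qed.

Lemma hd_word_in v q : hd (word v q) v \in v :: verts q.
Proof.
have := @unzip1_word V E v q; rewrite /hd; case: (unzip1 _) => [|x s] sub /=.
  exact: mem_head.
by apply: sub; apply: mem_head.
Qed.

Lemma spec_in d d' e : e \in edges d ->
  (e \in edges d -> (e \in fedges d') = (e \in fedges d)) ->
  edge_spec d e -> edge_spec d' e.
Proof. by move=> ed /(_ ed) fE; apply: edge_spec_eq. Qed.

Lemma closed_ok_Flex u e l r : closed_ok l -> closed_ok r -> closed_ok (Flex u e l r).
Proof.
move=> IHl IHr v wd W uv ue sep f.
have [Ge W1 W2] := walk_Flex wd W; have /andP[wl wr] : wf true l && wf true r by [].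
move: uv => /= /andP[]; rewrite inE mem_cat !negb_or => /and3P[vu vl vr].
case/andP; rewrite mem_cat negb_or => /andP[ul ur]; rewrite cat_uniq.
case/and3P=> uvl /hasPn lr uvr.
move: ue => /= /andP[]; rewrite mem_cat negb_or => /andP[el er] uee.
have := uee; rewrite cat_uniq => /and3P[uel /hasPn elr uer].
have outl x : x \in v :: verts r -> x \notin verts l.
  by rewrite inE => /orP[/eqP->//|/lr].
have outr x : x \in u :: verts l -> x \notin verts r.
  by rewrite inE => /orP[/eqP->//|xl]; apply/negP => /lr/=; rewrite xl.
have outu x : x \in v :: verts r -> x != u.
  by rewrite inE => /orP[/eqP->//|xr]; apply: contraNneq ur => <-.
have inl g x : g \in edges l -> x \in ends G g -> x \in u :: verts l.
  exact: ends_in_word W1.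
have inr g x : g \in edges r -> x \in ends G g -> x \in v :: verts r.
  exact: ends_in_word W2.
have oth g x : g != e -> g \notin edges l -> g \notin edges r -> x \in ends G g ->
    [/\ x != u, x \notin verts l & x \notin verts r].
  move=> ge gl gr xg; have := sep g; rewrite /= inE mem_cat !negb_or ge gl gr.
  by move=> /(_ isT x xg); rewrite /= inE mem_cat !negb_or => /and3P[].
rewrite /= inE mem_cat => /or3P[/eqP->|fl|fr].
- rewrite /edge_spec /= mem_head => c; apply: (@bridge_cut (mem (u :: verts l))).
  move=> g; have [->|ge] := eqVneq g e.
    rewrite (crossesE _ Ge) /= !inE eqxx (negPf vu) (negPf vl) /=.
    by rewrite eqxx.
  have [gl|gl] := boolP (g \in edges l).
    rewrite crosses_in /= ?(negPf ge) // => x; exact: inl.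
  rewrite crosses_out /= ?(negPf ge) // => x xg; rewrite inE negb_or.
  have [gr|gr] := boolP (g \in edges r); last by have [-> ->] := oth g x ge gl gr xg.
  by rewrite outu ?outl //; apply: inr xg.
- have sepl : separated l.
    move=> g gl x xg; have [ge|ge] := eqVneq g e.
      by move: xg; rewrite ge Ge !inE => /orP[]/eqP->.
    have [gr|gr] := boolP (g \in edges r); first by apply: outl; apply: inr xg.
    by have [] := oth g x ge gl gr xg.
  have ul' : uniq (u :: verts l) by rewrite /= ul.
  apply: (spec_in fl _ (IHl u wl W1 ul' uel sepl f fl)) => _.
  rewrite /= inE mem_cat (fedges_sideF uee fl) orbF.
  by case: eqP => [fe|//]; rewrite -fe fl in el.
- have sepr : separated r.
    move=> g gr x xg; have [ge|ge] := eqVneq g e.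
      by move: xg; rewrite ge Ge !inE => /orP[]/eqP->.
    have [gl|gl] := boolP (g \in edges l); first by apply: outr; apply: inl xg.
    by have [] := oth g x ge gl gr xg.
  have uv' : uniq (v :: verts r) by rewrite /= vr.
  apply: (spec_in fr _ (IHr v wr W2 uv' uer sepr f fr)) => _.
  rewrite /= inE mem_cat (fedges_sideF' uee fr).
  by case: eqP => [fe|//]; rewrite -fe fr in er.
Qed.

Lemma closed_ok_Cyc e q r : chain_ok q -> closed_ok r -> closed_ok (Cyc e q r).
Proof.
move=> IHq IHr v wd W uv ue sep f.
have [Ge W1 W2] := walk_Cyc wd W; have /andP[wq wr] : wf false q && wf true r by [].
move: uv => /= /andP[]; rewrite mem_cat negb_or => /andP[vq vr]; rewrite cat_uniq.
case/and3P=> uvq /hasPn qr uvr.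
move: ue => /= /andP[]; rewrite mem_cat negb_or => /andP[eq er] uee.
have := uee; rewrite cat_uniq => /and3P[ueq /hasPn eqr uer].
have uvq' : uniq (v :: verts q) by rewrite /= vq.
have uvr' : uniq (v :: verts r) by rewrite /= vr.
have outq x : x \in v :: verts r -> x \notin verts q.
  by rewrite inE => /orP[/eqP->//|/qr].
have outr x : x \in v :: verts q -> x \notin verts r.
  by rewrite inE => /orP[/eqP->//|xl]; apply/negP => /qr/=; rewrite xl.
have inq g x : g \in edges q -> x \in ends G g -> x \in v :: verts q.
  exact: ends_in_word W1.
have inr g x : g \in edges r -> x \in ends G g -> x \in v :: verts r.
  exact: ends_in_word W2.
have oth g x : g != e -> g \notin edges q -> g \notin edges r -> x \in ends G g ->
    x \notin verts q /\ x \notin verts r.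
  move=> ge gl gr xg; have := sep g; rewrite /= inE mem_cat !negb_or ge gl gr.
  by move=> /(_ isT x xg); rewrite /= mem_cat !negb_or => /andP[].
have [|cyc inner] := IHq v e v wq W1 uvq' ueq eq Ge vq.
  move=> g gq ge x xg; have [gr|gr] := boolP (g \in edges r).
    by apply: outq; apply: inr xg.
  by have [] := oth g x ge gq gr xg.
have [sp hs s1 s2] := spineP wq W1 uvq'.
have sZ : is_simple_cycle G ((v, e) :: spine q).
  by apply: simple_path_cycle => //; [rewrite hs|apply: contra eq => /s2].
(* By [cyc], the edges of this cycle lie in a simple cycle all together or not at all. *)
have specZ g : g \in unzip2 ((v, e) :: spine q) -> g \notin fedges (Cyc e q r) ->
    edge_spec (Cyc e q r) g.
  move=> gZ /negPf fg; rewrite /edge_spec fg; exists ((v, e) :: spine q).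
  split=> // c sc gc h hZ.
  have cE z : z \in unzip2 ((v, e) :: spine q) -> (z \in unzip2 c) = (e \in unzip2 c).
    by rewrite /= inE => /orP[/eqP->//|]; apply: cyc.
  by rewrite cE // -(cE g).
rewrite /= inE mem_cat => /or3P[/eqP->|fq|fr].
- apply: specZ; first exact: mem_head.
  rewrite /= mem_cat negb_or (contra (@fedges_edges q e)) //.
  by rewrite (contra (@fedges_edges r e)).
- have [fs|fs] := boolP (f \in unzip2 (spine q)).
    apply: specZ; first by rewrite /= inE fs orbT.
    by rewrite /= mem_cat negb_or fedges_spine //= (fedges_sideF uee fq).
  apply: (spec_in fq _ (inner f fq fs)) => _.
  by rewrite /= mem_cat (fedges_sideF uee fq) orbF.
- have sepr : separated r.
    move=> g gr x xg; have [ge|ge] := eqVneq g e.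
      apply: outr; move: xg; rewrite ge Ge !inE => /orP[/eqP->|/eqP->].
        by rewrite eqxx.
      by have := hd_word_in v q; rewrite inE.
    have [gl|gl] := boolP (g \in edges q); first by apply: outr; apply: inq xg.
    by have [] := oth g x ge gl gr xg.
  apply: (spec_in fr _ (IHr v wr W2 uvr' uer sepr f fr)) => _.
  by rewrite /= mem_cat (fedges_sideF' uee fr).
Qed.

Lemma chain_ok_Via u e t q : closed_ok t -> chain_ok q -> chain_ok (Via u e t q).
Proof.
move=> IHt IHq v ein x0 wd W uv ue ine Gin x0d sep.
have [Ge W1 W2] := walk_Via wd W; have /andP[wt wq] : wf true t && wf false q by [].
rewrite hd_word_Via // in Gin.
move: uv => /= /andP[]; rewrite inE mem_cat !negb_or => /and3P[vu vt vq].
case/andP; rewrite mem_cat negb_or => /andP[ut uq]; rewrite cat_uniq.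
case/and3P=> uvt /hasPn tq uvq.
move: ue => /= /andP[]; rewrite mem_cat negb_or => /andP[et eq] uee.
have := uee; rewrite cat_uniq => /and3P[uet /hasPn etq ueq].
move: ine; rewrite /= inE mem_cat !negb_or => /and3P[ine it iq].
move: x0d; rewrite /= inE mem_cat !negb_or => /and3P[x0u x0t x0q].
have uvq' : uniq (v :: verts q) by rewrite /= vq.
have uvt' : uniq (u :: verts t) by rewrite /= ut.
have outt x : x \in v :: verts q -> x \notin verts t.
  by rewrite inE => /orP[/eqP->//|/tq].
have outu x : x \in v :: verts q -> x != u.
  by rewrite inE => /orP[/eqP->//|xr]; apply: contraNneq uq => <-.
have outq x : x \in u :: verts t -> x \notin verts q.
  by rewrite inE => /orP[/eqP->//|xl]; apply/negP => /tq/=; rewrite xl.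
have int g x : g \in edges t -> x \in ends G g -> x \in u :: verts t.
  exact: ends_in_word W1.
have inq g x : g \in edges q -> x \in ends G g -> x \in v :: verts q.
  exact: ends_in_word W2.
have hq := hd_word_in v q.
have oth g x : g != e -> g != ein -> g \notin edges t -> g \notin edges q -> x \in ends G g ->
    [/\ x != u, x \notin verts t & x \notin verts q].
  move=> ge gi gt gq xg; have := sep g; rewrite /= inE mem_cat !negb_or ge gt gq.
  by move=> /(_ isT gi x xg); rewrite /= inE mem_cat !negb_or => /and3P[].
have [|cyc inner] := IHq v e u wq W2 uvq' ueq eq Ge uq.
  move=> g gq ge x xg; have [gi|gi] := eqVneq g ein.
    by move: xg; rewrite gi Gin !inE => /orP[]/eqP->.
  have [gt|gt] := boolP (g \in edges t); first by apply: outq; apply: int xg.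
  by have [] := oth g x ge gi gt gq xg.
have cut c : is_simple_cycle G c -> (e \in unzip2 c) = (ein \in unzip2 c).
  move=> sc; apply/esym/(@two_edge_cut (mem (u :: verts t))) => // g.
  rewrite /=; have [->|gi] := eqVneq g ein.
    rewrite (crossesE _ Gin) /= !inE eqxx (negPf x0u) (negPf x0t) /=.
    by [].
  have [->|ge] := eqVneq g e.
    rewrite (crossesE _ Ge) /= !inE eqxx (negPf (outu _ hq)) (negPf (outt _ hq)) /=.
    by [].
  have [gt|gt] := boolP (g \in edges t).
    by rewrite crosses_in // => x; apply: int.
  rewrite crosses_out // => x xg /=; rewrite inE negb_or.
  have [gq|gq] := boolP (g \in edges q); last by have [-> ->] := oth g x ge gi gt gq xg.
  by rewrite outu ?outt //; apply: inq xg.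
split=> [c sc z|f].
  by rewrite /= inE => /orP[/eqP->|zs]; rewrite ?(cyc c sc z zs) cut.
rewrite /= inE mem_cat => /or3P[/eqP->|ft|fq]; rewrite inE negb_or.
- by rewrite eqxx.
- move=> _; have sept : separated t.
    move=> g gt x xg; have [ge|ge] := eqVneq g e.
      by move: xg; rewrite ge Ge !inE => /orP[]/eqP-> //; apply: outt.
    have [gi|gi] := eqVneq g ein.
      by move: xg; rewrite gi Gin !inE => /orP[]/eqP->.
    have [gq|gq] := boolP (g \in edges q); first by apply: outt; apply: inq xg.
    by have [] := oth g x ge gi gt gq xg.
  apply: (spec_in ft _ (IHt u wt W1 uvt' uet sept f ft)) => _.
  by rewrite /= mem_cat (fedges_sideF uee ft) orbF.
- case/andP=> _ fs; apply: (spec_in fq _ (inner f fq fs)) => _.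
  by rewrite /= mem_cat (fedges_sideF' uee fq).
Qed.

Lemma tree_ok d : closed_ok d /\ chain_ok d.
Proof.
elim: d => [|u e l [IHl _] r [IHr _]|e q [_ IHq] r [IHr _]|u e t [IHt _] q [_ IHq]].
- by split=> [v|v ein x0].
- by split; [apply: closed_ok_Flex|move=> ? ? ? []].
- by split; [apply: closed_ok_Cyc|move=> ? ? ? []].
- by split; [move=> ? []|apply: chain_ok_Via].
Qed.

Section WholeGraph.
Variables (v : V) (d : dtree V E).
Hypotheses (wd : wf true d) (uv : uniq (v :: verts d)) (ue : uniq (edges d))
  (W : walk G (word v d) v) (allE : forall e, e \in edges d)
  (allV : forall x, x \in v :: verts d).

Lemma tree_edge_spec e : edge_spec d e.
Proof.
have [ok _] := tree_ok d; apply: (ok v) => //.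
by move=> f; rewrite allE.
Qed.

Lemma tree_rigid e : rigid G e = (e \notin fedges d).
Proof.
have := tree_edge_spec e; rewrite /edge_spec; case: ifP => fe /=.
  by move=> nc; apply/asboolP => -[c sc]; apply/negP/nc.
by move=> [Z [sZ eZ _]]; apply/asboolP; exists Z.
Qed.

Lemma tree_connected : connected G.
Proof.
pose R := fun x y => [exists e, ends G e == [set x; y]].
have path_conn p y : walk G p y -> connect R (hd p y) y.
  elim: p => [|[x e] p IH] /=; first by rewrite connect0.
  case/andP=> Ge Wp; apply: connect_trans (IH Wp); apply: connect1.
  by apply/existsP; exists e.
have hv : hd (word v d) v = v by apply: hd_word.
move=> x y; apply: (@connect_trans _ _ v).
  have [|pb [Wb hb _]] := walk_suffix W (y := x).
    have := allV x; rewrite inE mem_rcons inE => /orP[->//|/verts_word->].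
    by rewrite orbT.
  by rewrite -hb; apply: path_conn.
have [|pa [Wa ha _]] := walk_prefix W (y := y).
  have := allV y; rewrite inE mem_rcons inE => /orP[->//|/verts_word->].
  by rewrite orbT.
by rewrite hv in ha; rewrite -{1}ha; apply: path_conn.
Qed.

Lemma tree_cactus : is_cactus G.
Proof.
split=> [|e c c' sc sc' ec ec']; first exact: tree_connected.
have := tree_edge_spec e; rewrite /edge_spec; case: ifP => fe.
  by move=> nc; have := nc c sc; rewrite ec.
move=> [Z [sZ eZ subZ]].
have Zc := same_cycle_subset sc sZ (subZ c sc ec).
have Zc' := same_cycle_subset sc' sZ (subZ c' sc' ec').
apply: (@same_cycle_subset _ _ G) => // f.
by rewrite (same_cycle_edges Zc') (same_cycle_edges Zc).
Qed.

Lemma tree_outercycle : d <> Leaf -> is_outercycle G (word v d).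
Proof.
move=> dn; split=> [|e].
  apply: (closed_walk_cycle _ W); last exact: hd_word.
  by case: (d) dn wd.
rewrite count_word tree_rigid count_uniq_mem // allE.
rewrite (count_uniq_mem _ (subseq_uniq (fedges_subseq d) ue)).
by case: (e \in fedges d).
Qed.
End WholeGraph.
End TreeGraph.

(** * Weights and degrees *)

Section TreeWeights.
Variables (V E : Type).
Implicit Types d : dtree V E.
Variables (K : comNzRingType) (lam : nat -> K).

(* The weight 4 of a flexible edge is 2^2, from 2^(2 f_C). *)
Fixpoint weight (b : bool) k d : K :=
  match d with
  | Leaf => if b then lam k else 1
  | Flex _ _ l r => 4%:R * (weight true 1 l * weight true k.+1 r)
  | Cyc _ q r => weight false 0 q * weight true k.+2 r
  | Via _ _ t q => weight true 2 t * weight false 0 q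
  end.

(** The factor 2 is the one that a rigid first edge leaves: see [g_stat_tree]. *)
Definition top_weight d : K :=
  if d is Cyc _ _ _ then 2%:R * weight true 0 d else weight true 0 d.

End TreeWeights.

Section TreeDegrees.
Variables (V : eqType) (E : Type).
Implicit Types (d : dtree V E) (x v u : V).

(** Half-edges are charged to nodes: [Via] pays for both cycle edges at u, also for the one entering
    u, and [Cyc] for both cycle edges at v. *)
Fixpoint tree_degree v d x : nat :=
  match d with
  | Leaf => 0
  | Flex u _ l r => (x == v) + (x == u) + tree_degree u l x + tree_degree v r x
  | Cyc _ q r => 2 * (x == v) + tree_degree v q x + tree_degree v r x
  | Via u _ t q => 2 * (x == u) + tree_degree u t x + tree_degree v q x
  end%N.

Lemma tree_degree0 b v d x : wf b d -> x \notin verts d -> ~~ b || (x != v) ->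
  tree_degree v d x = 0%N.
Proof.
elim: d b v => [|u e l IHl r IHr|e q IHq r IHr|u e t IHt q IHq] [] v //=.
- case/andP=> wl wr; rewrite inE mem_cat !negb_or => /and3P[xu xl xr] xv.
  by rewrite (negPf xu) (negPf xv) (IHl true) // (IHr true).
- case/andP=> wq wr; rewrite mem_cat !negb_or => /andP[xq xr] xv.
  by rewrite (negPf xv) (IHq false) // (IHr true).
- case/andP=> wt wq; rewrite inE mem_cat !negb_or => /and3P[xu xt xq] _.
  by rewrite (negPf xu) (IHt true) // (IHq false).
Qed.

Variables (K : comNzRingType) (lam : nat -> K).

(** The k half-edges spent earlier at the base point v add to its degree. In the rest of a cycle v
    is left out of the product: its factor comes from the closed walk that goes on from v. *)
Lemma weightE d :
  (forall v k, wf true d -> uniq (v :: verts d) ->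
    weight lam true k d = 4%:R ^+ size (fedges d) *
      \prod_(x <- v :: verts d) lam (tree_degree v d x + (x == v) * k)%N) /\
  (forall v, wf false d -> uniq (v :: verts d) ->
    weight lam false 0 d = 4%:R ^+ size (fedges d) *
      \prod_(x <- verts d) lam (tree_degree v d x)).
Proof.
elim: d => [|u e l [IHl _] r [IHr _]|e q [_ IHq] r [IHr _]|u e t [IHt _] q [_ IHq]];
  split=> //.
- by move=> v k _ _; rewrite big_seq1 eqxx mul1n mul1r.
- by move=> v _ _; rewrite big_nil mulr1.
- move=> v k /= /andP[wl wr] /andP[]; rewrite inE mem_cat !negb_or => /and3P[vu vl vr].
  case/andP; rewrite mem_cat negb_or => /andP[ul ur]; rewrite cat_uniq.
  case/and3P=> uvl /hasPn lr uvr.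
  rewrite (IHl u 1%N) //= ?ul // (IHr v k.+1) //= ?vr // size_cat !big_cons big_cat /=.
  rewrite !eqxx (negPf vu) [u == v]eq_sym (negPf vu) exprS exprD.
  have -> : tree_degree u l v = 0%N by apply: tree_degree0 wl vl _; rewrite vu.
  have -> : tree_degree v r u = 0%N by apply: tree_degree0 wr ur _; rewrite eq_sym vu.
  rewrite [in RHS](eq_big_seq (fun x => lam (tree_degree u l x + (x == u) * 1)%N)); last first.
    move=> x xl; have xr : x \notin verts r by apply/negP => /lr/=; rewrite xl.
    have xu : x != u by apply: contraNneq ul => <-.
    have xv : x != v by apply: contraNneq vl => <-.
    by rewrite (negPf xu) (negPf xv) (tree_degree0 wr xr) ?xv // !addn0 add0n.
  rewrite [X in _ = _ * (_ * (_ * (_ * X)))](eq_big_seq (fun x => lam (tree_degree v r x + (x == v) * k.+1)%N)); last first.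
    move=> x xr; have xl := lr x xr.
    have xu : x != u by apply: contraNneq ur => <-.
    have xv : x != v by apply: contraNneq vr => <-.
    by rewrite (negPf xu) (negPf xv) (tree_degree0 wl xl) ?xu // !addn0 !add0n.
  have -> : (true + false + 0 + tree_degree v r v + true * k =
    tree_degree v r v + true * k.+1)%N by clear; lia.
  have -> : (false + true + tree_degree u l u + 0 + false * k =
    tree_degree u l u + true * 1)%N by clear; lia.
  ring.
- move=> v k /= /andP[wq wr] /andP[]; rewrite mem_cat !negb_or => /andP[vq vr].
  rewrite cat_uniq => /and3P[uvq /hasPn qr uvr].
  rewrite (IHq v) //= ?vq // (IHr v k.+2) //= ?vr // size_cat !big_cons big_cat /=.
  rewrite !eqxx exprD (tree_degree0 (v := v) wq vq) //.
  rewrite [in RHS](eq_big_seq (fun x => lam (tree_degree v q x))); last first.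
    move=> x xq; have xr : x \notin verts r by apply/negP => /qr/=; rewrite xq.
    have xv : x != v by apply: contraNneq vq => <-.
    by rewrite (negPf xv) (tree_degree0 wr xr) ?xv // !addn0 add0n.
  rewrite [X in _ = _ * (_ * (_ * X))](eq_big_seq (fun x => lam (tree_degree v r x + (x == v) * k.+2)%N)); last first.
    move=> x xr; have xq := qr x xr.
    have xv : x != v by apply: contraNneq vr => <-.
    by rewrite (negPf xv) (tree_degree0 wq xq) // !addn0 !add0n.
  have -> : (2 * true + 0 + tree_degree v r v + true * k = tree_degree v r v + true * k.+2)%N by lia.
  ring.
- move=> v /= /andP[wt wq] /andP[]; rewrite inE mem_cat !negb_or => /and3P[vu vt vq].
  case/andP; rewrite mem_cat negb_or => /andP[ut uq]; rewrite cat_uniq.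
  case/and3P=> uvt /hasPn tq uvq.
  rewrite (IHt u 2%N) //= ?ut // (IHq v) //= ?vq // size_cat !big_cons big_cat /=.
  rewrite !eqxx exprD (tree_degree0 (v := v) wq uq) //.
  rewrite [in RHS](eq_big_seq (fun x => lam (tree_degree u t x + (x == u) * 2)%N)); last first.
    move=> x xt; have xq : x \notin verts q by apply/negP => /tq/=; rewrite xt.
    have xu : x != u by apply: contraNneq ut => <-.
    by rewrite (negPf xu) (tree_degree0 wq xq) // !addn0.
  rewrite [X in _ = _ * (_ * (_ * X))](eq_big_seq (fun x => lam (tree_degree v q x))); last first.
    move=> x xq; have xt := tq x xq.
    have xu : x != u by apply: contraNneq uq => <-.
    by rewrite (negPf xu) (tree_degree0 wt xt) ?xu // add0n.
  have -> : (2 * true + tree_degree u t u + 0 = tree_degree u t u + true * 2)%N by clear; lia.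
  ring.
Qed.
End TreeDegrees.

Section GraphDegrees.
Variables (V E : finType) (G : multigraph V E).
Implicit Types (d : dtree V E) (x v u : V) (e : E).

Definition edge_degree e x : nat :=
  if x \in ends G e then (if #|ends G e| == 1 then 2 else 1)%N else 0%N.

Lemma edge_degreeE e x p q : ends G e = [set p; q] ->
  edge_degree e x = ((x == p) + (x == q))%N.
Proof.
rewrite /edge_degree => ->; rewrite cards2 !inE.
have [->|pq] := eqVneq p q; first by case: eqP.
have [->|_] := eqVneq x p; first by rewrite (negPf pq).
by case: eqP.
Qed.

(** In the rest of a cycle, the half-edge entering its first vertex is charged to d but belongs to
    an edge outside d, and the half-edge arriving at v lies in d but is charged to [Cyc]. Hence the
    two correction terms. *)
Lemma sum_edge_degree d :
  (forall v x, wf true d -> walk G (word v d) v ->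
    (\sum_(e <- edges d) edge_degree e x = tree_degree v d x)%N) /\
  (forall v x, wf false d -> walk G (word v d) v ->
    (\sum_(e <- edges d) edge_degree e x + (x == hd (word v d) v) =
     tree_degree v d x + (x == v))%N).
Proof.
elim: d => [|u e l [IHl _] r [IHr _]|e q [_ IHq] r [IHr _]|u e t [IHt _] q [_ IHq]];
  split=> //.
- by move=> v x _ _; rewrite big_nil.
- by move=> v x _ _; rewrite big_nil.
- move=> v x wd W; have [Ge W1 W2] := walk_Flex wd W; have /andP[wl wr] : wf true l && wf true r by [].
  by rewrite /= big_cons big_cat /= (edge_degreeE _ Ge) (IHl u) // (IHr v) // !addnA.
- move=> v x wd W; have [Ge W1 W2] := walk_Cyc wd W; have /andP[wq wr] : wf false q && wf true r by [].
  rewrite /= big_cons big_cat /= (edge_degreeE _ Ge) (IHr v) //.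
  by have := IHq v x wq W1; clear; lia.
- move=> v x wd W; have [Ge W1 W2] := walk_Via wd W; have /andP[wt wq] : wf true t && wf false q by [].
  rewrite hd_word_Via // /= big_cons big_cat /= (edge_degreeE _ Ge) (IHt u) //.
  by have := IHq v x wq W2; clear; lia.
Qed.

Section WholeGraph.
Variables (v : V) (d : dtree V E).
Hypotheses (wd : wf true d) (uv : uniq (v :: verts d)) (ue : uniq (edges d))
  (W : walk G (word v d) v) (allE : forall e, e \in edges d)
  (allV : forall x, x \in v :: verts d).

Lemma degree_tree x : degree G x = tree_degree v d x.
Proof.
have [<- // _] := sum_edge_degree d.
rewrite /degree big_mkcond /=; apply: perm_big; apply: uniq_perm; rewrite ?index_enum_uniq // => e.
by rewrite mem_index_enum allE.
Qed.

(** Since f_C leaves out e_1, the exponent is 2 (f_C + 1) for a flexible e_1, twice the number of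
    flexible edges, and 2 f_C + 1 for a rigid one. *)
Lemma g_stat_tree : d <> Leaf ->
  (g_stat G (word v d)).+1 = ((if d is Cyc _ _ _ then 1 else 0) + 2 * size (fedges d))%N.
Proof.
have rE := tree_rigid wd uv ue W allE.
have uf : uniq (fedges d) := subseq_uniq (fedges_subseq d) ue.
case: d wd uv ue allE allV W rE uf => [|u e l r|e q r|u e t q] //= _ _ ue' _ _ _ rE uf _.
- rewrite /flexible rE mem_head /=.
  have -> : f_stat G ((v, e) :: word u l ++ (u, e) :: word v r) = size (fedges l ++ fedges r).
    rewrite /f_stat -(card_uniqP _); last by case/andP: uf.
    apply: eq_card => f; rewrite !inE /flexible rE negbK inE /=.
    have [->|fe] := eqVneq f e; first by rewrite eqxx andbF; case/andP: uf => /negPf->.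
    by rewrite andbC /=; case: eqP => [[]|//] ef; rewrite ef eqxx in fe.
  lia.
- have ef : e \in fedges q ++ fedges r = false.
    case/andP: ue' => eqr _; apply/negbTE; apply: contra eqr.
    by rewrite !mem_cat => /orP[] /fedges_edges->; rewrite ?orbT.
  rewrite /flexible rE ef /=.
  have -> : f_stat G ((v, e) :: word v q ++ word v r) = size (fedges q ++ fedges r).
    rewrite /f_stat -(card_uniqP _) //.
    apply: eq_card => f; rewrite !inE /flexible rE negbK /=.
    have [->|fe] := eqVneq f e; first by rewrite ef.
    by rewrite andbC /=; case: eqP => [[]|//] fe'; rewrite fe' eqxx in fe.
  lia.
Qed.

Lemma graph_weight (K : comNzRingType) (lam : nat -> K) : d <> Leaf ->
  2%:R ^+ (g_stat G (word v d)).+1 * \prod_(x : V) lam (degree G x) = top_weight lam d.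
Proof.
move=> dn; rewrite g_stat_tree //.
have -> : \prod_(x : V) lam (degree G x) =
    \prod_(x <- v :: verts d) lam (tree_degree v d x + (x == v) * 0)%N.
  under eq_bigr do rewrite degree_tree.
  rewrite [RHS](eq_bigr (fun x => lam (tree_degree v d x))); last first.
    by move=> x _; rewrite muln0 addn0.
  apply: perm_big; apply: uniq_perm; rewrite ?index_enum_uniq // => x.
  by rewrite mem_index_enum allV.
have [WE _] := weightE lam d; rewrite /top_weight (WE v 0%N wd uv).
have four : 2%:R ^+ (2 * size (fedges d)) = 4%:R ^+ size (fedges d) :> K.
  by rewrite exprM; congr (_ ^+ _); rewrite -natrX.
case: d dn four => [|u e l r|e q r|u e t q] // _ four; rewrite ?add0n ?four //.
by rewrite add1n exprS four mulrA.
Qed.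
End WholeGraph.
End GraphDegrees.

(** * Oriented cacti and trees *)

Section ParseUniqueness.
Variables V E : eqType.
Implicit Types (d : dtree V E) (p s w : seq (V * E)) (u v : V) (e : E).

Lemma split_last_inj p p' s s' u e e' : u \notin unzip1 s -> u \notin unzip1 s' ->
  p ++ (u, e) :: s = p' ++ (u, e') :: s' -> [/\ p = p', e = e' & s = s'].
Proof.
move=> us us'; elim: p p' => [|a p IH] [|a' p'] /=.
- by case.
- case=> _ sE; move: us; rewrite sE unzip1_cat mem_cat /= inE eqxx orbT.
  by [].
- case=> _ sE; move: us'; rewrite -sE unzip1_cat mem_cat /= inE eqxx orbT.
  by [].
- by case=> -> /IH[-> -> ->].
Qed.

Lemma split_first_inj p p' s s' u u' e : e \notin unzip2 p -> e \notin unzip2 p' ->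
  p ++ (u, e) :: s = p' ++ (u', e) :: s' -> [/\ p = p', u = u' & s = s'].
Proof.
elim: p p' => [|a p IH] [|a' p'] /=.
- by move=> _ _ [].
- by move=> _ ep' [aE _]; move: ep'; rewrite -aE /= inE eqxx.
- by move=> ep _ [aE _]; move: ep; rewrite aE /= inE eqxx.
- rewrite !inE !negb_or => /andP[_ ep] /andP[_ ep'] [-> /IH H].
  by have [//|//|-> -> ->] := H _ _.
Qed.

Lemma uniq_cons_cat (T : eqType) (x : T) (s1 s2 : seq T) : uniq (x :: s1 ++ s2) ->
  [/\ x \notin s1, x \notin s2, uniq s1, uniq s2 & forall y, y \in s1 -> y \notin s2].
Proof.
rewrite /= mem_cat negb_or cat_uniq => /andP[/andP[-> ->] /and3P[-> /hasPn dis ->]].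
by split=> // y y1; apply/negP => /dis; rewrite /= y1.
Qed.

Lemma uniq_cons2_cat (T : eqType) (x y : T) (s1 s2 : seq T) :
  uniq (x :: y :: s1 ++ s2) ->
  [/\ uniq (y :: s1), uniq (x :: s2), x != y, y \notin s2 & forall z, z \in s1 -> z \notin s2].
Proof.
move=> /= /andP[]; rewrite inE mem_cat !negb_or => /and3P[xy x1 x2].
by case/uniq_cons_cat => /= -> -> -> -> dis; rewrite x2.
Qed.

(** The word can be parsed in one way only. A first edge that returns marks [Flex], which is cut at
    this return; a [Via] is cut at the last visit of its vertex. The rest of a cycle carries no end
    mark, hence the continuations w and w', which are empty or start at v and avoid the vertices
    already used. *)
Lemma word_inj d :
  (forall v d', wf true d -> wf true d' -> uniq (v :: verts d) -> uniq (edges d) ->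
    uniq (v :: verts d') -> uniq (edges d') -> word v d = word v d' -> d = d') /\
  (forall v d' w w', wf false d -> wf false d' -> uniq (v :: verts d) -> uniq (edges d) ->
    uniq (v :: verts d') -> uniq (edges d') -> hd w v = v -> hd w' v = v ->
    (forall x, x \in unzip1 w -> x \notin verts d) ->
    (forall x, x \in unzip1 w' -> x \notin verts d') ->
    word v d ++ w = word v d' ++ w' -> d = d' /\ w = w').
Proof.
have hdVia u e t q w (v : V) : wf true t -> hd (word v (Via u e t q) ++ w) v = u.
  by move=> wt; rewrite /= -catA hd_cat [hd (_ :: _) _]/hd /= hd_word.
have nFC (v : V) u e l r q r' : uniq (edges (Cyc e q r')) ->
    word v (Flex u e l r) = word v (Cyc e q r') -> False.
  move=> /uniq_cons_cat[eq er _ _ _] /= [wE].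
  have : e \in unzip2 (word v q ++ word v r').
    by rewrite -wE unzip2_cat mem_cat /= inE eqxx orbT.
  by rewrite unzip2_cat mem_cat !unzip2_word (negPf eq) (negPf er).
elim: d => [|u e l [IHl _] r [IHr _]|e q [_ IHq] r [IHr _]|u e t [IHt _] q [_ IHq]];
  split=> //.
- by move=> v [].
- move=> v [|?|?|u e t q] w w' //= _ /andP[wt wq] _ _ /andP[vu _] _ hw hw' _ _ wE.
  move: vu; rewrite inE negb_or => /andP[/eqP vu _]; case: vu.
  by rewrite -{1}hw wE; apply: hdVia.
- move=> v [|u' e' l' r'|e' q' r'|? ? ? ?] // /and3P[_ wl wr] /and3P[_ wl' wr'].
  + move=> /uniq_cons2_cat[ul ur _ _ _] /uniq_cons_cat[el er uel uer _].
    move=> /uniq_cons2_cat[ul' ur' _ _ _] /uniq_cons_cat[el' er' uel' uer' _].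
    move=> [ee]; subst e' => wE.
    have [||lE uE rE] := split_first_inj _ _ wE; rewrite ?unzip2_word //.
    by subst u'; rewrite (IHl _ _ wl wl' _ _ _ _ lE) // (IHr _ _ wr wr' _ _ _ _ rE).
  + move=> _ _ _ ue' wE; have ee : e = e' by case: wE.
    by subst e'; case: (nFC _ _ _ _ _ _ _ ue' wE).
- move=> v [|u' e' l' r'|e' q' r'|? ? ? ?] // /and3P[_ wq wr] /and3P[_ wq' wr'].
  + move=> _ ue _ _ wE; have ee : e' = e by case: wE.
    by subst e'; case: (nFC _ _ _ _ _ _ _ ue (esym wE)).
  + move=> /uniq_cons_cat[vq vr uvq uvr dv] /uniq_cons_cat[_ _ ueq uer _].
    move=> /uniq_cons_cat[vq' vr' uvq' uvr' dv'] /uniq_cons_cat[_ _ ueq' uer' _] [ee wE].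
    have out (q1 r1 : dtree V E) x : v \notin verts q1 ->
        (forall y, y \in verts q1 -> y \notin verts r1) ->
        x \in unzip1 (word v r1) -> x \notin verts q1.
      move=> vq1 d1 /unzip1_word; rewrite inE => /orP[/eqP->//|x1].
      by apply/negP => /d1; rewrite x1.
    have [||||||||qE rE] := IHq v q' _ _ wq wq' _ _ _ _ _ _ _ _ wE;
      rewrite /= ?vq ?vq' ?hd_word //; try by move=> x; apply: out.
    by subst e' q'; rewrite (IHr v r') //= ?vr ?vr'.
- move=> v [|?|?|u' e' t' q'] w w' // /and3P[_ wt wq].
  + move=> _ /andP[vu _] _ _ _ hw hw' _ _ wE.
    move: vu; rewrite inE negb_or => /andP[/eqP vu _]; case: vu.
    by rewrite -{1}hw' -[w']/(word v Leaf ++ w') -wE hdVia.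
  + move=> /and3P[_ wt' wq'] /uniq_cons2_cat[ut uq vu uq0 dv] /uniq_cons_cat[_ _ uet ueq _].
    move=> /uniq_cons2_cat[ut' uq' _ uq0' dv'] /uniq_cons_cat[_ _ uet' ueq' _].
    move=> hw hw' ow ow' wE; have uE : u = u'.
      by rewrite -(hdVia u e t q w v wt) wE hdVia.
    subst u'; move: wE; rewrite /= -!catA /= => wE.
    have nu (q1 : dtree V E) w1 : u \notin verts q1 -> u \notin unzip1 w1 ->
        u \notin unzip1 (word v q1 ++ w1).
      move=> u1 uw; rewrite unzip1_cat mem_cat negb_or uw andbT.
      by apply/negP => /unzip1_word; rewrite inE eq_sym (negPf vu) (negPf u1).
    have uw : u \notin unzip1 w by apply/negP => /ow; rewrite /= mem_head.
    have uw' : u \notin unzip1 w' by apply/negP => /ow'; rewrite /= mem_head.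
    have [tE eE sE] := split_last_inj (nu _ _ uq0 uw) (nu _ _ uq0' uw') wE.
    have [] // := IHq v q' w w' wq wq' uq ueq uq' ueq' hw hw' _ _ sE.
    + by move=> x /ow; rewrite /= inE mem_cat !negb_or => /and3P[].
    + by move=> x /ow'; rewrite /= inE mem_cat !negb_or => /and3P[].
    by move=> -> ->; rewrite (IHt u t') // eE.
Qed.
End ParseUniqueness.

(** * Isomorphism classes of oriented cacti as unlabelled trees *)

Section Shapes.
Fixpoint dmap (V E V' E' : Type) (g : V -> V') (h : E -> E') (d : dtree V E) : dtree V' E' :=
  match d with
  | Leaf => Leaf
  | Flex u e l r => Flex (g u) (h e) (dmap g h l) (dmap g h r)
  | Cyc e q r => Cyc (h e) (dmap g h q) (dmap g h r)
  | Via u e t q => Via (g u) (h e) (dmap g h t) (dmap g h q)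
  end.

Definition tree := dtree unit unit.
Definition shape (V E : Type) : dtree V E -> tree := dmap (fun=> tt) (fun=> tt).

Variables (V E V' E' : Type) (g : V -> V') (h : E -> E').
Implicit Types d : dtree V E.

Lemma wf_dmap b d : wf b (dmap g h d) = wf b d.
Proof.
by elim: d b => [|u e l IHl r IHr|e q IHq r IHr|u e t IHt q IHq] b //=;
  rewrite ?IHl ?IHr ?IHt ?IHq.
Qed.

Lemma word_dmap v d :
  word (g v) (dmap g h d) = [seq (g x.1, h x.2) | x <- word v d].
Proof.
by elim: d v => [|u e l IHl r IHr|e q IHq r IHr|u e t IHt q IHq] v //=;
  rewrite map_cat /= ?IHl ?IHr ?IHt ?IHq.
Qed.

Lemma verts_dmap d : verts (dmap g h d) = map g (verts d).
Proof.
by elim: d => [|u e l IHl r IHr|e q IHq r IHr|u e t IHt q IHq] //=;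
  rewrite map_cat /= ?IHl ?IHr ?IHt ?IHq.
Qed.

Lemma edges_dmap d : edges (dmap g h d) = map h (edges d).
Proof.
by elim: d => [|u e l IHl r IHr|e q IHq r IHr|u e t IHt q IHq] //=;
  rewrite map_cat /= ?IHl ?IHr ?IHt ?IHq.
Qed.

Lemma shape_dmap d : shape (dmap g h d) = shape d.
Proof.
rewrite /shape; elim: d => [|u e l IHl r IHr|e q IHq r IHr|u e t IHt q IHq] //=;
  by rewrite ?IHl ?IHr ?IHt ?IHq.
Qed.

Lemma size_verts_shape d : size (verts d) = size (verts (shape d)).
Proof.
rewrite /shape; elim: d => [|u e l IHl r IHr|e q IHq r IHr|u e t IHt q IHq] //=;
  by rewrite !size_cat ?IHl ?IHr ?IHt ?IHq.
Qed.

Lemma size_edges_shape d : size (edges d) = size (edges (shape d)).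
Proof.
rewrite /shape; elim: d => [|u e l IHl r IHr|e q IHq r IHr|u e t IHt q IHq] //=;
  by rewrite !size_cat ?IHl ?IHr ?IHt ?IHq.
Qed.
End Shapes.

Lemma weight_shape (V E : Type) (K : comNzRingType) (lam : nat -> K) b k (d : dtree V E) :
  weight lam b k (shape d) = weight lam b k d.
Proof.
rewrite /shape.
by elim: d b k => [|u e l IHl r IHr|e q IHq r IHr|u e t IHt q IHq] b k //=;
  rewrite ?IHl ?IHr ?IHt ?IHq.
Qed.

Lemma top_weight_shape (V E : Type) (K : comNzRingType) (lam : nat -> K) (d : dtree V E) :
  top_weight lam (shape d) = top_weight lam d.
Proof.
have := weight_shape lam true 0 d.
by case: d => [|u e l r|e q r|u e t q] //= ->.
Qed.

Lemma dmap_same_shape (V E V' E' : Type) (g : V -> V') (h : E -> E')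
    (d : dtree V E) (d' : dtree V' E') : shape d = shape d' ->
  map g (verts d) = verts d' -> map h (edges d) = edges d' -> dmap g h d = d'.
Proof.
have catE (T : Type) (s1 s1' s2 s2' : seq T) : size s1 = size s1' ->
    s1 ++ s2 = s1' ++ s2' -> s1 = s1' /\ s2 = s2'.
  move=> sz sE; split; first by rewrite -(take_size_cat s2 sz) sE take_size_cat.
  by rewrite -(drop_size_cat s2 sz) sE drop_size_cat.
have szv (d1 : dtree V E) (d2 : dtree V' E') : shape d1 = shape d2 ->
    size (map g (verts d1)) = size (verts d2).
  by move=> sh; rewrite size_map size_verts_shape sh -size_verts_shape.
have sze (d1 : dtree V E) (d2 : dtree V' E') : shape d1 = shape d2 ->
    size (map h (edges d1)) = size (edges d2).
  by move=> sh; rewrite size_map size_edges_shape sh -size_edges_shape.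
elim: d d' => [|u e l IHl r IHr|e q IHq r IHr|u e t IHt q IHq] [|u' e' l' r'|e' q' r'|u' e' t' q'] //.
- case=> shl shr /= []; rewrite !map_cat => -> /(catE _ _ _ _ _ (szv _ _ shl))[v1 v2].
  by case=> -> /(catE _ _ _ _ _ (sze _ _ shl))[e1 e2]; rewrite (IHl l') // (IHr r').
- case=> shl shr /=; rewrite !map_cat => /(catE _ _ _ _ _ (szv _ _ shl))[v1 v2].
  by case=> -> /(catE _ _ _ _ _ (sze _ _ shl))[e1 e2]; rewrite (IHq q') // (IHr r').
- case=> shl shr /= []; rewrite !map_cat => -> /(catE _ _ _ _ _ (szv _ _ shl))[v1 v2].
  by case=> -> /(catE _ _ _ _ _ (sze _ _ shl))[e1 e2]; rewrite (IHt t') // (IHq q').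
Qed.

Section TreeGraphs.
Variables (V E : finType).

Record tree_graph (G : multigraph V E) (v : V) (d : dtree V E) : Prop := TreeGraph {
  tg_wf : wf true d;
  tg_nonempty : d <> Leaf;
  tg_verts : uniq (v :: verts d);
  tg_edges : uniq (edges d);
  tg_walk : walk G (word v d) v;
  tg_allE : forall e, e \in edges d;
  tg_allV : forall x, x \in v :: verts d }.

Lemma tree_graph_cactus G v d : tree_graph G v d ->
  is_cactus G /\ is_outercycle G (word v d).
Proof.
case=> wd dn uv ue W aE aV; split; first exact: (tree_cactus wd uv ue W aE aV).
exact: tree_outercycle.
Qed.

Lemma cactus_tree_graph (G : multigraph V E) c : (0 < #|E|)%N ->
  is_cactus G -> is_outercycle G c ->
  exists v d, tree_graph G v d /\ c = word v d.
Proof.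
move=> /card_gt0P[e0 _] cG oc; have [v [d [wd cE uv ue]]] := cactus_word cG oc.
have [[c0 cyc] nc] := oc; have [conG _] := cG.
exists v, d; split=> //.
have dn : d <> Leaf by move=> dL; rewrite cE dL in c0.
have W : walk G (word v d) v.
  move: (conj c0 cyc) wd; rewrite cE.
  by case: (d) dn => [|u e l r|e q r|u e t q] //= _ /is_cycleE.
have aE e : e \in edges d.
  by rewrite -(unzip2_word v) -cE -has_pred1 has_count nc; case: ifP.
split=> // x; have [e xe] : exists e, x \in ends G e.
  have /forallP/(_ e0)/andP[/card_gt0P[w we] _] := endsP G.
  have /connectP[[|y p]] := conG x w; first by move=> _ /= <-; exists e0.
  by case/andP=> /existsP[e /eqP xy] _ _; exists e; rewrite xy set21.
exact: ends_in_word W (aE e) xe.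
Qed.

(** The endpoints that the edges must have for [word v d] to be a walk: see [walk_edge_ends]. *)
Fixpoint edge_ends v (d : dtree V E) : seq (E * (V * V)) :=
  match d with
  | Leaf => [::]
  | Flex u e l r => (e, (v, u)) :: edge_ends u l ++ edge_ends v r
  | Cyc e q r => (e, (v, hd (word v q) v)) :: edge_ends v q ++ edge_ends v r
  | Via u e t q => (e, (u, hd (word v q) v)) :: edge_ends u t ++ edge_ends v q
  end.

Lemma unzip1_edge_ends v d : unzip1 (edge_ends v d) = edges d.
Proof.
by elim: d v => [|u e l IHl r IHr|e q IHq r IHr|u e t IHt q IHq] v //=;
  rewrite /unzip1 map_cat -!/(unzip1 _) ?IHl ?IHr ?IHt ?IHq.
Qed.

Lemma walk_edge_ends (G : multigraph V E) b v d : wf b d ->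
  (forall e p q, (e, (p, q)) \in edge_ends v d -> ends G e = [set p; q]) ->
  walk G (word v d) v.
Proof.
elim: d b v => [|u e l IHl r IHr|e q IHq r IHr|u e t IHt q IHq] b v //=.
- case/and3P=> _ wl wr H; rewrite walk_cat hd_cat /= [hd (_ :: _) v]/hd /=.
  rewrite !hd_word // (H e v u) ?mem_head // [[set u; v]]setUC !eqxx /=.
  by rewrite (IHl true u) ?(IHr true v) // => f p q fI; apply: H;
     rewrite inE mem_cat fI ?orbT.
- case/and3P=> _ wq wr H; rewrite walk_cat hd_cat hd_word //.
  rewrite (H e v (hd (word v q) v)) ?mem_head // eqxx /=.
  by rewrite (IHq false v) ?(IHr true v) // => f p q' fI; apply: H;
     rewrite inE mem_cat fI ?orbT.
- case/and3P=> _ wt wq H; rewrite walk_cat /= [hd (_ :: _) v]/hd /=.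
  rewrite (H e u (hd (word v q) v)) ?mem_head // eqxx /=.
  by rewrite (IHt true u) ?(IHq false v) // => f p q' fI; apply: H;
     rewrite inE mem_cat fI ?orbT.
Qed.

Lemma tree_graph_exists v d : wf true d -> d <> Leaf -> uniq (v :: verts d) ->
  uniq (edges d) -> (forall e, e \in edges d) -> (forall x, x \in v :: verts d) ->
  exists G, tree_graph G v d.
Proof.
move=> wd dn uv ue aE aV.
(* The edges of d are distinct, so looking up endpoints by position is consistent. *)
pose look e := nth (v, v) (unzip2 (edge_ends v d)) (index e (edges d)).
pose f := [ffun e : E => [set (look e).1; (look e).2]].
have fP : [forall e, 0 < #|f e| <= 2]%N.
  by apply/forallP => e; rewrite ffunE cards2; case: eqP.
exists (Multigraph fP); split=> //; apply: (walk_edge_ends wd) => e p q epq.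
rewrite ffunE /look; set s := edge_ends v d in epq *.
have us : uniq (unzip1 s) by rewrite unzip1_edge_ends.
have is_ : (index (e, (p, q)) s < size s)%N by rewrite index_mem.
have -> : index e (edges d) = index (e, (p, q)) s.
  rewrite -(unzip1_edge_ends v) -/s.
  have {1}-> : e = nth e (unzip1 s) (index (e, (p, q)) s).
    by rewrite (nth_map (e, (p, q))) // nth_index.
  by rewrite index_uniq // size_map.
by rewrite (nth_map (e, (p, q))) // nth_index.
Qed.
End TreeGraphs.

Section ShapeIso.
Variables (V E V' E' : finType) (G : multigraph V E) (G' : multigraph V' E').

Lemma map_nth_index (S T : eqType) (x0 : T) (s : seq S) (t : seq T) : uniq s ->
  size s = size t -> [seq nth x0 t (index x s) | x <- s] = t.
Proof.
move=> us st; apply: (@eq_from_nth _ x0); first by rewrite size_map.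
move=> i; rewrite size_map => is_; case: s us st is_ => [//|y s] us st is_.
by rewrite (nth_map y) // index_uniq.
Qed.

Lemma nth_index_bij (S T : finType) (x0 : T) (y0 : S) (s : seq S) (t : seq T) :
  uniq s -> uniq t -> size s = size t -> (forall x, x \in s) -> (forall y, y \in t) ->
  bijective (fun x => nth x0 t (index x s)).
Proof.
move=> us ut st aS aT; exists (fun y => nth y0 s (index y t)) => [x|y].
  by rewrite index_uniq -?st ?index_mem // nth_index.
by rewrite index_uniq ?st ?index_mem // nth_index.
Qed.

(** A walk displays the endpoints of its edges. A relabelling that carries a walk through all edges
    to a walk therefore respects the graphs. *)
Lemma walk_map_ends (g : V -> V') (h : E -> E') (p : seq (V * E)) y e :
  walk G p y -> walk G' [seq (g x.1, h x.2) | x <- p] (g y) -> e \in unzip2 p ->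
  ends G' (h e) = g @: ends G e.
Proof.
elim: p => [|[x f] p IH] //= /andP[/eqP Gf Wp] /andP[/eqP Gf' Wp'].
rewrite inE => /orP[/eqP->|]; last exact: IH.
rewrite Gf' Gf imsetU1 imset_set1; congr [set _; _].
by case: (p).
Qed.

Lemma shape_iso v d v' d' : tree_graph G v d -> tree_graph G' v' d' ->
  shape d = shape d' -> oriented_iso G (word v d) G' (word v' d').
Proof.
move=> [wd dn uv ue W aE aV] [wd' dn' uv' ue' W' aE' aV'] sh.
have szv : size (v :: verts d) = size (v' :: verts d').
  by rewrite /= size_verts_shape sh -size_verts_shape.
have sze : size (edges d) = size (edges d').
  by rewrite size_edges_shape sh -size_edges_shape.
have [e0 e0'] : E * E'.
  by case: (d) (d') dn dn' sh => [|? e ? ?|e ? ?|? e ? ?] [|? e' ? ?|e' ? ?|? e' ? ?].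
(* Vertices and edges are matched by their positions in the two trees. *)
pose g x := nth v' (v' :: verts d') (index x (v :: verts d)).
pose h e := nth e0' (edges d') (index e (edges d)).
have /= [gv gd] : map g (v :: verts d) = v' :: verts d' by apply: map_nth_index.
have hd_ : map h (edges d) = edges d' by apply: map_nth_index.
have dE : dmap g h d = d' by apply: dmap_same_shape.
have wE : word v' d' = [seq (g x.1, h x.2) | x <- word v d].
  by rewrite -word_dmap dE gv.
exists g, h; split=> //.
- exact: nth_index_bij.
- exact: nth_index_bij.
- move=> e; apply: (walk_map_ends (y := v) W); first by rewrite -wE gv.
  by rewrite unzip2_word.
Qed.

(** The transported tree and d' spell the same word, so they are equal by [word_inj]. *)
Lemma iso_shape v d v' d' : tree_graph G v d -> tree_graph G' v' d' ->
  oriented_iso G (word v d) G' (word v' d') -> shape d = shape d'.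
Proof.
move=> [wd dn uv ue W aE aV] [wd' dn' uv' ue' W' aE' aV'] [g [h [bg bh _]]].
rewrite -word_dmap => wE.
have gv : v' = g v.
  have hdv (U F : Type) (x y : U) (t : dtree U F) : wf true t -> t <> Leaf -> hd (word x t) y = x.
    by case: t.
  rewrite -(hdv _ _ v' v' d') // wE hdv // ?wf_dmap //.
  by case: (d) dn.
have [inj _] := word_inj d'.
rewrite -(shape_dmap g h d); congr shape; symmetry; apply: (inj v') => //.
- by rewrite wf_dmap.
- by rewrite gv verts_dmap -map_cons (map_inj_uniq (bij_inj bg)).
- by rewrite edges_dmap (map_inj_uniq (bij_inj bh)).
- by rewrite [in RHS]gv.
Qed.
End ShapeIso.

(** Numbering in preorder turns [verts] and [edges] into intervals. *)
Fixpoint number (i j : nat) (t : tree) : dtree nat nat :=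
  match t with
  | Leaf => Leaf
  | Flex _ _ l r => Flex i j (number i.+1 j.+1 l)
      (number (i.+1 + size (verts l)) (j.+1 + size (edges l)) r)
  | Cyc _ q r => Cyc j (number i j.+1 q)
      (number (i + size (verts q)) (j.+1 + size (edges q)) r)
  | Via _ _ t q => Via i j (number i.+1 j.+1 t)
      (number (i.+1 + size (verts t)) (j.+1 + size (edges t)) q)
  end.

Lemma verts_number i j t : verts (number i j t) = iota i (size (verts t)).
Proof.
by elim: t i j => [|u e l IHl r IHr|e q IHq r IHr|u e t IHt q IHq] i j //=;
  rewrite ?IHl ?IHr ?IHt ?IHq size_cat iotaD.
Qed.

Lemma edges_number i j t : edges (number i j t) = iota j (size (edges t)).
Proof.
by elim: t i j => [|u e l IHl r IHr|e q IHq r IHr|u e t IHt q IHq] i j //=;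
  rewrite ?IHl ?IHr ?IHt ?IHq size_cat iotaD.
Qed.

Lemma shape_number i j t : shape (number i j t) = t.
Proof.
rewrite /shape; elim: t i j => [|[] [] l IHl r IHr|[] q IHq r IHr|[] [] t IHt q IHq] i j //=;
  by rewrite ?IHl ?IHr ?IHt ?IHq.
Qed.

Lemma map_inord_iota n : map (@inord n) (iota 0 n.+1) = enum 'I_n.+1.
Proof.
rewrite -val_enum_ord -map_comp -[RHS]map_id.
by apply: eq_map => i /=; rewrite inord_val.
Qed.

Lemma tree_realization n (t : tree) : wf true t -> size (edges t) = n.+1 ->
  exists (V : finType) (G : multigraph V 'I_n.+1) v d,
    tree_graph G v d /\ shape d = t.
Proof.
move=> wt st; pose m := size (verts t).
(* Vertex numbers start at 1, since 0 is the base point. *)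
pose d : dtree 'I_m.+1 'I_n.+1 := dmap inord inord (number 1 0 t).
have vE : inord 0 :: verts d = enum 'I_m.+1.
  by rewrite verts_dmap verts_number -map_inord_iota.
have eE : edges d = enum 'I_n.+1.
  by rewrite edges_dmap edges_number st map_inord_iota.
have sh : shape d = t by rewrite shape_dmap shape_number.
have [||||||G tg] := @tree_graph_exists _ _ (inord 0) d.
- by move: wt; rewrite -{1}sh wf_dmap.
- by move=> dL; rewrite -sh dL in st.
- by rewrite vE enum_uniq.
- by rewrite eE enum_uniq.
- by move=> e; rewrite eE mem_enum.
- by move=> x; rewrite vE mem_enum.
by exists 'I_m.+1, G, (inord 0), d.
Qed.

HB.instance Definition _ (V E : Type) := gen_eqMixin (dtree V E).

(** * Enumeration of the trees *)

Section TreeLists.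

(** Every constructor has a right subtree of the kind b of the whole and a left one of some kind c,
    so one recursion lists both kinds of trees. A chain has c = true only. *)
Definition node (b c : bool) (l r : tree) : tree :=
  if b then if c then Flex tt tt l r else Cyc tt l r else Via tt tt l r.

(* The trees of kind b with n edges; k is fuel, any k >= n will do. *)
Fixpoint trees_rec (k : nat) (b : bool) (n : nat) : seq tree :=
  match k, n with
  | _, 0 => [:: Leaf]
  | 0, _ => [::]
  | k'.+1, n'.+1 =>
    flatten [seq flatten [seq [seq node b c l r |
        l <- trees_rec k' c i, r <- trees_rec k' b (n' - i)] |
      i <- iota 0 n'.+1] |
    c <- if b then [:: true; false] else [:: true]]
  end.

Definition trees b n := trees_rec n b n.

Lemma trees_recS k b n : trees_rec k.+1 b n.+1 =
  flatten [seq flatten [seq [seq node b c l r |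
      l <- trees_rec k c i, r <- trees_rec k b (n - i)] | i <- iota 0 n.+1] |
    c <- if b then [:: true; false] else [:: true]].
Proof. by []. Qed.

Lemma trees_recE k k' b n : (n <= k)%N -> (n <= k')%N -> trees_rec k b n = trees_rec k' b n.
Proof.
elim: k k' b n => [|k IH] [|k'] b [|n] // nk nk'; rewrite !trees_recS.
congr (flatten _); apply: eq_map => c; congr (flatten _).
apply/eq_in_map => i; rewrite mem_iota add0n => /andP[_ ilt].
by rewrite (IH k' c) 1?(IH k' b) //; lia.
Qed.

Lemma trees0 b : trees b 0 = [:: Leaf].
Proof. by []. Qed.

Lemma treesS b n : trees b n.+1 =
  flatten [seq flatten [seq [seq node b c l r | l <- trees c i, r <- trees b (n - i)] |
      i <- iota 0 n.+1] |
    c <- if b then [:: true; false] else [:: true]].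
Proof.
rewrite /trees trees_recS; congr (flatten _); apply: eq_map => c; congr (flatten _).
apply/eq_in_map => i; rewrite mem_iota add0n => /andP[_ ilt].
by rewrite (@trees_recE n i c i) ?(@trees_recE n (n - i) b (n - i)) //; lia.
Qed.

Lemma wf_node b c l r : (if b then true else c) -> wf b (node b c l r) = wf c l && wf b r.
Proof. by case: b c => [] []. Qed.

Lemma size_node b c l r : size (edges (node b c l r)) = (size (edges l) + size (edges r)).+1.
Proof. by case: b c => [] [] /=; rewrite size_cat. Qed.

Lemma node_inj b c c' l l' r r' : (if b then true else c && c') ->
  node b c l r = node b c' l' r' -> [/\ c = c', l = l' & r = r'].
Proof. by case: b c c' => [] [] [] //= _ []. Qed.

Lemma mem_trees b n t : (t \in trees b n) = wf b t && (size (edges t) == n).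
Proof.
elim/ltn_ind: n b t => -[|n] IH b t.
  rewrite trees0 inE; apply/eqP/andP => [->//|[wt]].
  by case: t wt => [|[] [] l r|[] q r|[] [] t q].
rewrite treesS; apply/flatten_mapP/idP => [[c cb]|].
  case/flatten_mapP=> i.
  rewrite mem_iota add0n => /andP[_ ilt] /allpairsP[[l r] [/= lt rt ->]].
  rewrite IH // in lt; rewrite IH in rt; last by lia.
  rewrite wf_node; last by case: (b) cb; case: (c).
  case/andP: lt => -> /eqP lE; case/andP: rt => -> /eqP rE.
  by rewrite size_node lE rE /=; apply/eqP; lia.
case/andP=> wt /eqP st.
have [c [l [r [cb tE]]]] : exists c l r,
    (c \in (if b then [:: true; false] else [:: true])) /\ t = node b c l r.
  case: t wt st => [//|[] [] l r|[] q r|[] [] t q]; case: b => // _ _.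
  - by exists true, l, r.
  - by exists false, q, r.
  - by exists true, t, q.
have cb' : if b then true else c by case: (b) cb; case: (c).
move: wt st; rewrite tE wf_node // size_node => /andP[wl wr] [st].
exists c => //; apply/flatten_mapP; exists (size (edges l)).
  by rewrite mem_iota add0n /= ltnS -st leq_addr.
apply/allpairsP; exists (l, r); split=> //=; rewrite IH ?wl ?wr ?eqxx //.
- by rewrite ltnS -st leq_addr.
- by apply/eqP; rewrite -st addKn.
- by rewrite ltnS leq_subr.
Qed.

Lemma uniq_flatten_map (S T : eqType) (f : S -> seq T) (s : seq S) : uniq s ->
  (forall x, x \in s -> uniq (f x)) ->
  (forall x y z, x \in s -> y \in s -> z \in f x -> z \in f y -> x = y) ->
  uniq (flatten [seq f x | x <- s]).
Proof.
elim: s => [//|x s IH] /= /andP[xs us] uf dis; rewrite cat_uniq uf ?mem_head //=.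
rewrite IH ?andbT //; last 2 first.
- by move=> y ys; apply: uf; rewrite inE ys orbT.
- by move=> y y' z ys ys'; apply: dis; rewrite inE ?ys ?ys' orbT.
apply/hasPn => z /flatten_mapP[y ys zy]; apply/negP => /= zx.
by move: xs; rewrite (dis x y z) ?ys ?mem_head // inE ys orbT.
Qed.

Lemma uniq_trees b n : uniq (trees b n).
Proof.
elim/ltn_ind: n b => -[|n] IH b //; rewrite treesS.
have cond c c' : c \in (if b then [:: true; false] else [:: true]) ->
    c' \in (if b then [:: true; false] else [:: true]) -> if b then true else c && c'.
  by case: (b) c c' => [] [] [].
apply: uniq_flatten_map; first by case: (b).
  move=> c cb; apply: uniq_flatten_map; first exact: iota_uniq.
    move=> i; rewrite mem_iota add0n => /andP[_ ilt].
    apply: allpairs_uniq; [by apply: IH|by apply: IH; lia|].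
    by move=> [l r] [l' r'] _ _ /= /(node_inj (cond c c cb cb))[_ -> ->].
  move=> i j z; rewrite !mem_iota !add0n => /andP[_ ilt] /andP[_ jlt].
  move=> /allpairsP[[l r] [/= lt _ ->]] /allpairsP[[l' r'] [/= lt' _]].
  case/(node_inj (cond c c cb cb)) => _ lE _; subst l'.
  by move: lt lt'; rewrite !mem_trees => /andP[_ /eqP->] /andP[_ /eqP].
move=> c c' z cb cb' /flatten_mapP[i _ /allpairsP[[l r] [_ _ ->]]].
by case/flatten_mapP=> j _ /allpairsP[[l' r'] [_ _ /(node_inj (cond c c' cb cb'))[]]].
Qed.

Variables (K : comNzRingType) (lam : nat -> K).

(** The coefficients of F_k for b = true and, with k = 0, of Q for b = false. *)
Definition wsum b k n : K := \sum_(t <- trees b n) weight lam b k t.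

Lemma big_trees b n (W : tree -> K) : \sum_(t <- trees b n.+1) W t =
  \sum_(c <- if b then [:: true; false] else [:: true])
   \sum_(i < n.+1) \sum_(l <- trees c i) \sum_(r <- trees b (n - i)) W (node b c l r).
Proof.
rewrite treesS big_flatten big_map; apply: eq_bigr => c _.
rewrite big_flatten big_map -(big_mkord xpredT (fun i =>
  \sum_(l <- trees c i) \sum_(r <- trees b (n - i)) W (node b c l r))).
by rewrite /index_iota subn0; apply: eq_bigr => i _; rewrite big_allpairs_dep.
Qed.

Lemma wsum0 b k : wsum b k 0 = if b then lam k else 1.
Proof. by rewrite /wsum trees0 big_seq1. Qed.

Lemma wsumT n k : wsum true k n.+1 = \sum_(i < n.+1)
  (4%:R * (wsum true 1 i * wsum true k.+1 (n - i)) +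
   wsum false 0 i * wsum true k.+2 (n - i)).
Proof.
rewrite /wsum big_trees big_cons big_seq1 -big_split; apply: eq_bigr => i _ /=.
by rewrite !big_distrlr /= !big_distrr /=; congr (_ + _); apply: eq_bigr => l _;
  rewrite ?big_distrr.
Qed.

Lemma wsumF n : wsum false 0 n.+1 = \sum_(i < n.+1)
  wsum true 2 i * wsum false 0 (n - i).
Proof.
rewrite /wsum big_trees big_seq1; apply: eq_bigr => i _ /=.
by rewrite big_distrlr.
Qed.

Lemma top_wsum n : \sum_(t <- trees true n.+1) top_weight lam t = \sum_(i < n.+1)
  (4%:R * (wsum true 1 i * wsum true 1 (n - i)) +
   2%:R * (wsum false 0 i * wsum true 2 (n - i))).
Proof.
rewrite /wsum big_trees big_cons big_seq1 -big_split; apply: eq_bigr => i _ /=.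
by rewrite !big_distrlr /= !big_distrr /=; congr (_ + _); apply: eq_bigr => l _;
  rewrite ?big_distrr.
Qed.
End TreeLists.

(** * The sum over oriented cacti *)

Section OrientedCactiSum.
Variables (K : comNzRingType) (lam : nat -> K) (n : nat).
Implicit Types x y : oriented_graph n.+1.

Definition has_shape x (t : tree) : Prop :=
  exists v d, [/\ tree_graph (og_graph x) v d, og_cycle x = word v d & shape d = t].

Lemma OCG_cactus x : x \in OCG n.+1 ->
  is_cactus (og_graph x) /\ is_outercycle (og_graph x) (og_cycle x).
Proof.
have trP := transversalP (equivalence_partitionP (@og_iso_equiv n.+1)).
move=> /(subsetP (transversal_sub trP)); rewrite inE => /asboolP.
by [].
Qed.

Lemma OCG_has_shape x : x \in OCG n.+1 -> exists t, has_shape x t.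
Proof.
move=> /OCG_cactus[cG oc]; have [|v [d [tg cE]]] := cactus_tree_graph _ cG oc.
  by rewrite card_ord.
by exists (shape d), v, d.
Qed.

(** Equal shapes give isomorphic cacti, and [OCG] has one element in each class. *)
Lemma OCG_shape_inj x y t : x \in OCG n.+1 -> y \in OCG n.+1 ->
  has_shape x t -> has_shape y t -> x = y.
Proof.
move=> xO yO [v [d [tg cE sh]]] [v' [d' [tg' cE' sh']]].
have [cG oc] := OCG_cactus xO.
have [|z [_ uz]] := OCG_complete (isT : 0 < n.+1)%N _ cG oc; first by rewrite card_ord.
rewrite -(uz x); last by split=> //; apply: oriented_iso_refl.
apply: uz; split=> //; rewrite cE cE'.
by apply: shape_iso => //; rewrite sh sh'.
Qed.

Lemma OCG_shape_surj t : wf true t -> size (edges t) = n.+1 ->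
  exists2 x, x \in OCG n.+1 & has_shape x t.
Proof.
move=> wt st; have [V [G [v [d [tg sh]]]]] := tree_realization wt st.
have [cG oc] := tree_graph_cactus tg.
have [|x [[xO iso] _]] := OCG_complete (isT : 0 < n.+1)%N _ cG oc; first by rewrite card_ord.
exists x => //; have [t' [v' [d' [tg' cE sh']]]] := OCG_has_shape xO.
exists v', d'; split=> //; rewrite -sh; symmetry; apply: (iso_shape tg tg').
by rewrite -cE.
Qed.

Lemma OCG_sum : \sum_(x in OCG n.+1)
    2%:R ^+ (g_stat (og_graph x) (og_cycle x)).+1 *
    \prod_(v : 'I_(tag x)) lam (degree (og_graph x) v) =
  \sum_(t <- trees true n.+1) top_weight lam t.
Proof.
have /choice[sh shP] x : exists t, x \in OCG n.+1 -> has_shape x t.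
  have [xO|xO] := boolP (x \in OCG n.+1); last by exists Leaf.
  by have [t ht] := OCG_has_shape xO; exists t.
transitivity (\sum_(x in OCG n.+1) top_weight lam (sh x)).
  apply: eq_bigr => x /shP[v [d [tg cE <-]]].
  rewrite top_weight_shape cE.
  by case: tg => wd dn uv ue W aE aV; apply: graph_weight.
rewrite -big_enum -(big_map sh xpredT (top_weight lam)) /=.
apply: perm_big; apply: uniq_perm; last 1 first.
- move=> t; rewrite mem_trees; apply/mapP/andP => [[x]|[wt /eqP st]].
    rewrite mem_enum => xO ->; have [v [d [[wd dn uv ue W aE aV] _ <-]]] := shP x xO.
    rewrite wf_dmap wd -size_edges_shape; split=> //; apply/eqP.
    have /uniq_perm -/(_ (enum 'I_n.+1) (enum_uniq _)) p := ue.
    rewrite (perm_size (p _)) ?size_enum_ord // => e.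
    by rewrite aE mem_enum.
  have [x xO hx] := OCG_shape_surj wt st; exists x; first by rewrite mem_enum.
  have [v [d [tg cE <-]]] := hx; have [v' [d' [tg' cE' <-]]] := shP x xO.
  apply: (iso_shape tg tg'); rewrite -cE -cE'; exact: oriented_iso_refl.
- rewrite map_inj_in_uniq ?enum_uniq // => x y; rewrite !mem_enum => xO yO sE.
  by apply: (OCG_shape_inj xO yO (shP x xO)); rewrite sE; apply: shP.
- exact: uniq_trees.
Qed.
End OrientedCactiSum.

Theorem proposition1p16 (R : realType) (A : algType R[i]) (phi : {scalar A})
    (phi1 : phi 1 = 1) (a s : A)
    (free_as : free_pair phi a s) (semi_s : semicircular phi s) :
  (forall m : nat, odd m -> kappa phi m (a * s + s * a) = 0) /\
  (forall n : nat, (0 < n)%N ->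
     kappa phi (2 * n)%N (a * s + s * a) =
     \sum_(x in OCG n)
        2 ^+ (g_stat (og_graph x) (og_cycle x)).+1 *
        \prod_(v : 'I_(tag x)) kappa phi (degree (og_graph x) v) a).
Proof.
(* The weighted tree counts meet the recursions required of F and Q. *)
have cumulantE N := anticommutator_cumulant phi1 free_as semi_s
  (F := wsum (fun d => kappa phi d a) true) (Q := wsum (fun d => kappa phi d a) false 0)
  (fun d => wsum0 _ true d) (fun d n => wsumT _ n d) (wsum0 _ false 0) (wsumF _) N.
split=> [[//|N] oN|[//|n] _]; first by rewrite cumulantE oN.
rewrite (OCG_sum (fun d => kappa phi d a)) top_wsum; have -> : (2 * n.+1 = (2 * n).+2)%N by lia.
by rewrite cumulantE /= mul2n odd_double /= uphalf_double.
Qed.
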